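(* Let $X$ be a smooth connected variety over $\mathbb{C}$, $n>2$ an integer, $g_n\in H^1(X,\mathcal{G}_n)$, and $g_{n-1}\in H^1(X,\mathcal{G}_{n-1})$, $g_2\in H^1(X,\mathcal{G}_2)$ the images of $g_n$. Let $Y$ be the primitive double scheme defined by $g_2$, and $L$ its associated line bundle on $X$. Let $\rho_n:\mathcal{G}_n\to\mathcal{G}_{n-1}$ be the canonical morphism. Then $$\ker(\rho_n)^{g_{n-1}}\simeq(\Omega_{Y|X})^*\otimes L^{n-1}.$$
   Context: For an open $U\subset X$ and $m\geq 1$, $\mathcal{G}_m(U)$ is the group of automorphisms of the $\mathbb{C}$-algebra $\mathcal{O}_X(U)[t]/(t^m)$ which induce the identity on its quotient $\mathcal{O}_X(U)$ by the ideal $(t)$; the canonical morphisms $\mathcal{G}_m\to\mathcal{G}_{m-1}$ are given by reduction modulo $t^{m-1}$. A primitive multiple scheme with support $X$ ($d=\dim X$) is a Cohen-Macaulay scheme $Y$ over $\mathbb{C}$ with $Y_{red}=X$ such that every closed point of $X$ has a neighbourhood in $Y$ which is a locally closed subscheme of a smooth variety of dimension $d+1$. Its multiplicity is the smallest $m$ with $\mathcal{I}_X^m=0$, $\mathcal{I}_X$ being the ideal sheaf of $X$ in $Y$ (double scheme: $m=2$), and its associated line bundle is $L=\mathcal{I}_X/\mathcal{I}_X^2$. A primitive multiple scheme of multiplicity $m$ is locally isomorphic to $U\times\mathbf{Z}_m$, $\mathbf{Z}_m=\mathrm{Spec}(\mathbb{C}[t]/(t^m))$, by an isomorphism inducing the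 identity on $U$; given such isomorphisms $\delta_i$ over an open cover $(U_i)$, $\delta_{ij}^*=\delta_i^{*-1}\delta_j^*$ is a cocycle of $\mathcal{G}_m$, and this identifies $H^1(X,\mathcal{G}_m)$ with the set of isomorphism classes of primitive multiple schemes of multiplicity $m$ with support $X$. The sheaf of groups $\ker(\rho_n)$ is commutative, and $\mathcal{G}_n$ acts on it by conjugation; this action factors through $\mathcal{G}_{n-1}$. The twisted sheaf $\ker(\rho_n)^{g_{n-1}}$ is obtained by gluing the sheaves $\ker(\rho_n)_{|U_i}$ by means of the automorphisms of $\ker(\rho_n)_{|U_{ij}}$ defined by the action of $\delta_{ij}^*$, where $(\delta_{ij}^* )$ is a cocycle representing $g_{n-1}$: its sections are families $(\gamma_i)$, $\gamma_i\in\ker(\rho_n)(U_i)$, with $\gamma_i=\delta_{ij}^*\cdot\gamma_j$. $\Omega_{Y|X}$ denotes the restriction to $X$ of the sheaf of differentials $\Omega_Y$. *)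

(* Defs.v *)
From HB Require Import structures.
From mathcomp Require Import all_boot all_order all_algebra.
From mathcomp Require Import all_classical all_reals topology.
From mathcomp Require Import complex.

Set Implicit Arguments.
Unset Strict Implicit.
Unset Printing Implicit Defensive.
Import GRing.Theory.

Local Open Scope classical_set_scope.
Local Open Scope ring_scope.

Lemma rmorphism_ext (A B : pzSemiRingType) (f g : {rmorphism A -> B}) :
  (forall a, f a = g a) -> f = g.
Proof.
move=> /funext; case: f g => [f [[f1] [f2]]] [g [[g1] [g2]]] /= fg.
by subst g; rewrite (Prop_irrelevance f1 g1) ?(Prop_irrelevance f2 g2).
Qed.

(* A[t]/(t^m), an element being the sequence of its m coefficients. It is not a
   quotient of {poly A}, which excludes the zero ring. *)
Definition tpoly (m : nat) (A : comPzRingType) := {ffun 'I_m -> A}.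

Section TruncatedPolynomials.
Variables (m : nat) (A : comPzRingType).
Implicit Types a b c : tpoly m A.

HB.instance Definition _ := GRing.Zmodule.copy (tpoly m A) {ffun 'I_m -> A}.

Definition tconst (x : A) : tpoly m A :=
  [ffun i : 'I_m => if i == 0 :> nat then x else 0].

Definition tmul a b : tpoly m A :=
  [ffun k : 'I_m => \sum_(i < m) \sum_(j < m | (i + j)%N == k :> nat) a i * b j].

Let mulC : commutative tmul.
Proof.
move=> a b; apply/ffunP => k; rewrite !ffunE.
under eq_bigr do rewrite big_mkcond.
under [RHS]eq_bigr do rewrite big_mkcond.
rewrite exchange_big; apply: eq_bigr => i _; apply: eq_bigr => j _.
by rewrite addnC mulrC.
Qed.

Let mulA : associative tmul.
Proof.
have red a b c l : (tmul (tmul a b) c) l =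
    \sum_(i < m) \sum_(j < m) \sum_(k < m)
      if (i + j + k)%N == l :> nat then a i * b j * c k else 0.
  rewrite ffunE.
  transitivity (\sum_(p < m) \sum_(i < m) \sum_(j < m) \sum_(k < m)
     if ((p + k)%N == l :> nat) && ((i + j)%N == p :> nat) then a i * b j * c k
     else 0).
    apply: eq_bigr => p _; rewrite big_mkcond /=.
    rewrite (eq_bigr (fun k : 'I_m => \sum_(i < m) \sum_(j < m)
      if ((p + k)%N == l :> nat) && ((i + j)%N == p :> nat) then a i * b j * c k
      else 0)); last first.
      move=> k _; rewrite ffunE; case: ifP => _ /=; last first.
        by rewrite big1 // => i _; rewrite big1.
      rewrite mulr_suml; apply: eq_bigr => i _.
      by rewrite mulr_suml big_mkcond.
    by rewrite exchange_big; apply: eq_bigr => i _; rewrite exchange_big.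
  rewrite exchange_big; apply: eq_bigr => i _.
  rewrite exchange_big; apply: eq_bigr => j _.
  rewrite exchange_big; apply: eq_bigr => k _.
  rewrite -big_mkcond /=; case: ifP => [/eqP ijk|ijk]; last first.
    rewrite big_pred0 // => p; apply: contraFF ijk => /andP[/eqP <- /eqP <-] //.
  have lt : (i + j < m)%N by rewrite (leq_ltn_trans _ (ltn_ord l)) // -ijk leq_addr.
  rewrite (big_pred1 (Ordinal lt)) // => p; apply/andP/eqP => [[_ /eqP e]|->].
    exact/val_inj.
  by rewrite /= ijk !eqxx.
move=> a b c; rewrite mulC; apply/ffunP => l; rewrite !red.
rewrite [RHS]exchange_big /=; apply: eq_bigr => j _.
rewrite [RHS]exchange_big /=; apply: eq_bigr => k _; apply: eq_bigr => i _.
by rewrite addnC addnA -(mulrC (a i)) mulrA.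
Qed.

Let mul1 : left_id (tconst 1) tmul.
Proof.
move=> a; apply/ffunP => k; rewrite ffunE.
have m0 : (0 < m)%N by rewrite (leq_ltn_trans _ (ltn_ord k)).
rewrite (bigD1 (Ordinal m0)) //= (big_pred1 k) => [|j] //.
rewrite ffunE eqxx mul1r big1 ?addr0 // => i i0; rewrite big1 // => j _.
rewrite ffunE; case: eqP => [e|]; last by rewrite mul0r.
by case/eqP: i0; exact/val_inj.
Qed.

Let mulDl : left_distributive tmul +%R.
Proof.
move=> a b c; apply/ffunP => k; rewrite !ffunE -big_split; apply: eq_bigr => i _.
by rewrite -big_split; apply: eq_bigr => j _; rewrite ffunE mulrDl.
Qed.

HB.instance Definition _ :=
  GRing.Zmodule_isComPzRing.Build (tpoly m A) mulA mulC mul1 mulDl.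

Let tconst_zmod : zmod_morphism tconst.
Proof.
by move=> x y; apply/ffunP => i; rewrite !ffunE; case: eqP; rewrite ?subr0.
Qed.

Let tconst_monoid : monoid_morphism tconst.
Proof.
split=> // x y; apply/ffunP => k; rewrite [RHS]ffunE.
have m0 : (0 < m)%N by rewrite (leq_ltn_trans _ (ltn_ord k)).
rewrite (bigD1 (Ordinal m0)) //= (big_pred1 k) => [|j] //.
rewrite big1 ?addr0 => [|i i0]; last first.
  rewrite big1 // => j _; rewrite ffunE; case: eqP => [e|]; last by rewrite mul0r.
  by case/eqP: i0; exact/val_inj.
by rewrite !ffunE eqxx; case: eqP; rewrite ?mulr0.
Qed.

HB.instance Definition _ :=
  GRing.isZmodMorphism.Build A (tpoly m A) tconst tconst_zmod.
HB.instance Definition _ :=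
  GRing.isMonoidMorphism.Build A (tpoly m A) tconst tconst_monoid.

Definition tcoef (a : tpoly m A) (i : nat) : A :=
  if insub i is Some j then a j else 0.

End TruncatedPolynomials.

Section Map.
Variables (m : nat) (A B : comPzRingType) (f : {rmorphism A -> B}).

Definition tmap (a : tpoly m A) : tpoly m B := [ffun i => f (a i)].

Let tmap_zmod : zmod_morphism tmap.
Proof. by move=> a b; apply/ffunP => i; rewrite !ffunE rmorphB. Qed.

Let tmap_monoid : monoid_morphism tmap.
Proof.
split=> [|a b]; apply/ffunP => i; rewrite !ffunE.
  by case: eqP; rewrite ?rmorph1 ?rmorph0.
rewrite rmorph_sum; apply: eq_bigr => j _; rewrite rmorph_sum.
by apply: eq_bigr => k _; rewrite rmorphM !ffunE.
Qed.

HB.instance Definition _ :=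
  GRing.isZmodMorphism.Build (tpoly m A) (tpoly m B) tmap tmap_zmod.
HB.instance Definition _ :=
  GRing.isMonoidMorphism.Build (tpoly m A) (tpoly m B) tmap tmap_monoid.

End Map.

Section Coefficients.
Variables (m : nat) (A : comPzRingType).
Implicit Types a b : tpoly m A.

Lemma tcoefE (a : tpoly m A) (i : 'I_m) : tcoef a i = a i.
Proof. by rewrite /tcoef valK. Qed.

Lemma tcoef_ge (a : tpoly m A) i : (m <= i)%N -> tcoef a i = 0.
Proof. by move=> mi; rewrite /tcoef insubF // ltnNge mi. Qed.

Lemma tcoefP a b : (forall i, (i < m)%N -> tcoef a i = tcoef b i) -> a = b.
Proof. by move=> e; apply/ffunP => i; rewrite -!tcoefE e. Qed.

Lemma tcoefB a b i : tcoef (a - b) i = tcoef a i - tcoef b i.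
Proof. by rewrite /tcoef; case: insub => [j|]; rewrite ?ffunE ?subr0. Qed.

Lemma tcoef1 i : tcoef (1 : tpoly m A) i = (if (i == 0%N) && (0 < m)%N then 1 else 0).
Proof.
rewrite /tcoef; case: insubP => [j jm <-|im].
  by rewrite ffunE (leq_ltn_trans _ jm) // andbT.
by case: eqP im => //= ->; case: (0 < m)%N.
Qed.

Lemma tcoefM a b l : (l < m)%N ->
  tcoef (a * b) l = \sum_(i < l.+1) tcoef a i * tcoef b (l - i).
Proof.
move=> lm; rewrite (tcoefE _ (Ordinal lm)) ffunE /=.
rewrite [RHS](big_ord_widen m (fun i => tcoef a i * tcoef b (l - i))) //.
rewrite [RHS]big_mkcond /=; apply: eq_bigr => i _; rewrite ltnS tcoefE.
case: leqP => il.
  have lt : (l - i < m)%N by rewrite (leq_ltn_trans (leq_subr _ _)).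
  rewrite (big_pred1 (Ordinal lt)) => [|j].
    by rewrite -(tcoefE b (Ordinal lt)).
  by rewrite /= -[RHS](eqn_add2l i) /= subnKC.
by rewrite big_pred0 // => j; apply/negbTE; rewrite neq_ltn (leq_trans il) ?orbT ?leq_addr.
Qed.

End Coefficients.

(* Truncation modulo t^k when k <= m; padding with zeros when m <= k. *)
Definition tcast (m k : nat) (A : comPzRingType) (a : tpoly m A) : tpoly k A :=
  [ffun i : 'I_k => tcoef a i].

Lemma tcoef_cast (m k : nat) (A : comPzRingType) (a : tpoly m A) i :
  (i < k)%N -> tcoef (tcast k a) i = tcoef a i.
Proof. by move=> ik; rewrite (tcoefE _ (Ordinal ik)) ffunE. Qed.

Section Opens.
Variable X : topologicalType.

Record opens := Opens { oset : set X; oset_open : open oset }.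

Definition osub (V U : opens) : Prop := oset V `<=` oset U.

Definition ocap (U V : opens) : opens :=
  Opens (openI (oset_open U) (oset_open V)).

Definition covers (I : Type) (W : I -> opens) (U : opens) : Prop :=
  forall x, oset U x -> exists i, oset (W i) x.

Lemma osub_refl U : osub U U. Proof. by []. Qed.
Lemma osub_trans U V W : osub V U -> osub W V -> osub W U.
Proof. by move=> VU WV x /WV /VU. Qed.
Lemma ocapl U V : osub (ocap U V) U. Proof. by move=> x []. Qed.
Lemma ocapr U V : osub (ocap U V) V. Proof. by move=> x []. Qed.
Lemma ocapS U U' V V' : osub U U' -> osub V V' -> osub (ocap U V) (ocap U' V').
Proof. by move=> UU VV x [/UU ? /VV]. Qed.
Lemma osub_cap U V W : osub W U -> osub W V -> osub W (ocap U V).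
Proof. by move=> WU WV x Wx; split; [exact: WU|exact: WV]. Qed.

Definition is_sheaf (F : opens -> Type)
    (r : forall U V, osub V U -> F U -> F V) : Prop :=
  [/\ forall U (h : osub U U) s, r U U h s = s,
      forall U V W (hV : osub V U) (hW : osub W V) (hWU : osub W U) s,
        r V W hW (r U V hV s) = r U W hWU s,
      forall U (I : Type) (W : I -> opens) (hW : forall i, osub (W i) U),
        covers W U -> forall s t,
        (forall i, r U (W i) (hW i) s = r U (W i) (hW i) t) -> s = t
    & forall U (I : Type) (W : I -> opens) (hW : forall i, osub (W i) U),
        covers W U -> forall s : (forall i, F (W i)),
        (forall i j V (hi : osub V (W i)) (hj : osub V (W j)),
           r (W i) V hi (s i) = r (W j) V hj (s j)) ->
        exists t, forall i, r U (W i) (hW i) t = s i].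

End Opens.

(* Sheaves of commutative k-algebras. The ring of sections over the empty set
   is zero, whence the possibly trivial rings. *)
Record algSheaf (k : comPzRingType) (X : topologicalType) := AlgSheaf {
  asec :> opens X -> comPzRingType;
  ares : forall U V, osub V U -> {rmorphism asec U -> asec V};
  acst : forall U, {rmorphism k -> asec U};
  ares_cst : forall U V (h : osub V U) c, ares h (acst U c) = acst V c;
  ares_sheaf : is_sheaf (fun U V h => ares h)
}.

Record modSheaf (k : comPzRingType) (X : topologicalType) (O : algSheaf k X) :=
  ModSheaf {
  msec :> forall U, lmodType (O U);
  mres : forall U V, osub V U -> {additive msec U -> msec V};
  mresZ : forall U V (h : osub V U) a s, mres h (a *: s) = ares O h a *: mres h s;
  mres_sheaf : is_sheaf (fun U V h => mres h)
}.

Record grpSheaf (X : topologicalType) := GrpSheaf {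
  gsec :> opens X -> groupType;
  gres : forall U V, osub V U -> gsec U -> gsec V;
  gresM : forall U V (h : osub V U) s t,
    gres h (s * t)%g = (gres h s * gres h t)%g;
  gres_sheaf : is_sheaf gres
}.
Arguments gres {X} g {U V}.

Section Varieties.
Variables (k : comPzRingType) (X : topologicalType) (O : algSheaf k X).

Definition basic_open_set (U : opens X) (f : O U) : set X :=
  \bigcup_(V in [set V : opens X |
    exists h : osub V U, exists g, ares O h f * g = 1]) oset V.

Lemma basic_open_subproof U (f : O U) : open (basic_open_set f).
Proof. by apply: bigcup_open => V _; exact: oset_open. Qed.

(* D(f), the largest open subset of U on which f is invertible *)
Definition basic_open (U : opens X) (f : O U) : opens X :=
  Opens (basic_open_subproof f).

Lemma basic_open_sub U (f : O U) : osub (basic_open f) U.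
Proof. by move=> x [V [h _]] /h. Qed.

Definition prime_ideal (A : comPzRingType) (P : set A) : Prop :=
  [/\ P 0, forall a b, P a -> P b -> P (a + b),
      forall a b, P b -> P (a * b), ~ P 1
    & forall a b, P (a * b) -> P a \/ P b].

(* (U, O|U) is Spec O(U): x |-> {f | x \notin D(f)} is a homeomorphism from U
   onto the set of primes of O(U), and O(D(f)) is the localization O(U)_f. *)
Definition affine_open (U : opens X) : Prop :=
  let pt (x : X) := [set f : O U | ~ oset (basic_open f) x] in
  [/\ forall P : set (O U), prime_ideal P <-> exists2 x, oset U x & P = pt x,
      forall x y, oset U x -> oset U y -> pt x = pt y -> x = y,
      forall V, osub V U -> forall x, oset V x ->
        exists2 f : O U, oset (basic_open f) x & osub (basic_open f) V
    & forall f : O U, let r := ares O (basic_open_sub (f := f)) in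
      [/\ exists g, r f * g = 1,
          forall s, exists n a, r f ^+ n * s = r a
        & forall a, r a = 0 -> exists n, f ^+ n * a = 0]].

(* X -> X x X is a closed immersion: on the affine open cover by the U x V this
   says that U :&: V is affine and that O(U) (x) O(V) -> O(U :&: V) is onto. *)
Definition separated_scheme : Prop :=
  forall U V, affine_open U -> affine_open V ->
    affine_open (ocap U V) /\
    forall s : O (ocap U V), exists r : seq (O U * O V),
      s = \sum_(ab <- r)
        ares O (@ocapl _ U V) ab.1 * ares O (@ocapr _ U V) ab.2.

Definition finite_type_algebra (U : opens X) : Prop :=
  exists g : seq (O U), forall S : set (O U),
    [/\ forall c, S (acst O U c), forall a, a \in g -> S a,
        forall a b, S a -> S b -> S (a + b)
      & forall a b, S a -> S b -> S (a * b)] ->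
    S = setT.

(* Formal smoothness over k: every k-algebra morphism O(U) -> C lifts along every surjection of
   k-algebras B -> C with square-zero kernel. *)
Definition formally_smooth_algebra (U : opens X) : Prop :=
  forall (B C : comPzRingType) (cB : {rmorphism k -> B}) (q : {rmorphism B -> C})
    (u : {rmorphism O U -> C}),
  (forall y, exists x, q x = y) ->
  (forall x y, q x = 0 -> q y = 0 -> x * y = 0) ->
  (forall c, u (acst O U c) = q (cB c)) ->
  exists2 v : {rmorphism O U -> B},
    forall c, v (acst O U c) = cB c & forall a, q (v a) = u a.

(* Smooth = locally of finite presentation and formally smooth; over a field,
   finite type is the same as finite presentation. *)
Definition smooth_scheme : Prop :=
  forall x, exists U,
    [/\ oset U x, affine_open U, finite_type_algebra U & formally_smooth_algebra U].

Definition smooth_connected_variety : Prop :=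
  [/\ smooth_scheme, separated_scheme, compact [set: X], connected [set: X]
    & [set: X] !=set0].

End Varieties.

Section TruncatedSheaf.
Variables (k : comPzRingType) (X : topologicalType) (O : algSheaf k X) (m : nat).

Let tsh_cst U : {rmorphism k -> tpoly m (O U)} := @tconst m (O U) \o acst O U.

Let tsh_res_cst U V (h : osub V U) c :
  tmap (ares O h) (tsh_cst U c) = tsh_cst V c.
Proof.
apply/ffunP => i; rewrite !ffunE; case: eqP => _; rewrite ?rmorph0 //.
exact: ares_cst.
Qed.

Let tsh_sheaf : @is_sheaf X (fun U => tpoly m (O U)) (fun U V h => tmap (ares O h)).
Proof.
have [r1 r2 rs rg] := ares_sheaf O; split.
- by move=> U h s; apply/ffunP => i; rewrite ffunE r1.
- by move=> U V W hV hW hWU s; apply/ffunP => i; rewrite !ffunE (r2 _ _ _ _ _ hWU).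
- move=> U I W hW cW s t e; apply/ffunP => i; apply: (rs _ _ _ hW cW) => j.
  by have /ffunP/(_ i) := e j; rewrite !ffunE.
- move=> U I W hW cW s e.
  have /choice[t ht] : forall l : 'I_m, exists t : O U, forall i, ares O (hW i) t = s i l.
    move=> l; apply: (rg _ _ _ hW cW) => i j V hi hj.
    by have /ffunP/(_ l) := e i j V hi hj; rewrite !ffunE.
  by exists [ffun l => t l] => i; apply/ffunP => l; rewrite !ffunE ht.
Qed.

(* the structure sheaf O[t]/(t^m) of X x Z_m *)
Definition tsheaf : algSheaf k X :=
  @AlgSheaf k X (fun U => tpoly m (O U)) (fun U V h => tmap (ares O h))
    tsh_cst tsh_res_cst tsh_sheaf.

End TruncatedSheaf.

Lemma glue_natural (X : topologicalType) (F G : opens X -> Type)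
    (rF : forall U V, osub V U -> F U -> F V)
    (rG : forall U V, osub V U -> G U -> G V)
    (U : opens X) (I : Type) (W : I -> opens X)
    (n : forall i V, osub V (W i) -> F V -> G V) :
  is_sheaf rF -> is_sheaf rG -> (forall i, osub (W i) U) -> covers W U ->
  (forall i V V' (h : osub V (W i)) (h' : osub V' (W i)) (hV : osub V' V) s,
     rG V V' hV (n i V h s) = n i V' h' (rF V V' hV s)) ->
  (forall i j V (hi : osub V (W i)) (hj : osub V (W j)) s,
     n i V hi s = n j V hj s) ->
  exists N : forall V, osub V U -> F V -> G V,
    forall V h i V' (hV : osub V' V) (hi : osub V' (W i)) s,
      rG V V' hV (N V h s) = n i V' hi (rF V V' hV s).
Proof.
move=> [F1 F2 _ _] [G1 G2 Gs Gg] hW cW nat compat.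
have cap (V : opens X) (h : osub V U) :
    covers (fun i => ocap V (W i)) V.
  by move=> x Vx; have [i Wx] := cW x (h x Vx); exists i.
have H : forall q : {V : opens X & osub V U * F V}%type,
    exists t : G (projT1 q), forall i V' (hV : osub V' (projT1 q)) (hi : osub V' (W i)),
      rG (projT1 q) V' hV t = n i V' hi (rF (projT1 q) V' hV (projT2 q).2).
  case=> V [h s] /=.
  have [|t ht] := Gg V I (fun i => ocap V (W i)) (fun i => @ocapl _ V (W i)) (cap V h)
    (fun i => n i _ (@ocapr _ V (W i)) (rF _ _ (@ocapl _ V (W i)) s)).
    move=> i j V' hi hj; have hV := osub_trans (@ocapl _ V (W i)) hi.
    have ki := osub_trans (@ocapr _ V (W i)) hi.
    have kj := osub_trans (@ocapr _ V (W j)) hj.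
    by rewrite (nat i _ _ _ ki) (nat j _ _ _ kj) !(F2 _ _ _ _ _ hV).
  exists t => i V' hV hi; rewrite -(G2 _ _ _ (@ocapl _ V (W i)) (osub_cap hV hi)).
  by rewrite ht (nat _ _ _ _ hi) (F2 _ _ _ _ _ hV).
by exists (fun V h s => sval (cid (H (existT _ V (h, s))))) => V h i V' hV hi s; case: cid => /= t; exact.
Qed.

Section Isomorphisms.
Variables (k : comPzRingType) (X : topologicalType).

(* isomorphisms A|U -> B|U of sheaves of k-algebras on U *)
Record algIso (A B : algSheaf k X) (U : opens X) := AlgIso {
  ifun : forall V, osub V U -> {rmorphism A V -> B V};
  iinv : forall V, osub V U -> {rmorphism B V -> A V};
  ifunK : forall V (h : osub V U) a, iinv h (ifun h a) = a;
  iinvK : forall V (h : osub V U) b, ifun h (iinv h b) = b;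
  ifun_cst : forall V (h : osub V U) c, ifun h (acst A V c) = acst B V c;
  ifun_nat : forall V W (hV : osub V U) (hW : osub W U) (h : osub W V) a,
    ares B h (ifun hV a) = ifun hW (ares A h a)
}.

Lemma algIso_ext A B U (f g : algIso A B U) :
  (forall V h a, ifun f h a = ifun g (V := V) h a) -> f = g.
Proof.
case: f g => [f f' fK f'K fc fn] [g g' gK g'K gc gn] /= fg.
have e : f = g.
  apply: functional_extensionality_dep => V; apply/funext => h.
  by apply: rmorphism_ext => a; exact: fg.
subst g; have e : f' = g'.
  apply: functional_extensionality_dep => V; apply/funext => h; apply: rmorphism_ext => b.
  by rewrite -{1}(g'K V h b) fK.
by subst g'; congr AlgIso; exact: Prop_irrelevance.
Qed.

Lemma iinv_cst A B U (f : algIso A B U) V h c :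
  iinv f (V := V) h (acst B V c) = acst A V c.
Proof. by rewrite -(ifun_cst f h) ifunK. Qed.

Lemma iinv_nat A B U (f : algIso A B U) V W (hV : osub V U) (hW : osub W U)
  (h : osub W V) b : ares A h (iinv f hV b) = iinv f hW (ares B h b).
Proof. by rewrite -{2}(iinvK f hV b) (ifun_nat f _ hW) ifunK. Qed.

Definition iso_id A U : algIso A A U :=
  @AlgIso A A U (fun V _ => idfun) (fun V _ => idfun) (fun _ _ _ => erefl)
    (fun _ _ _ => erefl) (fun _ _ _ => erefl) (fun _ _ _ _ _ _ => erefl).

Definition iso_inv A B U (f : algIso A B U) : algIso B A U :=
  AlgIso (iinvK f) (ifunK f) (iinv_cst f) (iinv_nat f).

Definition iso_comp A B C U (g : algIso B C U) (f : algIso A B U) : algIso A C U.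
Proof.
refine (@AlgIso A C U (fun V h => ifun g h \o ifun f h) (fun V h => iinv f h \o iinv g h)
  _ _ _ _) => /=.
- by move=> V h a /=; rewrite !ifunK.
- by move=> V h b /=; rewrite !iinvK.
- by move=> V h c /=; rewrite !ifun_cst.
- by move=> V W hV hW h a /=; rewrite !(ifun_nat _ hV hW).
Defined.

Definition iso_res A B U V (h : osub V U) (f : algIso A B U) : algIso A B V.
Proof.
refine (@AlgIso A B V (fun W hW => ifun f (osub_trans h hW))
  (fun W hW => iinv f (osub_trans h hW)) _ _ _ _).
- by move=> W hW a; rewrite ifunK.
- by move=> W hW a; rewrite iinvK.
- by move=> W hW a; rewrite ifun_cst.
- by move=> W W' hW hW' hh a; rewrite (ifun_nat f _ (osub_trans h hW')).
Defined.

Lemma ifun_irr A B U (f : algIso A B U) V (h h' : osub V U) a :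
  ifun f h a = ifun f h' a.
Proof. by rewrite (Prop_irrelevance h h'). Qed.

Lemma glue_algIso A B U (I : Type) (W : I -> opens X) (s : forall i, algIso A B (W i)) :
  (forall i, osub (W i) U) -> covers W U ->
  (forall i j V (hi : osub V (W i)) (hj : osub V (W j)),
     iso_res hi (s i) = iso_res hj (s j)) ->
  exists t : algIso A B U,
    forall i V (h : osub V U) (hi : osub V (W i)) a, ifun t h a = ifun (s i) hi a.
Proof.
move=> hW cW e.
have ecompat i j V (hi : osub V (W i)) (hj : osub V (W j)) a :
    ifun (s i) hi a = ifun (s j) hj a.
  have := congr1 (fun f => ifun f (@osub_refl _ V) a) (e i j V hi hj).
  by rewrite /= (ifun_irr _ _ hi) (ifun_irr _ _ hj).
have icompat i j V (hi : osub V (W i)) (hj : osub V (W j)) b :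
    iinv (s i) hi b = iinv (s j) hj b.
  by rewrite -{1}(iinvK (s j) hj b) -(ecompat i j V hi hj) ifunK.
have [A1 A2 As Ag] := ares_sheaf A; have [B1 B2 Bs Bg] := ares_sheaf B.
have cap (V : opens X) (h : osub V U) : covers (fun i => ocap V (W i)) V.
  by move=> x Vx; have [i Wx] := cW x (h x Vx); exists i.
have [f hf] := glue_natural (n := fun i V h a => ifun (s i) h a) (ares_sheaf A)
  (ares_sheaf B) hW cW (fun i V V' h h' hV a => ifun_nat (s i) h h' hV a) ecompat.
have [g hg] := glue_natural (n := fun i V h a => iinv (s i) h a) (ares_sheaf B)
  (ares_sheaf A) hW cW (fun i V V' h h' hV a => iinv_nat (s i) h h' hV a) icompat.
have eqA V (h : osub V U) a b : (forall i V' (hV : osub V' V) (hi : osub V' (W i)),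
    ares A hV a = ares A hV b) -> a = b.
  move=> ab; apply: (As V _ _ (fun i => @ocapl _ V (W i)) (cap V h)) => i.
  exact: (ab i _ _ (@ocapr _ V (W i))).
have eqB V (h : osub V U) a b : (forall i V' (hV : osub V' V) (hi : osub V' (W i)),
    ares B hV a = ares B hV b) -> a = b.
  move=> ab; apply: (Bs V _ _ (fun i => @ocapl _ V (W i)) (cap V h)) => i.
  exact: (ab i _ _ (@ocapr _ V (W i))).
have fZ V h : zmod_morphism (f V h).
  by move=> a b; apply: (eqB V h) => i V' hV hi; rewrite rmorphB !(hf _ _ i _ _ hi) !rmorphB.
have fM V h : monoid_morphism (f V h).
  split=> [|a b]; apply: (eqB V h) => i V' hV hi.
    by rewrite (hf _ _ i _ _ hi) !rmorph1.
  by rewrite rmorphM !(hf _ _ i _ _ hi) !rmorphM.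
have gZ V h : zmod_morphism (g V h).
  by move=> a b; apply: (eqA V h) => i V' hV hi; rewrite rmorphB !(hg _ _ i _ _ hi) !rmorphB.
have gM V h : monoid_morphism (g V h).
  split=> [|a b]; apply: (eqA V h) => i V' hV hi.
    by rewrite (hg _ _ i _ _ hi) !rmorph1.
  by rewrite rmorphM !(hg _ _ i _ _ hi) !rmorphM.
pose F V h : {rmorphism A V -> B V} := HB.pack (f V h)
  (GRing.isZmodMorphism.Build _ _ _ (fZ V h)) (GRing.isMonoidMorphism.Build _ _ _ (fM V h)).
pose H V h : {rmorphism B V -> A V} := HB.pack (g V h)
  (GRing.isZmodMorphism.Build _ _ _ (gZ V h)) (GRing.isMonoidMorphism.Build _ _ _ (gM V h)).
have FK V h a : H V h (F V h a) = a.
  by apply: (eqA V h) => i V' hV hi; rewrite (hg _ _ i _ _ hi) (hf _ _ i _ _ hi) ifunK.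
have HK V h a : F V h (H V h a) = a.
  by apply: (eqB V h) => i V' hV hi; rewrite (hf _ _ i _ _ hi) (hg _ _ i _ _ hi) iinvK.
have Fc V h c : F V h (acst A V c) = acst B V c.
  by apply: (eqB V h) => i V' hV hi; rewrite (hf _ _ i _ _ hi) !ares_cst ifun_cst.
have Fn V V' (h : osub V U) (h' : osub V' U) (hV : osub V' V) a :
    ares B hV (F V h a) = F V' h' (ares A hV a).
  apply: (eqB V' h') => i V2 hV2 hi; rewrite (hf _ _ i _ _ hi).
  by rewrite (B2 _ _ _ _ _ (osub_trans hV hV2)) (hf _ _ i _ _ hi) (A2 _ _ _ _ _ (osub_trans hV hV2)).
exists (AlgIso FK HK Fc Fn) => i V h hi a /=.
by rewrite -(B1 V (@osub_refl _ V) (f V h a)) (hf _ _ i _ _ hi) A1.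
Qed.

End Isomorphisms.

Section AutomorphismSheaf.
Variables (k : comPzRingType) (X : topologicalType) (O : algSheaf k X) (m : nat).

(* Automorphisms of the sheaf of k-algebras O_U[t]/(t^m) inducing the identity
   modulo t. For U affine these are the automorphisms of the k-algebra
   O(U)[t]/(t^m) inducing the identity modulo t; for arbitrary U the latter
   do not restrict to smaller open sets, and one has to take automorphisms of
   the sheaf of algebras to obtain a sheaf of groups. *)
Record taut (U : opens X) := TAut {
  tval :> algIso (tsheaf O m) (tsheaf O m) U;
  tvalP : forall V (h : osub V U) a, tcoef (ifun tval h a) 0 = tcoef a 0
}.

Section Group.
Variable U : opens X.

HB.instance Definition _ := gen_eqMixin (taut U).
HB.instance Definition _ := gen_choiceMixin (taut U).

Lemma taut_ext (f g : taut U) :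
  (forall V h a, ifun f h a = ifun g (V := V) h a) -> f = g.
Proof.
case: f g => [f fP] [g gP] /= fg; have e : f = g by exact: algIso_ext.
subst g.
by congr TAut; exact: Prop_irrelevance.
Qed.

Let one : taut U := TAut (tval := iso_id _ U) (fun _ _ _ => erefl).

Let mul (f g : taut U) : taut U.
Proof.
by refine (@TAut U (iso_comp f g) _) => V h a /=; rewrite !tvalP.
Defined.

Let inv (f : taut U) : taut U.
Proof.
refine (@TAut U (iso_inv f) _) => V h a /=.
by rewrite -[in RHS](iinvK f h a) tvalP.
Defined.

Let mulA : associative mul. Proof. by move=> f g h; apply: taut_ext. Qed.
Let mul1g : left_id one mul. Proof. by move=> f; apply: taut_ext. Qed.
Let mulg1 : right_id one mul. Proof. by move=> f; apply: taut_ext. Qed.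
Let mulVg : left_inverse one inv mul.
Proof. by move=> f; apply: taut_ext => V h a; exact: ifunK. Qed.
Let mulgV : right_inverse one inv mul.
Proof. by move=> f; apply: taut_ext => V h a; exact: iinvK. Qed.

HB.instance Definition _ := isGroup.Build (taut U) mulA mul1g mulg1 mulVg mulgV.

Lemma tautM (f g : taut U) V (h : osub V U) a :
  ifun (f * g)%g h a = ifun f h (ifun g h a).
Proof. by []. Qed.

Lemma taut1 V (h : osub V U) a : ifun (1%g : taut U) h a = a.
Proof. by []. Qed.

Lemma tautV (f : taut U) V (h : osub V U) a : ifun f^-1%g h a = iinv f h a.
Proof. by []. Qed.

End Group.

Definition taut_res U V (h : osub V U) (f : taut U) : taut V :=
  TAut (tval := iso_res h f) (fun W hW a => tvalP f (osub_trans h hW) a).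

Let taut_resM U V (h : osub V U) (f g : taut U) :
  taut_res h (f * g)%g = (taut_res h f * taut_res h g)%g.
Proof. by apply: taut_ext. Qed.

Let taut_sheaf : is_sheaf taut_res.
Proof.
split.
- by move=> U h f; apply: taut_ext => V hV a; apply: (ifun_irr (tval f)).
- by move=> U V W hV hW hWU f; apply: taut_ext => V' hV' a; exact: (ifun_irr (tval f)).
- move=> U I W hW cW f g e; apply: taut_ext => V h a.
  have [A1 A2 As Ag] := ares_sheaf (tsheaf O m).
  have cap : covers (fun i => ocap V (W i)) V.
    by move=> x Vx; have [i Wx] := cW x (h x Vx); exists i.
  apply: (As V _ _ (fun i => @ocapl _ V (W i)) cap) => i.
  have hi := osub_trans h (@ocapl _ V (W i)).
  rewrite !(ifun_nat _ h hi).
  have := congr1 (fun f : taut (W i) => ifun f (@ocapr _ V (W i))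
    (ares _ (@ocapl _ V (W i)) a)) (e i).
  by rewrite /= (ifun_irr f _ hi) (ifun_irr g _ hi).
- move=> U I W hW cW s e.
  have [t ht] := glue_algIso (s := fun i => tval (s i)) hW cW
    (fun i j V hi hj => congr1 (@tval V) (e i j V hi hj)).
  have tP V (h : osub V U) a : tcoef (ifun t h a) 0 = tcoef a 0.
    have [A1 A2 As Ag] := ares_sheaf O.
    have cap : covers (fun i => ocap V (W i)) V.
      by move=> x Vx; have [i Wx] := cW x (h x Vx); exists i.
    have cr V' (hV : osub V' V) (b : tpoly m (O V)) i :
        ares O hV (tcoef b i) = tcoef (ares (tsheaf O m) hV b) i.
      by rewrite /tcoef; case: insub => [j|]; rewrite ?ffunE ?rmorph0.
    apply: (As V _ _ (fun i => @ocapl _ V (W i)) cap) => i.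
    have hi := osub_trans h (@ocapl _ V (W i)).
    by rewrite !cr (ifun_nat t h hi) (ht i _ hi (@ocapr _ V (W i))) tvalP.
  exists (TAut tP) => i; apply: taut_ext => V h a /=.
  exact: ht.
Qed.

Definition autSheaf : grpSheaf X := GrpSheaf taut_resM taut_sheaf.

End AutomorphismSheaf.

Section Reduction.
Variables (k : comPzRingType) (X : topologicalType) (O : algSheaf k X).

Definition eqmod_t (A : comPzRingType) (m j : nat) (a b : tpoly m A) :=
  forall i, (i < j)%N -> tcoef a i = tcoef b i.

Lemma taut_eqmod (m : nat) (U : opens X) (f : taut O m U) V (h : osub V U) j
    (a b : tpoly m (O V)) :
  eqmod_t j a b -> eqmod_t j (ifun f h a) (ifun f h b).
Proof.
suff F (c : tpoly m (O V)) : eqmod_t j c 0 -> eqmod_t j (ifun f h c) 0.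
  move=> ab i ij; apply/eqP; rewrite -subr_eq0 -tcoefB -rmorphB; apply/eqP.
  rewrite F //; first by rewrite -[0 in LHS](subrr 0) tcoefB subrr.
  by move=> l lj; rewrite tcoefB ab // subrr -[0 in RHS](subrr 0) tcoefB subrr.
have c0 i : tcoef (0 : tpoly m (O V)) i = 0.
  by rewrite -[0 in LHS](subrr 0) tcoefB subrr.
elim: j c => [//|j IH] c cj i ij; rewrite c0.
have [mi|im] := leqP m i; first exact: tcoef_ge.
pose t : tpoly m (O V) := [ffun l : 'I_m => (l == 1 :> nat)%:R].
pose d : tpoly m (O V) := [ffun l : 'I_m => tcoef c l.+1].
have t0 : tcoef t 0 = 0 by rewrite /tcoef; case: insubP => // l _ e; rewrite ffunE e.
have -> : c = t * d.
  apply: tcoefP => l lm; rewrite tcoefM //; case: l lm => [|l] lm.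
    by rewrite big_ord_recl big_ord0 t0 mul0r addr0 cj // c0.
  rewrite !big_ord_recl /= t0 mul0r add0r (tcoefE t (Ordinal (leq_ltn_trans (ltn0Sn l) lm))).
  rewrite ffunE /= mul1r big1 => [|q _].
    by rewrite addr0 subSS subn0 (tcoefE d (Ordinal (ltnW lm))) ffunE.
  have [qm|qm] := ltnP q.+2 m; last by rewrite tcoef_ge ?mul0r.
  by rewrite (tcoefE t (Ordinal qm)) ffunE mul0r.
rewrite rmorphM tcoefM // big1 // => l _.
have [->|l0] := posnP l; first by rewrite tvalP t0 mul0r.
have dj : eqmod_t j d 0.
  move=> q qj; rewrite c0 /tcoef; case: insubP => // q' _ e.
  by rewrite ffunE e cj ?c0.
have il : (i - l < j)%N.
  by rewrite (leq_trans _ (ij : (i <= j)%N)) // ltn_subrL l0 (leq_trans l0) // -ltnS.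
by rewrite (IH d dj _ il) c0 mulr0.
Qed.

Variables (m n : nat) (nm : (n <= m)%N).

Let cast_res V W (h : osub W V) p q (a : tpoly p (O V)) :
  tcast q (tmap (ares O h) a) = tmap (ares O h) (tcast q a).
Proof.
apply/ffunP => i; rewrite !ffunE /tcoef; case: insub => [j|]; rewrite ?ffunE ?rmorph0 //.
Qed.

Let castM (A : comPzRingType) (a b : tpoly n A) :
  eqmod_t n (tcast m (a * b)) (tcast m a * tcast m b).
Proof.
move=> i ni; have mi := leq_trans ni nm; rewrite tcoef_cast // !tcoefM //.
apply: eq_bigr => j _; have jm : (j < m)%N by rewrite (leq_ltn_trans _ mi) // -ltnS.
by rewrite !tcoef_cast // (leq_ltn_trans (leq_subr _ _)).
Qed.

Section Morphism.
Variables (U : opens X) (f : taut O m U) (V : opens X) (h : osub V U).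

Definition tred_fun (a : tpoly n (O V)) : tpoly n (O V) :=
  tcast n (ifun f h (tcast m a)).

Let tred_zmod : zmod_morphism tred_fun.
Proof.
have cB p q (A : comPzRingType) (a b : tpoly p A) : tcast q (a - b) = tcast q a - tcast q b.
  by apply/ffunP => i; rewrite !ffunE tcoefB.
by move=> a b; rewrite /tred_fun cB rmorphB cB.
Qed.

Let tred_monoid : monoid_morphism tred_fun.
Proof.
have e1 : eqmod_t n (tcast m (1 : tpoly n (O V))) (1 : tpoly m (O V)).
  move=> l ln; have lm := leq_trans ln nm; rewrite tcoef_cast // !tcoef1.
  by rewrite (leq_ltn_trans _ ln) // (leq_ltn_trans _ lm).
split=> [|a b]; apply: tcoefP => i ni; have mi := leq_trans ni nm; rewrite tcoef_cast //.
  rewrite (taut_eqmod f h e1 ni) rmorph1 !tcoef1.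
  by rewrite (leq_ltn_trans _ ni) // (leq_ltn_trans _ mi).
rewrite (taut_eqmod f h (@castM _ a b) ni) rmorphM !tcoefM //.
apply: eq_bigr => j _; have jn : (j < n)%N by rewrite (leq_ltn_trans _ ni) // -ltnS.
by rewrite !tcoef_cast // (leq_ltn_trans (leq_subr _ _)).
Qed.

HB.instance Definition _ :=
  GRing.isZmodMorphism.Build (tpoly n (O V)) (tpoly n (O V)) tred_fun tred_zmod.
HB.instance Definition _ :=
  GRing.isMonoidMorphism.Build (tpoly n (O V)) (tpoly n (O V)) tred_fun tred_monoid.

End Morphism.

Let tred_comp U (f g : taut O m U) V (h : osub V U) a :
  tred_fun f h (tred_fun g h a) = tred_fun (f * g)%g h a.
Proof.
apply: tcoefP => i ni; rewrite !tcoef_cast //.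
have e : eqmod_t n (tcast m (tred_fun g h a)) (ifun g h (tcast m a)).
  by move=> l ln; rewrite !tcoef_cast // (leq_trans ln).
by rewrite (taut_eqmod f h e ni).
Qed.

Let tred_one U V (h : osub V U) a : tred_fun (1%g : taut O m U) h a = a.
Proof. by apply: tcoefP => i ni; rewrite !tcoef_cast // (leq_trans ni). Qed.

Let tred_cst U (f : taut O m U) V (h : osub V U) c :
  tred_fun f h (acst (tsheaf O n) V c) = acst (tsheaf O n) V c.
Proof.
have e : eqmod_t n (tcast m (acst (tsheaf O n) V c)) (acst (tsheaf O m) V c).
  move=> l ln; have lm := leq_trans ln nm.
  by rewrite tcoef_cast // (tcoefE _ (Ordinal ln)) (tcoefE _ (Ordinal lm)) !ffunE.
apply: tcoefP => i ni; rewrite tcoef_cast // (taut_eqmod f h e ni) ifun_cst.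
by rewrite (tcoefE _ (Ordinal ni)) (tcoefE _ (Ordinal (leq_trans ni nm))) !ffunE.
Qed.

Let tred_nat U (f : taut O m U) V W (hV : osub V U) (hW : osub W U) (h : osub W V) a :
  tmap (ares O h) (tred_fun f hV a) = tred_fun f hW (tmap (ares O h) a).
Proof.
rewrite /tred_fun -cast_res; congr tcast.
by have := ifun_nat f hV hW h (tcast m a); rewrite /= cast_res.
Qed.

Definition tred_iso U (f : taut O m U) : algIso (tsheaf O n) (tsheaf O n) U :=
  @AlgIso _ _ (tsheaf O n) (tsheaf O n) U (@tred_fun U f) (@tred_fun U f^-1%g)
    (fun V h a => etrans (tred_comp _ _ h a)
      (etrans (congr1 (fun g => tred_fun g h a) (mulVg f)) (tred_one h a)))
    (fun V h a => etrans (tred_comp _ _ h a)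
      (etrans (congr1 (fun g => tred_fun g h a) (mulgV f)) (tred_one h a)))
    (@tred_cst U f) (@tred_nat U f).

Let tred_subproof U (f : taut O m U) V (h : osub V U) a :
  tcoef (ifun (tred_iso f) h a) 0 = tcoef a 0.
Proof.
case: (posnP n) => [n0|n0]; first by rewrite !tcoef_ge ?n0.
by rewrite tcoef_cast // tvalP tcoef_cast // (leq_trans n0).
Qed.

Definition tred U (f : taut O m U) : taut O n U := TAut (@tred_subproof U f).

End Reduction.

Section Cohomology.
Variable X : topologicalType.

Record grpHom (G H : grpSheaf X) := GrpHom {
  ghom : forall U, G U -> H U;
  ghomM : forall U s t, ghom (s * t)%g = (ghom (U := U) s * ghom t)%g;
  ghom_nat : forall U V (h : osub V U) s, gres H h (ghom s) = ghom (gres G h s)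
}.

Section Sheaf.
Variable G : grpSheaf X.

Lemma gres_id U (h : osub U U) (s : G U) : gres G h s = s.
Proof. by have [g1 _ _ _] := gres_sheaf G; rewrite g1. Qed.

Lemma gres_comp U V W (hV : osub V U) (hW : osub W V) (hWU : osub W U) (s : G U) :
  gres G hW (gres G hV s) = gres G hWU s.
Proof. by have [_ g2 _ _] := gres_sheaf G; rewrite (g2 _ _ _ _ _ hWU). Qed.

Lemma gres1 U V (h : osub V U) : gres G h 1%g = 1%g.
Proof. by apply: (mulgI (gres G h 1%g)); rewrite -gresM !mulg1. Qed.

Lemma gresV U V (h : osub V U) (s : G U) : gres G h s^-1%g = (gres G h s)^-1%g.
Proof. by apply: (mulgI (gres G h s)); rewrite -gresM !mulgV gres1. Qed.

Record cocycle := Cocycle {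
  cidx : Type;
  cov : cidx -> opens X;
  cov_covers : forall x, exists i, oset (cov i) x;
  coc : forall i j, G (ocap (cov i) (cov j));
  cocP : forall i j l V (hij : osub V (ocap (cov i) (cov j)))
      (hjl : osub V (ocap (cov j) (cov l))) (hil : osub V (ocap (cov i) (cov l))),
    (gres G hij (coc i j) * gres G hjl (coc j l))%g = gres G hil (coc i l)
}.

(* c and c' differ by a coboundary on a common refinement of their covers *)
Definition cohomologous (c c' : cocycle) : Prop :=
  exists (K : Type) (W : K -> opens X) (a : K -> cidx c) (b : K -> cidx c')
    (f : forall p, G (W p)),
  [/\ forall x, exists p, oset (W p) x, forall p, osub (W p) (cov (a p)),
      forall p, osub (W p) (cov (b p))
    & forall p q V (hp : osub V (W p)) (hq : osub V (W q))
        (ha : osub V (ocap (cov (a p)) (cov (a q))))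
        (hb : osub V (ocap (cov (b p)) (cov (b q)))),
      gres G hb (coc (b p) (b q)) =
        (gres G hp (f p) * gres G ha (coc (a p) (a q)) * (gres G hq (f q))^-1)%g].

Lemma cohomologous_refl c : cohomologous c c.
Proof.
exists (cidx c), (@cov c), id, id, (fun p => 1%g).
split; [exact: cov_covers|by move=> p; exact: osub_refl|by move=> p; exact: osub_refl|].
move=> p q V hp hq ha hb; rewrite !gres1 mul1g invg1 mulg1.
by rewrite (Prop_irrelevance ha hb).
Qed.

Lemma cohomologous_sym c c' : cohomologous c c' -> cohomologous c' c.
Proof.
move=> [K [W [a [b [f [cW ha hb e]]]]]].
exists K, W, b, a, (fun p => (f p)^-1%g); split=> // p q V hp hq hB hA.
by rewrite (e p q V hp hq hA hB) !gresV invgK !mulgA mulVg mul1g -mulgA mulVg mulg1.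
Qed.

Lemma cohomologous_trans c' c c'' :
  cohomologous c c' -> cohomologous c' c'' -> cohomologous c c''.
Proof.
move=> [K [W [a [b [f [cW ha hb e]]]]]] [L [W' [b' [d [f' [cW' hb' hd e']]]]]].
have sub p q : osub (ocap (W p) (W' q)) (ocap (cov (b' q)) (cov (b p))).
  by move=> x [/hb ? /hb' ?].
exists (K * L)%type, (fun p => ocap (W p.1) (W' p.2)), (a \o fst), (d \o snd),
  (fun p => gres G (@ocapr _ (W p.1) (W' p.2)) (f' p.2) *
            gres G (sub p.1 p.2) (coc (b' p.2) (b p.1)) *
            gres G (@ocapl _ (W p.1) (W' p.2)) (f p.1))%g; split.
- by move=> x; have [p Wp] := cW x; have [q Wq] := cW' x; exists (p, q).
- by move=> p x [/ha].
- by move=> p x [_ /hd].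
move=> [p q] [p2 q2] V hp hq /= hA hD.
have hVp : osub V (W p) := osub_trans (@ocapl _ _ _) hp.
have hVq : osub V (W' q) := osub_trans (@ocapr _ _ _) hp.
have hVp2 : osub V (W p2) := osub_trans (@ocapl _ _ _) hq.
have hVq2 : osub V (W' q2) := osub_trans (@ocapr _ _ _) hq.
have hB : osub V (ocap (cov (b p)) (cov (b p2))).
  by move=> x Vx; split; [apply/hb/hVp|apply/hb/hVp2].
have hB' : osub V (ocap (cov (b' q)) (cov (b' q2))).
  by move=> x Vx; split; [apply/hb'/hVq|apply/hb'/hVq2].
have h1 : osub V (ocap (cov (b' q)) (cov (b p))) := osub_trans (sub p q) hp.
have h2 : osub V (ocap (cov (b' q2)) (cov (b p2))) := osub_trans (sub p2 q2) hq.
have h3 : osub V (ocap (cov (b' q)) (cov (b p2))).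
  by move=> x Vx; split; [apply/hb'/hVq|apply/hb/hVp2].
have eB : gres G hB' (coc (b' q) (b' q2)) =
    (gres G h1 (coc (b' q) (b p)) * gres G hB (coc (b p) (b p2)) *
     (gres G h2 (coc (b' q2) (b p2)))^-1)%g.
  by rewrite (cocP h1 hB h3) -(cocP hB' h2 h3) -mulgA mulgV mulg1.
rewrite (e' q q2 V hVq hVq2 hB' hD) eB (e p p2 V hVp hVp2 hA hB) !gresM.
rewrite !(gres_comp _ _ hVp) !(gres_comp _ _ hVq) !(gres_comp _ _ hVp2).
rewrite !(gres_comp _ _ hVq2) (gres_comp _ _ h1) (gres_comp _ _ h2).
by rewrite !invgM !mulgA.
Qed.

(* An element of H^1(X, G), as the set of the cocycles representing it *)
Record H1 := MkH1 {
  represents : cocycle -> Prop;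
  representsP : exists c, forall c', represents c' <-> cohomologous c c'
}.

Definition H1_class (c : cocycle) : H1 :=
  MkH1 (ex_intro _ c (fun c' => iff_refl (cohomologous c c'))).

End Sheaf.

Section Map.
Variables (G H : grpSheaf X) (r : grpHom G H).

Definition cocycle_map (c : cocycle G) : cocycle H.
Proof.
refine (@Cocycle H (cidx c) (@cov _ c) (@cov_covers _ c)
  (fun i j => ghom r (coc (c := c) i j)) _).
by move=> i j l V hij hjl hil; rewrite !ghom_nat -ghomM cocP.
Defined.

Lemma cohomologous_map c c' :
  cohomologous c c' -> cohomologous (cocycle_map c) (cocycle_map c').
Proof.
move=> [K [W [a [b [f [cW ha hb e]]]]]].
have r1 U : ghom r 1%g = 1%g :> H U.
  by apply: (mulgI (ghom r 1%g)); rewrite -ghomM !mulg1.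
have rV U (s : G U) : ghom r s^-1%g = (ghom r s)^-1%g.
  by apply: (mulgI (ghom r s)); rewrite -ghomM !mulgV r1.
exists K, W, a, b, (fun p => ghom r (f p)); split=> // p q V hp hq hA hB.
by rewrite !ghom_nat (e p q V hp hq hA hB) !ghomM rV.
Qed.

Definition H1_map (g : H1 G) : H1 H.
Proof.
refine (@MkH1 H (fun c' => exists2 c, represents g c &
  cohomologous (cocycle_map c) c') _).
have [c cP] := representsP g; exists (cocycle_map c) => c'; split.
  by move=> [d /cP /cohomologous_map cd]; exact: cohomologous_trans cd.
by move=> cc'; exists c => //; apply/cP; exact: cohomologous_refl.
Defined.

End Map.
End Cohomology.

Section ReductionMorphism.
Variables (k : comPzRingType) (X : topologicalType) (O : algSheaf k X).
Variables (m n : nat) (nm : (n <= m)%N).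

Let tredM U (f g : taut O m U) :
  tred nm (f * g)%g = (tred nm f * tred nm g)%g.
Proof.
apply: taut_ext => V h a; rewrite tautM; apply: tcoefP => i ni.
rewrite /= !tcoef_cast //; have e :
    eqmod_t n (tcast m (tred_fun (n := n) g h a)) (ifun g h (tcast m a)).
  by move=> l ln; rewrite !tcoef_cast // (leq_trans ln).
by rewrite (taut_eqmod f h e ni).
Qed.

Let tred_nat U V (h : osub V U) (f : taut O m U) :
  taut_res h (tred nm f) = tred nm (taut_res h f).
Proof. by apply: taut_ext. Qed.

Definition rho : grpHom (autSheaf O m) (autSheaf O n) :=
  @GrpHom X (autSheaf O m) (autSheaf O n) (fun U => @tred k X O m n nm U) tredM tred_nat.

End ReductionMorphism.

Section Thickening.
Variables (k : comPzRingType) (X : topologicalType).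

Record algHom (A B : algSheaf k X) := AlgHom {
  ahom : forall U, {rmorphism A U -> B U};
  ahom_cst : forall U c, ahom U (acst A U c) = acst B U c;
  ahom_nat : forall U V (h : osub V U) a, ares B h (ahom U a) = ahom V (ares A h a)
}.

(* Y = (X, OY), with the closed immersion X -> Y given by p : OY -> O, is the
   primitive multiple scheme of multiplicity m defined by g: there are local
   trivializations tau_i = delta_i^* : O[t]/(t^m) -> OY, inducing the identity
   on O, such that the cocycle tau_i^-1 tau_j represents g. The topological
   space of Y is that of X = Y_red. *)
Definition multiple_scheme_of (O OY : algSheaf k X) (p : algHom OY O) (m : nat)
    (g : H1 (autSheaf O m)) : Prop :=
  exists2 c : cocycle (autSheaf O m), represents g c &
  exists tau : forall i : cidx c, algIso (tsheaf O m) OY (cov i),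
    (forall i V (h : osub V (cov i)) a, ahom p V (ifun (tau i) h a) = tcoef a 0) /\
    (forall i j V (hi : osub V (cov i)) (hj : osub V (cov j))
        (hij : osub V (ocap (cov i) (cov j))) a,
      ifun (tau i) hi (ifun (coc i j) hij a) = ifun (tau j) hj a).

End Thickening.

Section TwistedKernel.
Variables (k : comPzRingType) (X : topologicalType) (O : algSheaf k X).
Variables (n n' : nat) (nn : (n' <= n)%N).

(* t = d . s, for the action of the reduced group on the kernel of the
   reduction induced by conjugation: t = d' s d'^-1 for every local lift d' of d.
   On a smooth X local lifts exist. *)
Definition conj_action (V : opens X) (d : taut O n' V) (s t : taut O n V) : Prop :=
  forall W (h : osub W V) (d' : taut O n W), tred nn d' = taut_res h d ->
    taut_res h t = (d' * taut_res h s * d'^-1)%g.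

Variable c : cocycle (autSheaf O n').

Record twisted (U : opens X) := Twisted {
  tw : forall i : cidx c, taut O n (ocap U (cov i));
  tw_ker : forall i, tred nn (tw i) = 1%g;
  tw_glue : forall (i j : cidx c) V (hi : osub V (ocap U (cov i)))
      (hj : osub V (ocap U (cov j))) (hij : osub V (ocap (cov i) (cov j))),
    conj_action (taut_res hij (coc (c := c) i j)) (taut_res hj (tw j)) (taut_res hi (tw i))
}.

Let trM V (s t : taut O n V) : tred nn (s * t)%g = (tred nn s * tred nn t)%g.
Proof. exact: (ghomM (rho O nn)). Qed.

Let resM V W (h : osub W V) (s t : taut O n V) :
  taut_res h (s * t)%g = (taut_res h s * taut_res h t)%g.
Proof. exact: (gresM (g := autSheaf O n)). Qed.

Let resV V W (h : osub W V) (s : taut O n V) :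
  taut_res h s^-1%g = (taut_res h s)^-1%g.
Proof. exact: (gresV (G := autSheaf O n)). Qed.

Let res1 m V W (h : osub W V) : taut_res h (1%g : taut O m V) = 1%g.
Proof. exact: (gres1 (autSheaf O m) h). Qed.

Let tr1 V : tred nn (1%g : taut O n V) = 1%g.
Proof. by apply: (mulgI (tred nn 1%g)); rewrite -trM !mulg1. Qed.

Let trV V (s : taut O n V) : tred nn s^-1%g = (tred nn s)^-1%g.
Proof. by apply: (mulgI (tred nn s)); rewrite -trM !mulgV tr1. Qed.

Let res_id m V (h : osub V V) (s : taut O m V) : taut_res h s = s.
Proof. exact: (gres_id (G := autSheaf O m)). Qed.

Let res_comp m V W W' (h : osub W V) (h' : osub W' W) (h2 : osub W' V)
    (s : taut O m V) : taut_res h' (taut_res h s) = taut_res h2 s.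
Proof. exact: (gres_comp (G := autSheaf O m)). Qed.

Let tr_res V W (h : osub W V) (s : taut O n V) :
  tred nn (taut_res h s) = taut_res h (tred nn s).
Proof. exact/esym/(ghom_nat (rho O nn)). Qed.

Section Group.
Variable U : opens X.

HB.instance Definition _ := gen_eqMixin (twisted U).
HB.instance Definition _ := gen_choiceMixin (twisted U).

Lemma twisted_ext (s t : twisted U) : (forall i, tw s i = tw t i) -> s = t.
Proof.
case: s t => [s sk sg] [t tk tg] /= st.
have e : s = t by apply: functional_extensionality_dep.
by subst t; rewrite (Prop_irrelevance sk tk) (Prop_irrelevance sg tg).
Qed.

Let one : twisted U.
Proof.
refine (@Twisted U (fun i => 1%g) (fun i => tr1 _) _).
move=> i j V hi hj hij W h d' e.
by rewrite !res1 mulg1 mulgV.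
Defined.

Let mul (s t : twisted U) : twisted U.
Proof.
refine (@Twisted U (fun i => tw s i * tw t i)%g _ _).
  by move=> i; rewrite trM !tw_ker mulg1.
move=> i j V hi hj hij W h d' e; rewrite !resM.
rewrite (tw_glue s hi hj e) (tw_glue t hi hj e).
by rewrite -!mulgA mulKg.
Defined.

Let inv (s : twisted U) : twisted U.
Proof.
refine (@Twisted U (fun i => (tw s i)^-1)%g _ _).
  by move=> i; rewrite trV tw_ker invg1.
move=> i j V hi hj hij W h d' e.
by rewrite !resV (tw_glue s hi hj e) !invgM invgK mulgA.
Defined.

Let mulA : associative mul.
Proof. by move=> f g h; apply: twisted_ext => i /=; rewrite mulgA. Qed.
Let mul1g : left_id one mul.
Proof. by move=> f; apply: twisted_ext => i /=; rewrite mul1g. Qed.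
Let mulg1 : right_id one mul.
Proof. by move=> f; apply: twisted_ext => i /=; rewrite mulg1. Qed.
Let mulVg : left_inverse one inv mul.
Proof. by move=> f; apply: twisted_ext => i /=; rewrite mulVg. Qed.
Let mulgV : right_inverse one inv mul.
Proof. by move=> f; apply: twisted_ext => i /=; rewrite mulgV. Qed.

HB.instance Definition _ := isGroup.Build (twisted U) mulA mul1g mulg1 mulVg mulgV.

End Group.

Definition twisted_res U V (h : osub V U) (s : twisted U) : twisted V.
Proof.
refine (@Twisted V (fun i => taut_res (ocapS h (@osub_refl _ (cov i))) (tw s i)) _ _).
  by move=> i; rewrite tr_res tw_ker res1.
move=> i j W hi hj hij.
have r l (hl : osub W (ocap V (cov l))) (hl' : osub W (ocap U (cov l))) :
    taut_res hl (taut_res (ocapS h (@osub_refl _ (cov l))) (tw s l)) = taut_res hl' (tw s l).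
  exact: res_comp.
have hUi := osub_trans (ocapS h (@osub_refl _ (cov i))) hi.
have hUj := osub_trans (ocapS h (@osub_refl _ (cov j))) hj.
by rewrite (r i hi hUi) (r j hj hUj); exact: tw_glue.
Defined.

Let twisted_resM U V (h : osub V U) (s t : twisted U) :
  twisted_res h (s * t)%g = (twisted_res h s * twisted_res h t)%g.
Proof. by apply: twisted_ext => i; exact: (gresM (g := autSheaf O n)). Qed.

Let twisted_sheaf : is_sheaf twisted_res.
Proof.
have [_ _ gs gg] := gres_sheaf (autSheaf O n).
have [_ _ gs' _] := gres_sheaf (autSheaf O n').
have cap U I (W : I -> opens X) (cW : covers W U) (V : opens X) :
  covers (fun p => ocap (W p) V) (ocap U V).
  by move=> x [Ux Vx]; have [p Wp] := cW x Ux; exists p.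
split.
- by move=> U h s; apply: twisted_ext => i; exact: res_id.
- by move=> U V W hV hW hWU s; apply: twisted_ext => i; exact: res_comp.
- move=> U I W hW cW s t e; apply: twisted_ext => i.
  apply: (gs _ _ _ (fun p => ocapS (hW p) (@osub_refl _ (cov i))) (cap _ _ _ cW _)) => p.
  exact: (congr1 (fun s : twisted (W p) => tw s i) (e p)).
move=> U I W hW cW s e.
have ex i : exists t : taut O n (ocap U (cov i)),
    forall p, taut_res (ocapS (hW p) (@osub_refl _ (cov i))) t = tw (s p) i.
  apply: (gg _ _ _ (fun p => ocapS (hW p) (@osub_refl _ (cov i))) (cap _ _ _ cW _)
    (fun p => tw (s p) i)) => p q V hp hq.
  pose Z := ocap (W p) (W q).
  have := congr1 (fun s : twisted Z => tw s i) (e p q Z (@ocapl _ _ _) (@ocapr _ _ _)).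
  move=> /= eZ; have hZ : osub V (ocap Z (cov i)).
    by move=> x Vx; have [? ?] := hp x Vx; have [? ?] := hq x Vx.
  by have := congr1 (taut_res hZ) eZ; rewrite (res_comp _ _ hp) (res_comp _ _ hq).
pose t i := sval (cid (ex i)).
have tE i p : taut_res (ocapS (hW p) (@osub_refl _ (cov i))) (t i) = tw (s p) i.
  by rewrite /t; case: cid => /= ti.
have tk i : tred nn (t i) = 1%g.
  apply: (gs' _ _ _ (fun p => ocapS (hW p) (@osub_refl _ (cov i))) (cap _ _ _ cW _)) => p.
  have -> : gres (autSheaf O n') (ocapS (hW p) (@osub_refl _ (cov i))) (tred nn (t i)) = 1%g.
    by rewrite -[LHS]tr_res tE tw_ker.
  exact/esym/gres1.
have tg i j V (hi : osub V (ocap U (cov i)))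
      (hj : osub V (ocap U (cov j))) (hij : osub V (ocap (cov i) (cov j))) :
    conj_action (taut_res hij (coc (c := c) i j)) (taut_res hj (t j)) (taut_res hi (t i)).
  move=> V' h d' ed.
  have cV : covers (fun p => ocap (W p) V') V'.
    by move=> x Vx; have [p Wp] := cW x (hi x (h x Vx)).1; exists p.
  apply: (gs _ _ _ (fun p => @ocapr _ (W p) V') cV) => p.
  set V2 := ocap (W p) V'; set hV2 : osub V2 V' := @ocapr _ _ _.
  have hl (l : cidx c) (kl : osub V (ocap U (cov l))) : osub V2 (ocap (W p) (cov l)).
    by move=> x [Wx Vx]; split=> //; have [] := kl x (h x Vx).
  have hij2 : osub V2 (ocap (cov i) (cov j)) := osub_trans hij (osub_trans h hV2).
  have ed2 : tred nn (taut_res hV2 d') =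
      taut_res (@osub_refl _ V2) (taut_res hij2 (coc (c := c) i j)).
    by rewrite tr_res ed (res_comp _ _ (osub_trans h hV2)) (res_comp _ _ hij2) res_id.
  have := tw_glue (s p) (hl i hi) (hl j hj) ed2; rewrite !res_id -!tE.
  have hU (l : cidx c) (kl : osub V (ocap U (cov l))) := osub_trans kl (osub_trans h hV2).
  rewrite (res_comp _ _ (hU i hi)) (res_comp _ _ (hU j hj)) => e2.
  rewrite -[LHS]/(taut_res hV2 (taut_res h (taut_res hi (t i)))).
  rewrite -[RHS]/(taut_res hV2 (d' * taut_res h (taut_res hj (t j)) * d'^-1)%g).
  rewrite !resM resV (res_comp _ _ (osub_trans hi h)) (res_comp _ _ (hU i hi)) e2.
  by rewrite (res_comp _ _ (osub_trans hj h)) (res_comp _ _ (hU j hj)).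
exists (Twisted tk tg) => p; apply: twisted_ext => i; exact: tE.
Qed.

(* The sheaf ker(rho)^c: the families (s_i), s_i in ker(rho) over U :&: U_i, such
   that s_i = c_ij . s_j. *)
Definition twistSheaf : grpSheaf X := GrpSheaf twisted_resM twisted_sheaf.

(* s' = f . s for the O-module structure of the kernel, which is given by
   f . (id + E) = id + f E *)
Definition twisted_scale (U : opens X) (f : O U) (s s' : twisted U) : Prop :=
  forall i V (h : osub V (ocap U (cov i))) (hU : osub V U) a,
    ifun (tw s' i) h a = a + tconst n (ares O hU f) * (ifun (tw s i) h a - a).

End TwistedKernel.

Section Modules.
Variables (k : comPzRingType) (X : topologicalType) (O : algSheaf k X).

Record modHom (M N : modSheaf O) := ModHom {
  mhom : forall U, {linear M U -> N U};
  mhom_nat : forall U V (h : osub V U) s, mres N h (mhom U s) = mhom V (mres M h s)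
}.

Let structure_additive U V (h : osub V U) : {additive (O U)^o -> (O V)^o} := ares O h.

(* O as a module over itself *)
Definition structure_module : modSheaf O :=
  @ModSheaf k X O (fun U => (O U)^o) structure_additive
    (fun U V h a s => rmorphM (ares O h) a s) (ares_sheaf O).

Section InternalHom.
Variables F G : modSheaf O.

(* morphisms F|U -> G|U of O|U-modules *)
Record homsec (U : opens X) := HomSec {
  hfun : forall V, osub V U -> {linear F V -> G V};
  hfun_nat : forall V W (hV : osub V U) (hW : osub W U) (h : osub W V) s,
    mres G h (hfun hV s) = hfun hW (mres F h s)
}.

Lemma linear_ext (A : comPzRingType) (M N : lmodType A) (f g : {linear M -> N}) :
  (forall s, f s = g s) -> f = g.
Proof.
move=> /funext; case: f g => [f [[f1] [f2]]] [g [[g1] [g2]]] /= fg.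
by subst g; rewrite (Prop_irrelevance f1 g1) (Prop_irrelevance f2 g2).
Qed.

Section Lmodule.
Variable U : opens X.

HB.instance Definition _ := gen_eqMixin (homsec U).
HB.instance Definition _ := gen_choiceMixin (homsec U).

Lemma homsec_ext (f g : homsec U) :
  (forall V (h : osub V U) s, hfun f h s = hfun g h s) -> f = g.
Proof.
case: f g => [f fn] [g gn] /= fg.
have e : f = g.
  apply: functional_extensionality_dep => V; apply/funext => h.
  by apply: linear_ext => s; exact: fg.
by subst g; congr HomSec; exact: Prop_irrelevance.
Qed.

Let zero : homsec U.
Proof.
by refine (@HomSec U (fun V h => \0) _) => V W hV hW h s /=; rewrite raddf0.
Defined.

Let add (f g : homsec U) : homsec U.
Proof.
refine (@HomSec U (fun V h => hfun f h \+ hfun g h) _) => V W hV hW h s /=.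
by rewrite raddfD !(hfun_nat _ hV hW).
Defined.

Let opp (f : homsec U) : homsec U.
Proof.
refine (@HomSec U (fun V h => \- hfun f h) _) => V W hV hW h s /=.
by rewrite raddfN !(hfun_nat _ hV hW).
Defined.

Let addA : associative add.
Proof. by move=> f g l; apply: homsec_ext => V h s /=; rewrite addrA. Qed.
Let addC : commutative add.
Proof. by move=> f g; apply: homsec_ext => V h s /=; rewrite addrC. Qed.
Let add0 : left_id zero add.
Proof. by move=> f; apply: homsec_ext => V h s /=; rewrite add0r. Qed.
Let addN : left_inverse zero opp add.
Proof. by move=> f; apply: homsec_ext => V h s /=; rewrite addNr. Qed.

HB.instance Definition _ := GRing.isZmodule.Build (homsec U) addA addC add0 addN.

Let scale_fun (a : O U) (f : homsec U) V (h : osub V U) (s : F V) : G V :=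
  ares O h a *: hfun f h s.

Let scale_linear a f V h : linear (@scale_fun a f V h).
Proof. by move=> b s t; rewrite /scale_fun linearP scalerDr !scalerA mulrC. Qed.

HB.instance Definition _ a f V h :=
  GRing.isLinear.Build (O V) (F V) (G V) *:%R (@scale_fun a f V h)
    (@scale_linear a f V h).

Let scale (a : O U) (f : homsec U) : homsec U.
Proof.
refine (@HomSec U (fun V h => @scale_fun a f V h) _) => V W hV hW h s /=.
have [_ r2 _ _] := ares_sheaf O.
by rewrite /scale_fun mresZ (hfun_nat _ hV hW) (r2 _ _ _ _ _ hW).
Defined.

Let scaleA a b f : scale a (scale b f) = scale (a * b) f.
Proof. by apply: homsec_ext => V h s /=; rewrite /scale_fun rmorphM scalerA. Qed.
Let scale1 : left_id 1 scale.
Proof. by move=> f; apply: homsec_ext => V h s /=; rewrite /scale_fun rmorph1 scale1r. Qed.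
Let scaleDr : right_distributive scale +%R.
Proof. by move=> a f g; apply: homsec_ext => V h s /=; rewrite /scale_fun scalerDr. Qed.
Let scaleDl f : {morph scale^~ f : a b / a + b}.
Proof. by move=> a b; apply: homsec_ext => V h s /=; rewrite /scale_fun rmorphD scalerDl. Qed.

HB.instance Definition _ :=
  GRing.Zmodule_isLmodule.Build (O U) (homsec U) scaleA scale1 scaleDr scaleDl.

Lemma homsecZ a (f : homsec U) V (h : osub V U) s :
  hfun (a *: f) h s = ares O h a *: hfun f h s.
Proof. by []. Qed.

End Lmodule.

Definition homsec_res U V (h : osub V U) (f : homsec U) : homsec V :=
  @HomSec V (fun W hW => hfun f (osub_trans h hW))
    (fun W W' hW hW' hh s => hfun_nat f (osub_trans h hW) (osub_trans h hW') hh s).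

Let homsec_res_zmod U V (h : osub V U) : zmod_morphism (homsec_res h).
Proof. by move=> f g; apply: homsec_ext. Qed.

HB.instance Definition _ U V h :=
  GRing.isZmodMorphism.Build (homsec U) (homsec V) (@homsec_res U V h)
    (homsec_res_zmod h).

Let homsec_resZ U V (h : osub V U) (a : O U) f :
  homsec_res h (a *: f) = ares O h a *: homsec_res h f.
Proof.
apply: homsec_ext => W hW s; have [_ r2 _ _] := ares_sheaf O.
have e : ares O hW (ares O h a) = ares O (osub_trans h hW) a by exact: r2.
by rewrite [RHS]homsecZ e.
Qed.

Lemma hfun_irr U (f : homsec U) V (h h' : osub V U) s : hfun f h s = hfun f h' s.
Proof. by rewrite (Prop_irrelevance h h'). Qed.

Let homsec_sheaf : is_sheaf homsec_res.
Proof.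
have [_ F2 _ _] := mres_sheaf F; have [G1 G2 Gs _] := mres_sheaf G.
have [F1 _ _ _] := mres_sheaf F.
have eqG U I (W : I -> opens X) (cW : covers W U) V (h : osub V U) (a b : G V) :
    (forall i V' (hV : osub V' V) (hi : osub V' (W i)),
      mres G hV a = mres G hV b) -> a = b.
  move=> ab; have cap : covers (fun i => ocap V (W i)) V.
    by move=> x Vx; have [i Wx] := cW x (h x Vx); exists i.
  apply: (Gs V _ _ (fun i => @ocapl _ V (W i)) cap) => i.
  exact: (ab i _ _ (@ocapr _ V (W i))).
split.
- by move=> U h f; apply: homsec_ext => V hV s; exact: (hfun_irr f).
- by move=> U V W hV hW hWU f; apply: homsec_ext => V' hV' s; exact: (hfun_irr f).
- move=> U I W hW cW f g e; apply: homsec_ext => V h s.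
  apply: (eqG _ _ _ cW _ h) => i V' hV hi; rewrite !(hfun_nat _ h (osub_trans h hV)).
  have := congr1 (fun f => hfun f hi (mres F hV s)) (e i).
  by rewrite /= (hfun_irr f _ (osub_trans h hV)) (hfun_irr g _ (osub_trans h hV)).
move=> U I W hW cW s e.
have compat i j V (hi : osub V (W i)) (hj : osub V (W j)) a :
    hfun (s i) hi a = hfun (s j) hj a.
  have := congr1 (fun f => hfun f (@osub_refl _ V) a) (e i j V hi hj).
  by rewrite /= (hfun_irr _ _ hi) (hfun_irr _ _ hj).
have [f hf] := glue_natural (n := fun i V h a => hfun (s i) h a) (mres_sheaf F)
  (mres_sheaf G) hW cW (fun i V V' h h' hV a => hfun_nat (s i) h h' hV a) compat.
have fL V h : linear (f V h).
  move=> a x y; apply: (eqG _ _ _ cW _ h) => i V' hV hi.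
  by rewrite raddfD mresZ !(hf _ _ i _ _ hi) raddfD mresZ linearP.
pose H V h : {linear F V -> G V} := HB.pack (f V h)
  (GRing.isLinear.Build _ _ _ _ (f V h) (fL V h)).
have Hn V V' (h : osub V U) (h' : osub V' U) (hV : osub V' V) a :
    mres G hV (H V h a) = H V' h' (mres F hV a).
  apply: (eqG _ _ _ cW _ h') => i V2 hV2 hi; rewrite (hf _ _ i _ _ hi).
  by rewrite (G2 _ _ _ _ _ (osub_trans hV hV2)) (hf _ _ i _ _ hi) (F2 _ _ _ _ _ (osub_trans hV hV2)).
exists (HomSec Hn) => i; apply: homsec_ext => V hi a /=.
by rewrite -(G1 V (@osub_refl _ V) (f V _ a)) (hf _ _ i _ _ hi) F1.
Qed.

Definition homSheaf : modSheaf O :=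
  @ModSheaf k X O (fun U => homsec U) (fun U V h => homsec_res h)
    homsec_resZ homsec_sheaf.

End InternalHom.

Definition dual_module (F : modSheaf O) : modSheaf O := homSheaf F structure_module.

Definition bilinear_pairing (F G T : modSheaf O) (b : forall U, F U -> G U -> T U) :=
  [/\ forall U x, linear (b U x), forall U y, linear (b U ^~ y)
    & forall U V (h : osub V U) x y,
        mres T h (b U x y) = b V (mres F h x) (mres G h y)].

(* (T, b) is the tensor product of F and G over O *)
Definition is_tensor (F G T : modSheaf O) (b : forall U, F U -> G U -> T U) : Prop :=
  bilinear_pairing b /\
  forall (M : modSheaf O) (b' : forall U, F U -> G U -> M U), bilinear_pairing b' ->
    exists u : modHom T M, (forall U x y, mhom u U (b U x y) = b' U x y) /\
      forall v : modHom T M, (forall U x y, mhom v U (b U x y) = b' U x y) ->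
      forall U t, mhom v U t = mhom u U t.

Inductive tensor_power (L : modSheaf O) : nat -> modSheaf O -> Prop :=
| tensor_power0 : tensor_power L 0 structure_module
| tensor_powerS j (P Q : modSheaf O) (b : forall U, P U -> L U -> Q U) :
    tensor_power L j P -> is_tensor b -> tensor_power L j.+1 Q.

Definition derivation (M : modSheaf O) (d : forall U, O U -> M U) : Prop :=
  [/\ forall U a b, d U (a + b) = d U a + d U b,
      forall U a b, d U (a * b) = a *: d U b + b *: d U a,
      forall U c, d U (acst O U c) = 0
    & forall U V (h : osub V U) a, mres M h (d U a) = d V (ares O h a)].

(* (Om, d) is the sheaf of differentials of (X, O) over k *)
Definition is_differentials (Om : modSheaf O) (d : forall U, O U -> Om U) : Prop :=
  derivation d /\
  forall (M : modSheaf O) (D : forall U, O U -> M U), derivation D ->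
    exists u : modHom Om M, (forall U a, mhom u U (d U a) = D U a) /\
      forall v : modHom Om M, (forall U a, mhom v U (d U a) = D U a) ->
      forall U s, mhom v U s = mhom u U s.

End Modules.

Section Restriction.
Variables (k : comPzRingType) (X : topologicalType) (OY O : algSheaf k X).
Variable p : algHom OY O.

Definition semilinear_map (M : modSheaf OY) (N : modSheaf O) (r : forall U, M U -> N U) :=
  [/\ forall U x y, r U (x + y) = r U x + r U y,
      forall U a x, r U (a *: x) = ahom p U a *: r U x
    & forall U V (h : osub V U) x, mres N h (r U x) = r V (mres M h x)].

(* (N, r) is the restriction M|X, i.e. the tensor product of M and O over OY *)
Definition is_restriction (M : modSheaf OY) (N : modSheaf O)
    (r : forall U, M U -> N U) : Prop :=
  semilinear_map r /\
  forall (N' : modSheaf O) (r' : forall U, M U -> N' U), semilinear_map r' ->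
    exists u : modHom N N', (forall U x, mhom u U (r U x) = r' U x) /\
      forall v : modHom N N', (forall U x, mhom v U (r U x) = r' U x) ->
      forall U s, mhom v U s = mhom u U s.

Definition ideal_sheaf (U : opens X) : set (OY U) := [set s | ahom p U s = 0].

Definition ideal_sheaf_sq (U : opens X) : set (OY U) := [set s |
  forall x, oset U x -> exists (V : opens X) (h : osub V U), oset V x /\
    exists2 r : seq (OY V * OY V),
      {in r, forall ab, ideal_sheaf ab.1 /\ ideal_sheaf ab.2} &
      ares OY h s = \sum_(ab <- r) ab.1 * ab.2].

(* L = I/I^2 for the ideal sheaf I of X in Y, by a surjective morphism of sheaves
   l : I -> L with kernel I^2; the values of l outside I are irrelevant. *)
Definition is_conormal (L : modSheaf O) (l : forall U, OY U -> L U) : Prop :=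
  [/\ forall U s t, ideal_sheaf s -> ideal_sheaf t ->
        l U (s + t) = l U s + l U t,
      forall U a s, ideal_sheaf s -> l U (a * s) = ahom p U a *: l U s,
      forall U V (h : osub V U) s, ideal_sheaf s ->
        mres L h (l U s) = l V (ares OY h s),
      forall U s, ideal_sheaf s -> (l U s = 0 <-> ideal_sheaf_sq s)
    & forall U (t : L U) x, oset U x -> exists (V : opens X) (h : osub V U),
        oset V x /\ exists2 s, ideal_sheaf s & l V s = mres L h t].

End Restriction.

(* Main.v *)
From HB Require Import structures.
Require Import Defs.
From mathcomp Require Import all_boot all_order all_algebra.
From mathcomp Require Import all_classical all_reals topology.
From mathcomp Require Import complex.

(* An element of ker(rho_n) over V is id + t^(n-1) D, where D(x) depends only on
   x mod t^2 and is a derivation O[t]/(t^2) -> O over x |-> x_0. Conjugation by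
   a lift of an automorphism delta with delta(t) = u t + ... replaces D by
   u^(n-1) D o delta^-1, which involves delta only modulo t^2; local lifts exist
   since X is smooth.
   Trivializations tau_i : O[t]/(t^2) -> OY adapted to the cocycle delta_ij modulo
   t^2 turn D_i into the derivation D_i o tau_i^-1 : OY -> O, i.e. a section of
   the dual of Omega_Y|X, and e_i = l(tau_i t) generates L over U_i. The relations
   D_i tau_i^-1 = u_ij^(n-1) D_j tau_j^-1 and e_j = u_ij e_i show that the sections
   (D_i tau_i^-1) (x) e_i^(n-1) agree on overlaps. *)

Set Implicit Arguments.
Unset Strict Implicit.
Unset Printing Implicit Defensive.
(* [Defs] is imported again because [tuple] also defines a [tcast]. *)
Import GRing.Theory Defs.
Local Open Scope ring_scope.

(** * Truncated polynomials *)

(** Two obstacles shape the proof. The lifts in question are automorphisms of sheaves, while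
    smoothness lifts a single ring morphism out of the sections over an affine open set; that
    morphism is extended to smaller open sets by writing sections there locally as fractions. As the
    action is defined through all lifts, which need not exist over a given open set, [conj_actionP]
    turns it into a formula free of lifts. Tensor products, differentials and restrictions are
    characterized by universal properties among modules on all of X, whereas generators and
    derivations live over an open set W. The module U |-> M(U cap W) bridges the gap: a pairing or a
    derivation defined over W becomes global with values in it. The condition n > 2 makes t^(n-1)
    vanish modulo t^2. Hence D kills t^(n-1), products in the kernel become sums of derivations, and
    the cocycle of g_(n-1) can be reduced to one of g_2. *)

Section TruncatedMonomials.
Variables (m : nat) (A : comPzRingType).
Implicit Types x y : tpoly m A.

Lemma tcoef0 i : tcoef (0 : tpoly m A) i = 0.
Proof. by rewrite -[0 in LHS](subrr 0) tcoefB subrr. Qed.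

Lemma tcoefN x i : tcoef (- x) i = - tcoef x i.
Proof. by rewrite -sub0r tcoefB tcoef0 sub0r. Qed.

Lemma tcoefD x y i : tcoef (x + y) i = tcoef x i + tcoef y i.
Proof. by rewrite -[y in LHS]opprK tcoefB tcoefN opprK. Qed.

Lemma tcoef_sum (I : Type) (s : seq I) (P : pred I) (F : I -> tpoly m A) i :
  tcoef (\sum_(j <- s | P j) F j) i = \sum_(j <- s | P j) tcoef (F j) i.
Proof. exact: (big_morph (fun x => tcoef x i) (fun x y => tcoefD x y i) (tcoef0 i)). Qed.

Lemma tcoefM0 x y : tcoef (x * y) 0 = tcoef x 0 * tcoef y 0.
Proof.
have [m0|m0] := posnP m; first by rewrite !tcoef_ge ?m0 // mul0r.
by rewrite tcoefM // big_ord_recl big_ord0 addr0.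
Qed.

Lemma tcoefX0 x j : (0 < m)%N -> tcoef (x ^+ j) 0 = tcoef x 0 ^+ j.
Proof.
move=> m0; elim: j => [|j IH]; first by rewrite !expr0 tcoef1 m0.
by rewrite !exprS tcoefM0 IH.
Qed.

Definition tmono (k : nat) (c : A) : tpoly m A :=
  [ffun i : 'I_m => if i == k :> nat then c else 0].

Lemma tcoef_mono k c i :
  tcoef (tmono k c) i = if (i == k) && (i < m)%N then c else 0.
Proof.
rewrite /tcoef; case: insubP => [j _ <-|]; first by rewrite ffunE ltn_ord andbT.
by move/negbTE => ->; rewrite andbF.
Qed.

Lemma tconst_mono c : tconst m c = tmono 0 c.
Proof. by []. Qed.

Lemma tmonoD k c d : tmono k (c + d) = tmono k c + tmono k d.
Proof. by apply/ffunP => i; rewrite !ffunE; case: eqP => _; rewrite ?addr0. Qed.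

Lemma tmono0 k : tmono k 0 = 0.
Proof. by apply/ffunP => i; rewrite !ffunE; case: eqP. Qed.

Lemma tmonoN k c : tmono k (- c) = - tmono k c.
Proof. by apply/ffunP => i; rewrite !ffunE; case: eqP => _; rewrite ?oppr0. Qed.

Lemma tcoef_monoM k c x l : (l < m)%N ->
  tcoef (tmono k c * x) l = if (k <= l)%N then c * tcoef x (l - k) else 0.
Proof.
move=> lm; rewrite tcoefM //; case: leqP => kl; last first.
  rewrite big1 // => i _; rewrite tcoef_mono; case: eqP => /= [ik|]; last by rewrite mul0r.
  by have := ltn_ord i; rewrite ik ltnS leqNgt kl.
rewrite (bigD1 (Ordinal (kl : (k < l.+1)%N))) //= big1 => [|i ik].
  by rewrite addr0 tcoef_mono eqxx (leq_ltn_trans kl lm).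
rewrite tcoef_mono; case: eqP => /= [e|]; last by rewrite mul0r.
by case/eqP: ik; apply: val_inj.
Qed.

Lemma tmonoM j k c d : tmono j c * tmono k d = tmono (j + k) (c * d).
Proof.
apply: tcoefP => i im; rewrite tcoef_monoM // !tcoef_mono im andbT.
rewrite (leq_ltn_trans (leq_subr _ _) im) andbT.
case: leqP => ji; last first.
  by case: eqP => // e; move: ji; rewrite e ltnNge leq_addr.
by rewrite -[in RHS](subnKC ji) eqn_add2l; case: eqP => _; rewrite ?mulr0.
Qed.

Lemma tmonoX c j : (0 < m)%N -> tmono 1 c ^+ j = tmono j (c ^+ j).
Proof.
move=> m0; elim: j => [|j IH]; last by rewrite !exprS IH tmonoM.
by rewrite !expr0; apply: tcoefP => i im; rewrite [LHS]tcoef1 [RHS]tcoef_mono im m0.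
Qed.

Lemma tmono_ge k c : (m <= k)%N -> tmono k c = 0.
Proof.
move=> mk; apply: tcoefP => i im; rewrite tcoef_mono tcoef0.
by case: eqP => // e; rewrite e ltnNge mk in im.
Qed.

Lemma tcoef_constM c x l : tcoef (tconst m c * x) l = c * tcoef x l.
Proof.
have [ml|lm] := leqP m l; first by rewrite !tcoef_ge // mulr0.
by rewrite tcoef_monoM // subn0.
Qed.

(** Multiplication by t^(m-1) kills the ideal (t), so only the constant coefficient of [x]
    survives. *)
Lemma tmono_lastM c x : (0 < m)%N -> tmono m.-1 c * x = tmono m.-1 (c * tcoef x 0).
Proof.
move=> m0; apply: tcoefP => i im; rewrite tcoef_monoM // tcoef_mono im andbT.
have [e|mi] := eqVneq i m.-1; first by rewrite e leqnn subnn.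
rewrite leqNgt ltn_neqAle mi -ltnS prednK // im //.
Qed.

Lemma tmono_last_eq x y : eqmod_t m.-1 x y ->
  y = x + tmono m.-1 (tcoef y m.-1 - tcoef x m.-1).
Proof.
move=> xy; apply: tcoefP => i im; rewrite tcoefD tcoef_mono im andbT.
have [->|mi] := eqVneq i m.-1; first by rewrite addrC subrK.
rewrite addr0 xy // ltn_neqAle mi -ltnS prednK //.
exact: leq_ltn_trans im.
Qed.

(** The quotient by t^k is determined only modulo t^(m-k), whence the bound on [i] in the second
    clause. *)
Lemma eqmod_t0_factor k x : eqmod_t k x 0 -> exists w, x = tmono k 1 * w /\
  (forall i, (i + k < m)%N -> tcoef w i = tcoef x (i + k)).
Proof.
move=> x0; exists [ffun i : 'I_m => tcoef x (i + k)]; split; last first.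
  move=> i ikm; have im : (i < m)%N := leq_ltn_trans (leq_addr k i) ikm.
  by rewrite (tcoefE _ (Ordinal im)) ffunE.
apply: tcoefP => l lm; rewrite tcoef_monoM //; case: leqP => kl.
  have lk : (l - k < m)%N by exact: leq_ltn_trans (leq_subr _ _) lm.
  by rewrite (tcoefE _ (Ordinal lk)) ffunE /= subnK // mul1r.
by rewrite x0 // tcoef0.
Qed.

End TruncatedMonomials.

Lemma tcoef_map (m : nat) (A B : comPzRingType) (f : {rmorphism A -> B}) (x : tpoly m A) i :
  tcoef (tmap f x) i = f (tcoef x i).
Proof. by rewrite /tcoef; case: insub => [j|]; rewrite ?ffunE ?rmorph0. Qed.

Lemma tmap_mono (m : nat) (A B : comPzRingType) (f : {rmorphism A -> B}) k c :
  tmap f (tmono m k c) = tmono m k (f c).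
Proof. by apply/ffunP => i; rewrite !ffunE; case: eqP => _; rewrite ?rmorph0. Qed.

Section Truncation.
Variables (m k : nat) (km : (k <= m)%N) (A : comPzRingType).

(* The proof argument lets unification find the morphism instances below. *)
Definition ttrunc (_ : (k <= m)%N) : tpoly m A -> tpoly k A := @tcast m k A.
Local Notation tr := (ttrunc km).

Let ttrunc_zmod : zmod_morphism tr.
Proof. by move=> a b; apply/ffunP => i; rewrite !ffunE tcoefB. Qed.

Let ttrunc_monoid : monoid_morphism tr.
Proof.
split=> [|a b]; apply: tcoefP => i ik; have im := leq_trans ik km.
  by rewrite tcoef_cast // !tcoef1 (leq_ltn_trans _ ik) // (leq_ltn_trans _ im).
rewrite tcoef_cast // !tcoefM //; apply: eq_bigr => j _.
have jk : (j < k)%N by rewrite (leq_ltn_trans _ ik) // -ltnS.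
by rewrite !tcoef_cast // (leq_ltn_trans (leq_subr _ _)).
Qed.

HB.instance Definition _ :=
  GRing.isZmodMorphism.Build (tpoly m A) (tpoly k A) tr ttrunc_zmod.
HB.instance Definition _ :=
  GRing.isMonoidMorphism.Build (tpoly m A) (tpoly k A) tr ttrunc_monoid.

End Truncation.

Section TruncationLemmas.
Variables (A : comPzRingType).

Lemma tcast_0 (m k : nat) : tcast k (0 : tpoly m A) = 0.
Proof. by apply: tcoefP => i ik; rewrite tcoef_cast // !tcoef0. Qed.

Lemma tcast_add (m k : nat) (x y : tpoly m A) :
  tcast k (x + y) = tcast k x + tcast k y.
Proof. by apply: tcoefP => i ik; rewrite tcoefD !tcoef_cast // tcoefD. Qed.

Lemma tcast_sub (m k : nat) (x y : tpoly m A) :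
  tcast k (x - y) = tcast k x - tcast k y.
Proof. by apply: tcoefP => i ik; rewrite tcoefB !tcoef_cast // tcoefB. Qed.

Lemma tcast_mul (m k : nat) (km : (k <= m)%N) (x y : tpoly m A) :
  tcast k (x * y) = tcast k x * tcast k y.
Proof. exact: (rmorphM (ttrunc km)). Qed.

Lemma tcast_tcast (m k l : nat) (x : tpoly m A) : (l <= k)%N ->
  tcast l (tcast k x) = tcast l x.
Proof.
by move=> lk; apply: tcoefP => i il; rewrite !tcoef_cast // (leq_trans il).
Qed.

Lemma tcast_mono (m k i : nat) (c : A) : (k <= m)%N ->
  tcast k (tmono m i c) = tmono k i c.
Proof.
move=> km; apply: tcoefP => l lk; rewrite tcoef_cast // !tcoef_mono lk.
by rewrite (leq_trans lk).
Qed.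

Lemma tcast_pad (m k : nat) (x : tpoly k A) : (k <= m)%N -> tcast k (tcast m x) = x.
Proof.
by move=> km; apply: tcoefP => l lk; rewrite !tcoef_cast // (leq_trans lk).
Qed.

Lemma tcast_eqmod (m k : nat) (x y : tpoly m A) :
  tcast k x = tcast k y -> eqmod_t k x y.
Proof. by move=> e i ik; rewrite -[LHS](tcoef_cast _ ik) e tcoef_cast. Qed.

Lemma eqmod_tcast (m k : nat) (x y : tpoly m A) :
  eqmod_t k x y -> tcast k x = tcast k y.
Proof. by move=> e; apply: tcoefP => i ik; rewrite !tcoef_cast // e. Qed.

End TruncationLemmas.

Lemma tcast_map (m k : nat) (A B : comPzRingType) (f : {rmorphism A -> B}) (x : tpoly m A) :
  tcast k (tmap f x) = tmap f (tcast k x).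
Proof. by apply: tcoefP => i ik; rewrite tcoef_cast // !tcoef_map tcoef_cast. Qed.

(** * Substitution of a nilpotent element for t *)

Section Evaluation.
Variables (m : nat) (A B : comPzRingType) (f : {rmorphism A -> B}) (z : B).
Hypotheses (m0 : (0 < m)%N) (zm : z ^+ m = 0).

Definition teval (x : tpoly m A) : B := \sum_(i < m) f (x i) * z ^+ i.

(** Terms of degree at least m disappear on both sides: by truncation in the product of polynomials,
    by z^m = 0 in the product of values. *)
Lemma teval_monoid : monoid_morphism teval.
Proof.
split=> [|x y]; rewrite /teval.
  rewrite (bigD1 (Ordinal m0)) //= big1 => [|i i0].
    by rewrite ffunE /= rmorph1 expr0 mulr1 addr0.
  rewrite ffunE; case: eqP => [e|_]; last by rewrite rmorph0 mul0r.
  by case/eqP: i0; exact: val_inj.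
have zge k : (m <= k)%N -> z ^+ k = 0.
  by move=> mk; rewrite -(subnK mk) exprD zm mulr0.
transitivity (\sum_(i < m) \sum_(j < m) f (x i) * f (y j) * z ^+ (i + j)); last first.
  rewrite mulr_suml; apply: eq_bigr => i _; rewrite mulr_sumr; apply: eq_bigr => j _.
  by rewrite exprD mulrACA.
transitivity (\sum_(k < m) \sum_(i < m) \sum_(j < m)
   if (i + j)%N == k :> nat then f (x i) * f (y j) * z ^+ (i + j) else 0).
  apply: eq_bigr => k _; rewrite ffunE rmorph_sum mulr_suml; apply: eq_bigr => i _.
  rewrite rmorph_sum mulr_suml big_mkcond; apply: eq_bigr => j _.
  by case: eqP => // ->; rewrite rmorphM.
rewrite exchange_big; apply: eq_bigr => i _; rewrite exchange_big; apply: eq_bigr => j _.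
have [ijm|ijm] := ltnP (i + j) m; last first.
  rewrite zge // mulr0 big1 // => k _; case: eqP => //.
rewrite (bigD1 (Ordinal ijm)) //= eqxx big1 ?addr0 // => k.
by rewrite -val_eqE /= eq_sym; case: eqP.
Qed.

Lemma teval_zmod : zmod_morphism teval.
Proof.
move=> x y; rewrite /teval -sumrB; apply: eq_bigr => i _.
by rewrite !ffunE rmorphB mulrBl.
Qed.

Lemma teval_const c : teval (tconst m c) = f c.
Proof.
rewrite /teval (bigD1 (Ordinal m0)) //= big1 => [|i i0].
  by rewrite ffunE expr0 mulr1 addr0.
rewrite ffunE; case: eqP => [e|_]; last by rewrite rmorph0 mul0r.
by case/eqP: i0; exact: val_inj.
Qed.

End Evaluation.

Lemma tpoly_sum (m : nat) (A : comPzRingType) (x : tpoly m A) : (0 < m)%N ->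
  x = \sum_(i < m) tconst m (x i) * tmono m 1 1 ^+ i.
Proof.
move=> m0; apply: tcoefP => l lm; rewrite tcoef_sum.
rewrite (bigD1 (Ordinal lm)) //= big1 => [|i il].
  rewrite tcoef_constM tmonoX // expr1n tcoef_mono eqxx lm mulr1 addr0.
  exact: (tcoefE x (Ordinal lm)).
rewrite tcoef_constM tmonoX // tcoef_mono; case: eqP => [e|_]; last by rewrite mulr0.
by case/eqP: il; exact: val_inj.
Qed.

(** * The kernel of the reduction *)

Section KernelElements.
Variables (k : comPzRingType) (X : topologicalType) (O : algSheaf k X).

(** An automorphism trivial modulo t preserves the ideals (t^j), so the truncation of its value
    depends only on the truncation of the argument. *)
Lemma tred_eqmod (m j : nat) (jm : (j <= m)%N) (U : opens X) (f : taut O m U)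
    (g : taut O j U) V (h : osub V U) (x : tpoly m (O V)) :
  tred jm f = g -> tcast j (ifun f h x) = ifun g h (tcast j x).
Proof.
move=> <-; apply: eqmod_tcast; apply: taut_eqmod.
by move=> i ij; rewrite tcoef_cast ?tcoef_cast // (leq_trans ij).
Qed.

Lemma tredE (m j : nat) (jm : (j <= m)%N) (U : opens X) (f : taut O m U)
    V (h : osub V U) (x : tpoly j (O V)) :
  ifun (tred jm f) h x = tcast j (ifun f h (tcast m x)).
Proof. by []. Qed.

Lemma tred_eqP (m j : nat) (jm : (j <= m)%N) (U : opens X) (f : taut O m U)
    (g : taut O j U) :
  (forall V (h : osub V U) x, tcast j (ifun f h x) = ifun g h (tcast j x)) ->
  tred jm f = g.
Proof. by move=> fg; apply: taut_ext => V h a; rewrite tredE fg tcast_pad. Qed.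

Lemma tred_res (m j : nat) (jm : (j <= m)%N) (U V : opens X) (h : osub V U)
    (f : taut O m U) : tred jm (taut_res h f) = taut_res h (tred jm f).
Proof. exact/esym/(ghom_nat (rho O jm)). Qed.

Lemma tred_mul (m j : nat) (jm : (j <= m)%N) (U : opens X) (f g : taut O m U) :
  tred jm (f * g)%g = (tred jm f * tred jm g)%g.
Proof. exact: (ghomM (rho O jm)). Qed.

Lemma tred_1 (m j : nat) (jm : (j <= m)%N) (U : opens X) :
  tred jm (1%g : taut O m U) = 1%g.
Proof. by apply: (mulgI (tred jm 1%g)); rewrite -tred_mul !mulg1. Qed.

Lemma tred_tred (m j i : nat) (jm : (j <= m)%N) (ij : (i <= j)%N) (im : (i <= m)%N)
    (U : opens X) (f : taut O m U) : tred ij (tred jm f) = tred im f.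
Proof.
apply/esym/tred_eqP => V h x; rewrite -(tcast_tcast x ij).
rewrite -(tred_eqmod h (tcast j x) (erefl (tred ij (tred jm f)))).
by rewrite -(tred_eqmod h x (erefl (tred jm f))) tcast_tcast.
Qed.

Lemma taut_tmap (m : nat) (U V W : opens X) (f : taut O m U) (hV : osub V U)
    (hW : osub W U) (h : osub W V) (x : tpoly m (O V)) :
  tmap (ares O h) (ifun f hV x) = ifun f hW (tmap (ares O h) x).
Proof. exact: (ifun_nat f hV hW h x). Qed.

Lemma taut_mono1 (m : nat) (U V : opens X) (f : taut O m U) (h : osub V U) :
  exists w, ifun f h (tmono m 1 1) = tmono m 1 1 * w /\
    ((1 < m)%N -> tcoef w 0 = tcoef (ifun f h (tmono m 1 1)) 1).
Proof.
have [|w [e wE]] := @eqmod_t0_factor m (O V) 1 (ifun f h (tmono m 1 1)).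
  by case=> // _; rewrite tvalP tcoef_mono tcoef0.
by exists w; split=> // m1; rewrite wE.
Qed.

(** Write f(t) = t w. Then f(t^(m-1)) = t^(m-1) w^(m-1), where only w_0, the coefficient of t in
    f(t), counts. This is the origin of the exponent n-1 of L. *)
Lemma taut_mono_last (m : nat) (U V : opens X) (f : taut O m U) (h : osub V U) c :
  (1 < m)%N -> ifun f h (tmono m m.-1 c) =
    tmono m m.-1 (tcoef (ifun f h (tmono m 1 1)) 1 ^+ m.-1 * c).
Proof.
move=> m1; have m0 := ltnW m1; have [w [e wE]] := taut_mono1 f h; rewrite -(wE m1).
have -> : tmono m m.-1 c = tmono m m.-1 1 * tconst m c.
  by rewrite tmonoM addn0 mul1r.
have tX : tmono m 1 (1 : O V) ^+ m.-1 = tmono m m.-1 1 by rewrite tmonoX // expr1n.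
rewrite -[in LHS]tX rmorphM rmorphXn /= e exprMn tX -mulrA tmono_lastM //.
by rewrite mul1r tcoefM0 tcoefX0 // tvalP tcoef_mono eqxx m0.
Qed.

(** With f(t) = t w and f^-1(t) = t v, applying f to f^-1(t) gives t = t w f(v), and the coefficient
    of t reads w_0 v_0 = 1. *)
Lemma taut_unit (m : nat) (U V : opens X) (f : taut O m U) (h : osub V U) :
  (1 < m)%N -> exists u, u * tcoef (ifun f h (tmono m 1 1)) 1 = 1.
Proof.
move=> m1; have m0 := ltnW m1; have [w [e wE]] := taut_mono1 f h.
have [v [e' vE]] := taut_mono1 f^-1%g h; exists (tcoef v 0); rewrite -wE //.
have: ifun f h (ifun f^-1%g h (tmono m 1 1)) = tmono m 1 1.
  by rewrite tautV iinvK.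
rewrite e' rmorphM /= e => /(congr1 (fun x => tcoef x 1)).
rewrite -mulrA tcoef_monoM //= mul1r tcoefM0 tvalP tcoef_mono m1 /=.
by rewrite mulrC.
Qed.

Variables (n : nat) (n2 : (2 < n)%N).
Let n0 : (0 < n)%N := ltnW (ltnW n2).
Let n1 : (1 < n)%N := ltnW n2.
Let n'1 : (1 < n.-1)%N. Proof. by rewrite -ltnS prednK. Qed.
Let n'0 : (0%N == n.-1) = false. Proof. by case: (n) n2 => [|[]]. Qed.
Let n'n : (n.-1 < n)%N. Proof. by rewrite prednK. Qed.

Section Part.
Variables (U : opens X) (g : taut O n U).

Definition dpart V (h : osub V U) (x : tpoly n (O V)) : O V :=
  tcoef (ifun g h x) n.-1 - tcoef x n.-1.

(** The derivation D of the overview when [g] lies in the kernel. Padding from degree 2 to n is not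
    multiplicative, so the product rule is obtained through [dpart] and [dpart_kpart]. *)
Definition kpart V (h : osub V U) (x : tpoly 2 (O V)) : O V := dpart h (tcast n x).

Hypothesis gk : tred (leq_pred n) g = 1%g.

Lemma kerE V (h : osub V U) x : ifun g h x = x + tmono n n.-1 (dpart h x).
Proof.
apply: tmono_last_eq; apply: tcast_eqmod.
by rewrite (tred_eqmod _ _ gk) taut1.
Qed.

Lemma dpartE V (h : osub V U) x d :
  ifun g h x = x + tmono n n.-1 d -> dpart h x = d.
Proof. by move=> e; rewrite /dpart e tcoefD tcoef_mono eqxx n'n addrC addrA addNr add0r. Qed.

Lemma dpartD V (h : osub V U) x y : dpart h (x + y) = dpart h x + dpart h y.
Proof. by apply: dpartE; rewrite rmorphD /= !kerE tmonoD addrACA. Qed.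

(** Expand (x + t^(n-1) Dx)(y + t^(n-1) Dy): the last product vanishes because n-1 > 0, and t^(n-1)
    only sees constant coefficients in the mixed terms. *)
Lemma dpartM V (h : osub V U) x y :
  dpart h (x * y) = tcoef x 0 * dpart h y + tcoef y 0 * dpart h x.
Proof.
apply: dpartE; rewrite rmorphM /= !kerE mulrDl (mulrDr x) (mulrDr (tmono _ _ _)).
rewrite [x * tmono _ _ _]mulrC !tmono_lastM // tcoef_mono n'0 /= mulr0.
rewrite tmono0.
by rewrite addr0 -addrA -tmonoD ![tcoef _ 0 * _]mulrC.
Qed.

(** In the Leibniz expansion of D(t t w) every term contains the constant coefficient of t or of
    t^2, which is 0. So D factors through the quotient by t^2, the structure sheaf of a double
    scheme. *)
Lemma dpart_tail V (h : osub V U) x : eqmod_t 2 x 0 -> dpart h x = 0.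
Proof.
move=> /eqmod_t0_factor[w [-> _]]; have -> : tmono n 2 (1 : O V) = tmono n 1 1 * tmono n 1 1.
  by rewrite tmonoM mul1r.
by rewrite !dpartM tcoefM0 !tcoef_mono /= !mul0r !addr0 mulr0 ?addr0.
Qed.

Lemma dpartB V (h : osub V U) x y : dpart h (x - y) = dpart h x - dpart h y.
Proof. by apply: (addIr (dpart h y)); rewrite -dpartD !subrK. Qed.

Lemma dpart_kpart V (h : osub V U) x : dpart h x = kpart h (tcast 2 x).
Proof.
apply/eqP; rewrite -subr_eq0 -dpartB; apply/eqP/dpart_tail => i i2.
by rewrite tcoefB tcoef_cast ?(leq_trans i2 n1) // tcoef_cast // subrr tcoef0.
Qed.

Lemma kpartE V (h : osub V U) x :
  ifun g h x = x + tmono n n.-1 (kpart h (tcast 2 x)).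
Proof. by rewrite kerE dpart_kpart. Qed.

Lemma kpart_eq V (h : osub V U) x d :
  ifun g h x = x + tmono n n.-1 d -> kpart h (tcast 2 x) = d.
Proof. by rewrite -dpart_kpart; exact: dpartE. Qed.

Lemma kpartD V (h : osub V U) x y : kpart h (x + y) = kpart h x + kpart h y.
Proof.
by rewrite -[RHS]dpartD /kpart tcast_add.
Qed.

Lemma kpartM V (h : osub V U) x y :
  kpart h (x * y) = tcoef x 0 * kpart h y + tcoef y 0 * kpart h x.
Proof.
have e : tcast 2 (tcast n x * tcast n y) = x * y.
  by rewrite tcast_mul // !tcast_pad.
by rewrite -e -dpart_kpart dpartM /kpart !tcoef_cast.
Qed.

Lemma kpart_cst V (h : osub V U) c : kpart h (acst (tsheaf O 2) V c) = 0.
Proof.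
have -> : acst (tsheaf O 2) V c = tcast 2 (acst (tsheaf O n) V c).
  by rewrite /= !tconst_mono tcast_mono.
by rewrite -dpart_kpart /dpart (ifun_cst g) subrr.
Qed.

Lemma kpart_nat V W (hV : osub V U) (hW : osub W U) (h : osub W V) x :
  ares O h (kpart hV x) = kpart hW (tmap (ares O h) x).
Proof.
by rewrite /kpart /dpart rmorphB -!tcoef_map (taut_tmap g hV hW) -tcast_map.
Qed.

End Part.

(** These are the derivations over the base ring from O[t]/(t^2) to O, a module through the constant
    coefficient, on the open subsets of [U]. *)
Definition kpart_axioms U (D : forall V, osub V U -> tpoly 2 (O V) -> O V) : Prop :=
  [/\ forall V h x y, D V h (x + y) = D V h x + D V h y,
      forall V h x y, D V h (x * y) = tcoef x 0 * D V h y + tcoef y 0 * D V h x,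
      forall V h c, D V h (acst (tsheaf O 2) V c) = 0
    & forall V W hV hW (h : osub W V) x,
        ares O h (D V hV x) = D W hW (tmap (ares O h) x)].

Lemma ker_ext U (g g' : taut O n U) :
  tred (leq_pred n) g = 1%g -> tred (leq_pred n) g' = 1%g ->
  (forall V (h : osub V U) x, kpart g h x = kpart g' h x) -> g = g'.
Proof. by move=> gk gk' e; apply: taut_ext => V h x; rewrite !kpartE // e. Qed.

(** Composition evaluates D at x + t^(n-1) D'x, which equals x modulo t^2 as n-1 >= 2; hence it adds
    the derivations. *)
Lemma kpart_mul U (g g' : taut O n U) V (h : osub V U) x :
  tred (leq_pred n) g = 1%g -> tred (leq_pred n) g' = 1%g ->
  kpart (g * g')%g h x = kpart g h x + kpart g' h x.
Proof.
move=> gk gk'; rewrite -{1}(tcast_pad x n1); apply: kpart_eq.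
  by rewrite tred_mul gk gk' mulg1.
rewrite tautM (kpartE gk) (kpartE gk') -addrA -tmonoD; congr (_ + tmono _ _ _).
rewrite addrC tcast_add tcast_mono // tmono_ge // addr0.
by rewrite tcast_pad.
Qed.

Lemma kpart_res U U' (u : osub U' U) (g : taut O n U) V (h : osub V U') (h' : osub V U) x :
  kpart (taut_res u g) h x = kpart g h' x.
Proof. by rewrite /kpart /dpart /= (ifun_irr g _ h'). Qed.

(** The map id + t^(n-1) D is multiplicative by the Leibniz rule, and its inverse is id - t^(n-1) D
    because D kills t^(n-1). *)
Lemma kpart_surj U (D : forall V, osub V U -> tpoly 2 (O V) -> O V) :
  kpart_axioms D -> exists2 g : taut O n U, tred (leq_pred n) g = 1%g &
    forall V (h : osub V U) x, kpart g h x = D V h x.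
Proof.
move=> [DD DM Dc Dn].
pose E V h (x : tpoly n (O V)) := D V h (tcast 2 x).
have ED V h x y : E V h (x + y) = E V h x + E V h y.
  by rewrite /E tcast_add DD.
have EM V h x y : E V h (x * y) = tcoef x 0 * E V h y + tcoef y 0 * E V h x.
  by rewrite /E tcast_mul // DM !tcoef_cast.
have E0 V h : E V h 0 = 0 by apply: (addIr (E V h 0)); rewrite -ED !add0r.
have EN V h x : E V h (- x) = - E V h x.
  by apply: (addIr (E V h x)); rewrite -ED !addNr E0.
have Ee V h c : E V h (tmono n n.-1 c) = 0.
  rewrite /E tcast_mono // tmono_ge //.
  by apply: (addIr (D V h 0)); rewrite -DD !add0r.
have E1 V h : E V h 1 = 0.
  by move: (EM V h 1 1); rewrite mulr1 tcoef1 n0 /= mul1r -[LHS]addr0 => /addrI.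
(* The boolean is the sign: [false] gives the automorphism, [true] its inverse, and both are shown
   to be morphisms at once. *)
pose F (e : bool) V h x := x + tmono n n.-1 ((-1) ^+ e * E V h x).
have FZ e V h : zmod_morphism (F e V h).
  by move=> x y; rewrite /F ED EN mulrDr mulrN tmonoD tmonoN opprD addrACA.
have FM e V h : monoid_morphism (F e V h).
  split=> [|x y]; rewrite /F; first by rewrite E1 mulr0; rewrite tmono0 addr0.
  rewrite EM mulrDl !mulrDr [x * tmono _ _ _]mulrC !tmono_lastM // tcoef_mono n'0 /=.
  rewrite mulr0 tmono0 addr0 -addrA -tmonoD; congr (_ + tmono _ _ _).
  by rewrite ![tcoef _ 0 * _]mulrC !mulrA.
have FK e V h x : F (~~ e) V h (F e V h x) = x.
  rewrite /F ED Ee addr0 -addrA -tmonoD -mulrDl.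
  by case: e; rewrite /= ?expr1 ?expr0 ?addNr ?addrN mul0r tmono0 addr0.
have Fc V h c : F false V h (acst (tsheaf O n) V c) = acst (tsheaf O n) V c.
  rewrite /F; have -> : E V h (acst (tsheaf O n) V c) = 0.
    by rewrite -(Dc V h c) /E /= !tconst_mono tcast_mono.
  by rewrite mulr0 tmono0 addr0.
have Fn V W (hV : osub V U) (hW : osub W U) (h : osub W V) x :
    tmap (ares O h) (F false V hV x) = F false W hW (tmap (ares O h) x).
  by rewrite /F rmorphD /= tmap_mono expr0 !mul1r /E (Dn _ _ _ hW) tcast_map.
pose f e V h : {rmorphism tpoly n (O V) -> tpoly n (O V)} := HB.pack (F e V h)
  (GRing.isZmodMorphism.Build _ _ _ (FZ e V h)) (GRing.isMonoidMorphism.Build _ _ _ (FM e V h)).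
pose i : algIso (tsheaf O n) (tsheaf O n) U := @AlgIso _ _ (tsheaf O n) (tsheaf O n) U
  (f false) (f true) (FK false) (FK true) Fc Fn.
have i0 V (h : osub V U) a : tcoef (ifun i h a) 0 = tcoef a 0.
  by rewrite /= /F tcoefD tcoef_mono n'0 addr0.
have gE V (h : osub V U) x : ifun (TAut i0) h x = x + tmono n n.-1 (D V h (tcast 2 x)).
  by rewrite /= /F expr0 mul1r.
have gk : tred (leq_pred n) (TAut i0) = 1%g.
  apply: tred_eqP => V h x; rewrite gE tcast_add.
  by rewrite tcast_mono ?(ltnW n'n) // tmono_ge // addr0.
exists (TAut i0) => // V h x; rewrite -{1}(tcast_pad x n1); apply: kpart_eq => //.
by rewrite gE tcast_pad.
Qed.

Lemma ker_conj U (g : taut O n U) (d : taut O n U) : tred (leq_pred n) g = 1%g ->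
  tred (leq_pred n) (d * g * d^-1)%g = 1%g.
Proof.
by move=> gk; rewrite !tred_mul gk mulg1 -tred_mul mulgV tred_1.
Qed.

(** At d(x) the conjugate takes the value d(g(x)) = d(x) + d(t^(n-1) Dx), and d multiplies the
    coefficient of t^(n-1) by u^(n-1) on such top terms. *)
Lemma kpart_conj U (g d : taut O n U) V (h : osub V U) x : tred (leq_pred n) g = 1%g ->
  kpart (d * g * d^-1)%g h (ifun (tred n1 d) h x) =
    tcoef (ifun d h (tmono n 1 1)) 1 ^+ n.-1 * kpart g h x.
Proof.
move=> gk; rewrite tredE; apply: kpart_eq; first exact: ker_conj.
by rewrite !tautM tautV ifunK (kpartE gk) rmorphD /= taut_mono_last // tcast_pad.
Qed.

End KernelElements.

(** * Extending a morphism from the sections over an affine open set *)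

Section SheafLemmas.
Variables (X : topologicalType) (F : opens X -> Type).
Variable r : forall U V, osub V U -> F U -> F V.
Hypothesis rF : is_sheaf r.

Lemma sheaf_local_eq U (s t : F U) :
  (forall x, oset U x -> exists V (h : osub V U), oset V x /\ r h s = r h t) -> s = t.
Proof.
move=> st; have [_ _ rs _] := rF.
pose I := {V : opens X | exists h : osub V U, r h s = r h t}.
have IU (i : I) : osub (sval i) U by case: (svalP i).
apply: (rs U I (fun i => sval i) IU) => [x /st[V [h [Vx e]]]|i].
  by exists (exist _ V (ex_intro _ h e)).
by case: (svalP i) => h e; rewrite (Prop_irrelevance (IU i) h).
Qed.

(** Local sections are often given only by a relation that determines them. Stability under
    restriction and uniqueness then force agreement on overlaps, so no separate compatibility check
    is needed. *)
Lemma sheaf_glue_unique U (P : forall V, osub V U -> F V -> Prop) :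
  (forall x, oset U x -> exists V (h : osub V U), oset V x /\ exists s, P V h s) ->
  (forall V V' h h' (u : osub V' V) s, P V h s -> P V' h' (r u s)) ->
  (forall V h s t, P V h s -> P V h t -> s = t) ->
  exists t : F U, forall V h s, P V h s -> r h t = s.
Proof.
move=> Pex Pres Puniq; have [r1 r2 rs rg] := rF.
pose I := {V : opens X | exists h : osub V U, exists s, P V h s}.
have IU (i : I) : osub (sval i) U by case: (svalP i).
have cI : covers (fun i : I => sval i) U.
  by move=> x /Pex[V [h [Vx e]]]; exists (exist _ V (ex_intro _ h e)).
have sec (i : I) : exists s, P (sval i) (IU i) s.
  by case: (svalP i) => h [s Ps]; exists s; rewrite (Prop_irrelevance (IU i) h).
pose s i := sval (cid (sec i)).
have sP i : P _ (IU i) (s i) by rewrite /s; case: cid.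
have [|t tE] := rg U I (fun i => sval i) IU cI s.
  move=> i j V hi hj; apply: (Puniq V (osub_trans (IU i) hi)); apply: Pres (sP _).
exists t => V h y Py; apply: sheaf_local_eq => x Vx.
have [i ix] := cI x (h x Vx); exists (ocap V (sval i)), (@ocapl _ _ _); split=> //.
have u := osub_trans h (@ocapl _ V (sval i)).
rewrite (r2 _ _ _ _ _ u) -(r2 _ _ _ (IU i) (@ocapr _ _ _)) tE.
by apply: (Puniq _ u); [exact: Pres (sP i)|exact: Pres Py].
Qed.

End SheafLemmas.

Section AlgebraSheaves.
Variables (k : comPzRingType) (X : topologicalType) (A : algSheaf k X).

Lemma ares_id U (h : osub U U) (s : A U) : ares A h s = s.
Proof. by have [r1 _ _ _] := ares_sheaf A; rewrite r1. Qed.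

Lemma ares_comp U V W (hV : osub V U) (hW : osub W V) (hWU : osub W U) (s : A U) :
  ares A hW (ares A hV s) = ares A hWU s.
Proof. by have [_ r2 _ _] := ares_sheaf A; rewrite (r2 _ _ _ _ _ hWU). Qed.

Lemma ares_irr U V (h h' : osub V U) (s : A U) : ares A h s = ares A h' s.
Proof. by rewrite (Prop_irrelevance h h'). Qed.

End AlgebraSheaves.

Definition runit (A : comPzRingType) (a : A) := exists b, a * b = 1.

Lemma runitM (A : comPzRingType) (a b : A) : runit a -> runit b -> runit (a * b).
Proof. by move=> [a' aa] [b' bb]; exists (a' * b'); rewrite mulrACA aa bb mulr1. Qed.

Lemma runit_morph (A B : comPzRingType) (f : {rmorphism A -> B}) a : runit a -> runit (f a).
Proof. by move=> [b ab]; exists (f b); rewrite -rmorphM ab rmorph1. Qed.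

Lemma runit_inj (A : comPzRingType) (a b c : A) : runit a -> a * b = a * c -> b = c.
Proof.
move=> [a' aa] e; rewrite -[b]mul1r -[c]mul1r -aa ![_ * a']mulrC.
by rewrite -!mulrA e.
Qed.

Lemma tpoly_nilpotent (m : nat) (A : comPzRingType) (x : tpoly m A) :
  tcoef x 0 = 0 -> x ^+ m = 0.
Proof.
move=> x0; have [|w [-> _]] := @eqmod_t0_factor m A 1 x.
  by case=> // _; rewrite x0 tcoef0.
rewrite exprMn; have [m0|m0] := posnP m; last first.
  by rewrite tmonoX // tmono_ge // mul0r.
by apply: tcoefP => i im; move: (im); rewrite [X in (_ < X)%N]m0.
Qed.

(** If b inverts the constant coefficient, then x b = 1 - z with z nilpotent, and a geometric series
    inverts 1 - z. *)
Lemma tpoly_runit (m : nat) (A : comPzRingType) (x : tpoly m A) :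
  runit (tcoef x 0) -> runit x.
Proof.
have [m0|m0] := posnP m.
  by move=> _; exists 1; apply: tcoefP => i im; move: (im); rewrite [X in (_ < X)%N]m0.
move=> [b ab]; pose z := 1 - x * tconst m b.
have zm : z ^+ m = 0.
  by apply: tpoly_nilpotent; rewrite tcoefB tcoefM0 tcoef1 m0 /= tcoef_mono m0 /= ab subrr.
exists (tconst m b * \sum_(i < m) z ^+ i); rewrite mulrA.
have -> : x * tconst m b = 1 - z by rewrite /z opprB addrC subrK.
by apply: oppr_inj; rewrite -mulNr opprB -subrX1 zm sub0r.
Qed.

Lemma algIso_of_bij (k : comPzRingType) (X : topologicalType) (A B : algSheaf k X)
    (U : opens X) (F : forall V, osub V U -> {rmorphism A V -> B V}) :
  (forall V h a, F V h a = 0 -> a = 0) -> (forall V h b, exists a, F V h a = b) ->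
  (forall V h c, F V h (acst A V c) = acst B V c) ->
  (forall V W hV hW (h : osub W V) a, ares B h (F V hV a) = F W hW (ares A h a)) ->
  exists f : algIso A B U, forall V h a, ifun f h a = F V h a.
Proof.
move=> Finj Fsurj Fc Fn.
pose G V h (b : B V) : A V := sval (cid (Fsurj V h b)).
have GK V h b : F V h (G V h b) = b by rewrite /G; case: cid.
have FK V h a : G V h (F V h a) = a.
  by apply/eqP; rewrite -subr_eq0; apply/eqP/(Finj V h); rewrite rmorphB /= GK subrr.
have GZ V h : zmod_morphism (G V h).
  by move=> a b; rewrite -[RHS](FK V h) rmorphB /= !GK.
have GM V h : monoid_morphism (G V h).
  by split=> [|a b]; [rewrite -[RHS](FK V h) rmorph1|rewrite -[RHS](FK V h) rmorphM /= !GK].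
pose g V h : {rmorphism B V -> A V} := HB.pack (G V h)
  (GRing.isZmodMorphism.Build _ _ _ (GZ V h)) (GRing.isMonoidMorphism.Build _ _ _ (GM V h)).
by exists (@AlgIso _ _ A B U F g FK GK Fc Fn).
Qed.

Section AffineExtension.
Variables (k : comPzRingType) (X : topologicalType) (A : algSheaf k X) (U : opens X).
Hypothesis aU : affine_open A U.

(** Every section over a subset of the affine [U] is locally a fraction a/f of sections over [U], by
    the localization property on a basic open set. *)
Lemma affine_fraction V (h : osub V U) (s : A V) x : oset V x ->
  exists V' (h' : osub V' V) (hU : osub V' U), oset V' x /\ exists f a,
    runit (ares A hU f) /\ ares A hU f * ares A h' s = ares A hU a.
Proof.
move=> Vx; have [_ _ basis loc] := aU; have [f fx fV] := basis V h x Vx.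
exists (basic_open f), fV, (@basic_open_sub _ _ _ _ f); split=> //.
have [[g fg] frac _] := loc f; have [j [a ea]] := frac (ares A fV s).
exists (f ^+ j), a; rewrite rmorphXn /=; split=> //.
by exists (g ^+ j); rewrite -exprMn fg expr1n.
Qed.

Lemma affine_annihilator V (h : osub V U) (b : A U) x : oset V x -> ares A h b = 0 ->
  exists V' (h' : osub V' V) (hU : osub V' U), oset V' x /\ exists f,
    runit (ares A hU f) /\ f * b = 0.
Proof.
move=> Vx b0; have [_ _ basis loc] := aU; have [f fx fV] := basis V h x Vx.
exists (basic_open f), fV, (@basic_open_sub _ _ _ _ f); split=> //.
have [[g fg] _ ann] := loc f; have [|j ej] := ann b.
  by rewrite -(ares_comp h fV) b0 rmorph0.
exists (f ^+ j); split=> //; rewrite rmorphXn /=.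
by exists (g ^+ j); rewrite -exprMn fg expr1n.
Qed.

(** Locally f s = a with f a unit and a, f coming from [U], so the values on O(U) determine the
    value on s. *)
Lemma affine_unique (B : algSheaf k X) W (F G : forall V, osub V W -> {rmorphism A V -> B V}) :
  osub W U ->
  (forall V V' hV hW (h : osub V' V) a, ares B h (F V hV a) = F V' hW (ares A h a)) ->
  (forall V V' hV hW (h : osub V' V) a, ares B h (G V hV a) = G V' hW (ares A h a)) ->
  (forall V h (hU : osub V U) a, F V h (ares A hU a) = G V h (ares A hU a)) ->
  forall V h s, F V h s = G V h s.
Proof.
move=> WU Fn Gn FG V h s; apply: (sheaf_local_eq (ares_sheaf B)) => x Vx.
have [V' [h' [hU [V'x [f [a [fu fs]]]]]]] := affine_fraction (osub_trans WU h) s Vx.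
exists V', h'; split=> //; have hW := osub_trans h h'; rewrite (Fn _ _ _ hW) (Gn _ _ _ hW).
apply: (@runit_inj _ (F V' hW (ares A hU f))); first exact: runit_morph.
by rewrite -rmorphM fs !FG -rmorphM fs.
Qed.

Variables (B : algSheaf k X) (W : opens X) (WU : osub W U) (v : {rmorphism A U -> B W}).
Hypothesis v_unit : forall f V (hU : osub V U) (h : osub V W),
  runit (ares A hU f) -> runit (ares B h (v f)).

(** The relation y = v(a)/v(f) for some expression of s as a fraction a/f of sections over [U]. *)
Let Q V (h : osub V W) (s : A V) (y : B V) := exists f a,
  [/\ runit (ares A (osub_trans WU h) f),
      ares A (osub_trans WU h) f * s = ares A (osub_trans WU h) a
    & ares B h (v f) * y = ares B h (v a)].

(** A section b vanishing on V is locally killed by some f invertible there; v(f) is then a unit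
    that kills v(b). This makes v(a)/v(f) independent of the fraction. *)
Let v_ker V (h : osub V W) b : ares A (osub_trans WU h) b = 0 -> ares B h (v b) = 0.
Proof.
move=> b0; apply: (sheaf_local_eq (ares_sheaf B)) => x Vx.
have [V' [h' [hU [V'x [f [fu fb]]]]]] := affine_annihilator Vx b0.
exists V', h'; split=> //; rewrite (ares_comp _ _ (osub_trans h h')) rmorph0.
apply: (runit_inj (v_unit (osub_trans h h') fu)).
by rewrite -!rmorphM fb !rmorph0 mulr0.
Qed.

Let Q_res V V' h h' (u : osub V' V) s y : @Q V h s y -> @Q V' h' (ares A u s) (ares B u y).
Proof.
move=> [f [a [fu fs fy]]]; exists f, a.
rewrite -!(ares_comp (osub_trans WU h) u) -!(ares_comp h u) -!rmorphM fs fy; split=> //.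
exact: runit_morph.
Qed.

Let Q_uniq V h s y y' : @Q V h s y -> @Q V h s y' -> y = y'.
Proof.
move=> [f [a [fu fs fy]]] [f' [a' [fu' fs' fy']]].
apply: (runit_inj (runitM (v_unit h fu) (v_unit h fu'))).
rewrite mulrAC fy -mulrA fy'; apply/eqP; rewrite -subr_eq0 -!rmorphM -!rmorphB; apply/eqP.
by apply: v_ker; rewrite rmorphB !rmorphM -fs -fs' mulrA mulrAC subrr.
Qed.

Let Q_loc V h s x : oset V x -> exists V' (u : osub V' V), oset V' x /\
  exists y, Q (osub_trans h u) (ares A u s) y.
Proof.
move=> Vx; have [V' [u [hU [V'x [f [a [fu fs]]]]]]] := affine_fraction (osub_trans WU h) s Vx.
exists V', u; split=> //; have [g fg] := v_unit (osub_trans h u) fu.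
exists (ares B (osub_trans h u) (v a) * g), f, a; split.
- by rewrite (ares_irr _ hU).
- by rewrite !(ares_irr _ hU).
- by rewrite mulrCA fg mulr1.
Qed.

Let Q_add V h s s' y y' : @Q V h s y -> @Q V h s' y' -> @Q V h (s - s') (y - y').
Proof.
move=> [f [a [fu fs fy]]] [f' [a' [fu' fs' fy']]].
exists (f * f'), (f' * a - f * a').
split; first by rewrite rmorphM; exact: runitM.
  by rewrite rmorphB !rmorphM -fs -fs' mulrBr !mulrA -!(mulrC (ares A _ f')).
by rewrite !rmorphB !rmorphM -fy -fy' mulrBr !mulrA -!(mulrC (ares B _ (v f'))).
Qed.

Let Q_mul V h s s' y y' : @Q V h s y -> @Q V h s' y' -> @Q V h (s * s') (y * y').
Proof.
move=> [f [a [fu fs fy]]] [f' [a' [fu' fs' fy']]].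
exists (f * f'), (a * a').
split; first by rewrite rmorphM; exact: runitM.
  by rewrite !rmorphM -fs -fs' mulrACA.
by rewrite !rmorphM -fy -fy' mulrACA.
Qed.

Let Q_img V h (hU : osub V U) a : @Q V h (ares A hU a) (ares B h (v a)).
Proof.
exists 1, a; rewrite !rmorph1 !mul1r; split=> //; last exact: ares_irr.
by exists 1; rewrite mulr1.
Qed.

(** The extension sends a/f to v(a)/v(f). Fractions exist only locally, so the values are glued, and
    ring identities are checked where fractions are available. *)
Lemma affine_extension : exists F : forall V, osub V W -> {rmorphism A V -> B V},
  (forall V h (hU : osub V U) a, F V h (ares A hU a) = ares B h (v a)) /\
  (forall V V' hV hW (h : osub V' V) a, ares B h (F V hV a) = F V' hW (ares A h a)).
Proof.
have ex V (h : osub V W) s : exists t : B V, forall V' (u : osub V' V) y,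
    Q (osub_trans h u) (ares A u s) y -> ares B u t = y.
  apply: (sheaf_glue_unique (ares_sheaf B)
    (P := fun V' u y => Q (osub_trans h u) (ares A u s) y)) => [x|V1 V2 h1 h2 u y|V1 h1 y y'].
  - exact: Q_loc.
  - by move=> /(Q_res (osub_trans h h2) u); rewrite (ares_comp _ _ h2).
  - exact: Q_uniq.
pose F V h s := sval (cid (ex V h s)).
have FE V h s V' (u : osub V' V) hW y : @Q V' hW (ares A u s) y -> ares B u (F V h s) = y.
  rewrite /F; case: cid => t /= tE; rewrite (Prop_irrelevance hW (osub_trans h u)).
  exact: tE.
have Fimg V h (hU : osub V U) a : F V h (ares A hU a) = ares B h (v a).
  rewrite -[LHS](ares_id (@osub_refl _ V)); apply: (FE _ _ _ _ _ h).
  by rewrite ares_id; exact: Q_img.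
have loc2 V (h : osub V W) s s' x : oset V x -> exists V' (u : osub V' V), oset V' x /\
    exists (hW : osub V' W) y y', @Q V' hW (ares A u s) y /\ @Q V' hW (ares A u s') y'.
  move=> Vx; have [V1 [u1 [V1x [y1 Q1]]]] := Q_loc h s Vx.
  have [V2 [u2 [V2x [y2 Q2]]]] := Q_loc h s' Vx.
  have l := @ocapl _ V1 V2; have r := @ocapr _ V1 V2; have u := osub_trans u1 l.
  exists (ocap V1 V2), u; split=> //.
  exists (osub_trans h u), (ares B l y1), (ares B r y2).
  rewrite -(ares_comp u1 l) -(ares_comp u2 r u).
  by split; [exact: Q_res Q1|exact: Q_res Q2].
have FZ V (h : osub V W) : zmod_morphism (F V h).
  move=> s s'; apply: (sheaf_local_eq (ares_sheaf B)) => x Vx.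
  have [V' [u [V'x [hW [y [y' [Qs Qs']]]]]]] := loc2 V h s s' x Vx.
  exists V', u; split=> //; rewrite rmorphB /= (FE _ _ _ _ _ _ _ Qs) (FE _ _ _ _ _ _ _ Qs').
  by apply: (FE _ _ _ _ _ hW); rewrite rmorphB; exact: Q_add.
have FM V (h : osub V W) : monoid_morphism (F V h).
  split=> [|s s'].
    by rewrite -(rmorph1 (ares A (osub_trans WU h))) Fimg !rmorph1.
  apply: (sheaf_local_eq (ares_sheaf B)) => x Vx.
  have [V' [u [V'x [hW [y [y' [Qs Qs']]]]]]] := loc2 V h s s' x Vx.
  exists V', u; split=> //; rewrite rmorphM /= (FE _ _ _ _ _ _ _ Qs) (FE _ _ _ _ _ _ _ Qs').
  by apply: (FE _ _ _ _ _ hW); rewrite rmorphM; exact: Q_mul.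
pose F' V h : {rmorphism A V -> B V} := HB.pack (F V h)
  (GRing.isZmodMorphism.Build _ _ _ (FZ V h)) (GRing.isMonoidMorphism.Build _ _ _ (FM V h)).
exists F'.
split=> [V h hU a|V V' hV hW h a] /=; first exact: Fimg.
apply: (sheaf_local_eq (ares_sheaf B)) => x Vx.
have [V1 [u [V1x [y Qy]]]] := Q_loc hW (ares A h a) Vx.
exists V1, u; split=> //; rewrite (FE _ _ _ _ _ _ _ Qy) (ares_comp _ _ (osub_trans h u)).
by apply: (FE _ _ _ _ _ (osub_trans hW u)); rewrite -(ares_comp h u).
Qed.

End AffineExtension.

(** * Local lifts of automorphisms *)

Section LocalLift.
Variables (k : comPzRingType) (X : topologicalType) (O : algSheaf k X).
Hypothesis smO : smooth_scheme O.
Variables (n : nat) (n2 : (2 < n)%N).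
Let n0 : (0 < n)%N := ltnW (ltnW n2).
Let n1 : (1 < n)%N := ltnW n2.
Let n'1 : (1 < n.-1)%N. Proof. by rewrite -ltnS prednK. Qed.
Let n'0 : (0 < n.-1)%N. Proof. exact: ltnW. Qed.
Local Notation n'n := (leq_pred n).
#[local] Hint Resolve leq_pred : core.
Let n'00 : (0%N == n.-1) = false. Proof. by case: (n) n2 => [|[]]. Qed.
Let n'lt : (n.-1 < n)%N. Proof. by rewrite prednK. Qed.

Lemma tcast_pred_eq0 (A : comPzRingType) (x : tpoly n A) : tcast n.-1 x = 0 ->
  x = tmono n n.-1 (tcoef x n.-1).
Proof.
move=> x0; have e : eqmod_t n.-1 0 x.
  by apply/tcast_eqmod; rewrite x0 tcast_0.
by rewrite {1}(tmono_last_eq e) tcoef0 subr0 add0r.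
Qed.

(** A lift on constants together with any lift z of d(t) gives the endomorphism sum x_i t^i |-> sum
    F(x_i) z^i. It induces d modulo t^(n-1) and multiplies multiples of t^(n-1) by a unit, hence is
    bijective. *)
Lemma taut_lift_ring U (d : taut O n.-1 U)
    (F : forall V, osub V U -> {rmorphism O V -> tpoly n (O V)}) :
  (forall V V' hV hW (h : osub V' V) a, tmap (ares O h) (F V hV a) = F V' hW (ares O h a)) ->
  (forall V h c, F V h (acst O V c) = tconst n (acst O V c)) ->
  (forall V h s, tcast n.-1 (F V h s) = ifun d h (tconst n.-1 s)) ->
  exists e : taut O n U, tred n'n e = d.
Proof.
(* Padding d(t) by zero is one choice of lift. It is made over [U] and then restricted, which gives
   compatibility with restrictions. *)
move=> Fn Fc Fd; pose z : tpoly n (O U) := tcast n (ifun d (@osub_refl _ U) (tmono n.-1 1 1)).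
pose zr V (h : osub V U) := tmap (ares O h) z.
have z0 V h : tcoef (zr V h) 0 = 0.
  by rewrite tcoef_map tcoef_cast // tvalP tcoef_mono rmorph0.
have zd V h : tcast n.-1 (zr V h) = ifun d h (tmono n.-1 1 1).
  by rewrite tcast_map tcast_pad // (taut_tmap d _ h) tmap_mono rmorph1.
pose e V h : tpoly n (O V) -> tpoly n (O V) := teval (F V h) (zr V h).
have eZ V h : zmod_morphism (e V h) by exact: teval_zmod.
have eM V h : monoid_morphism (e V h).
  by apply: teval_monoid => //; apply: tpoly_nilpotent.
pose f V h : {rmorphism tpoly n (O V) -> tpoly n (O V)} := HB.pack (e V h)
  (GRing.isZmodMorphism.Build _ _ _ (eZ V h)) (GRing.isMonoidMorphism.Build _ _ _ (eM V h)).
have fd V h x : tcast n.-1 (f V h x) = ifun d h (tcast n.-1 x).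
  rewrite [in RHS](tpoly_sum x n0) /= /e /teval.
  rewrite -[LHS]/(ttrunc n'n _) -[X in ifun d h X]/(ttrunc n'n _) !rmorph_sum.
  apply: eq_bigr => i _; rewrite !rmorphM !rmorphXn /= /ttrunc Fd zd.
  by rewrite !tconst_mono !tcast_mono.
have f0 V h x : tcoef (f V h x) 0 = tcoef x 0.
  by rewrite -(tcoef_cast _ n'0) fd tvalP tcoef_cast.
have f1 V h : tcoef (f V h (tmono n 1 1)) 1 = tcoef (ifun d h (tmono n.-1 1 1)) 1.
  by rewrite -(tcoef_cast _ n'1) fd tcast_mono.
have flast V h c : f V h (tmono n n.-1 c) =
    tmono n n.-1 (tcoef (ifun d h (tmono n.-1 1 1)) 1 ^+ n.-1 * c).
  have [|w [ew wE]] := @eqmod_t0_factor n (O V) 1 (f V h (tmono n 1 1)).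
    by case=> // _; rewrite f0 tcoef_mono tcoef0.
  rewrite -f1 -(wE 0%N) //.
  have -> : tmono n n.-1 c = tmono n n.-1 1 * tconst n c by rewrite tmonoM addn0 mul1r.
  have tX : tmono n 1 (1 : O V) ^+ n.-1 = tmono n n.-1 1 by rewrite tmonoX // expr1n.
  rewrite -[in LHS]tX rmorphM rmorphXn ew exprMn tX -mulrA tmono_lastM //.
  by rewrite mul1r tcoefM0 tcoefX0 // f0 tcoef_mono n0.
have u_unit V h : runit (tcoef (ifun d h (tmono n.-1 1 (1 : O V))) 1 ^+ n.-1).
  have [v uv] := taut_unit d h n'1.
  by exists (v ^+ n.-1); rewrite mulrC -exprMn uv expr1n.
have dinj V h (y : tpoly n.-1 (O V)) : ifun d h y = 0 -> y = 0.
  by move=> dy; rewrite -(ifunK d h y) dy rmorph0.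
have finj V h x : f V h x = 0 -> x = 0.
  move=> fx; have x0 : tcast n.-1 x = 0.
    by apply: (dinj V h); rewrite -fd fx tcast_0.
  move: fx; rewrite (tcast_pred_eq0 x0) flast => /(congr1 (fun y => tcoef y n.-1)).
  rewrite tcoef_mono eqxx n'lt tcoef0 -[RHS](mulr0 (tcoef (ifun d h (tmono n.-1 1 1)) 1 ^+ n.-1)).
  by move/(runit_inj (u_unit V h)) => ->; rewrite tmono0.
(* Pull the truncation of y back by d; the remaining error is a multiple of t^(n-1) and is corrected
   by the inverse of u^(n-1). *)
have fsurj V h y : exists x, f V h x = y.
  pose x := tcast n (iinv d h (tcast n.-1 y)).
  have e0 : tcast n.-1 (y - f V h x) = 0.
    by rewrite tcast_sub fd tcast_pad // iinvK subrr.
  have [v uv] := u_unit V h.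
  exists (x + tmono n n.-1 (v * tcoef (y - f V h x) n.-1)).
  by rewrite rmorphD flast mulrA uv mul1r -(tcast_pred_eq0 e0) addrC subrK.
have fc V h c : f V h (acst (tsheaf O n) V c) = acst (tsheaf O n) V c.
  by rewrite [LHS](teval_const _ _ n0) Fc.
have fn V W hV hW (h : osub W V) x :
    tmap (ares O h) (f V hV x) = f W hW (tmap (ares O h) x).
  rewrite /= /e /teval rmorph_sum; apply: eq_bigr => i _.
  rewrite rmorphM rmorphXn /= (Fn _ _ _ hW) ffunE; congr (_ * _ ^+ _).
  by apply/ffunP => l; rewrite !ffunE ares_comp.
have [g gE] := algIso_of_bij (A := tsheaf O n) (B := tsheaf O n) finj fsurj fc fn.
have g0 V h (a : tpoly n (O V)) : tcoef (ifun g h a) 0 = tcoef a 0 by rewrite gE f0.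
exists (TAut g0); apply: tred_eqP => V h x.
by rewrite [ifun _ _ _]gE fd.
Qed.

(** The kernel of O[t]/(t^n) -> O[t]/(t^(n-1)) has square zero, so formal smoothness of an affine
    neighbourhood U of x lifts d on the constants coming from U. The lift is extended to a sheaf
    morphism over W = V cap U. *)
Lemma taut_local_lift V (d : taut O n.-1 V) x : oset V x ->
  exists W (h : osub W V), oset W x /\ exists e : taut O n W, tred n'n e = taut_res h d.
Proof.
move=> Vx; have [U [Ux aU _ smU]] := smO x.
pose W := ocap V U; have WV : osub W V := @ocapl _ V U; have WU : osub W U := @ocapr _ V U.
exists W, WV; split=> //; pose q : {rmorphism tpoly n (O W) -> tpoly n.-1 (O W)} := ttrunc n'n.
pose u : {rmorphism O U -> tpoly n.-1 (O W)} := ifun d WV \o (@tconst n.-1 (O W) \o ares O WU).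
have [||c|v vc vq] := smU _ _ (acst (tsheaf O n) W) q u.
- by move=> y; exists (tcast n y); rewrite /= /ttrunc tcast_pad.
- move=> y z /tcast_pred_eq0 -> /tcast_pred_eq0 ->.
  by rewrite tmono_lastM // tcoef_mono n'00 mulr0 tmono0.
- rewrite /= /ttrunc !tconst_mono tcast_mono // -!tconst_mono ares_cst.
  exact: (ifun_cst d WV c).
have vqE f : tcast n.-1 (v f) = u f := vq f.
have v0 f : tcoef (v f) 0 = ares O WU f.
  by rewrite -(tcoef_cast _ n'0) vqE /= tvalP tcoef_mono n'0.
(* The constant coefficient of v(f) is the restriction of f, so v(f) is invertible wherever f is. *)
have [|F [Fimg Fn]] := affine_extension aU (B := tsheaf O n) WU (v := v).
  move=> f V' hU h fu; apply: tpoly_runit.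
  by rewrite tcoef_map v0 (ares_comp _ _ hU).
(* Both sides are sheaf morphisms agreeing on sections that come from the affine [U], so
   [affine_unique] applies. *)
have Fd V' h s : tcast n.-1 (F V' h s) = ifun (taut_res WV d) h (tconst n.-1 s).
  pose G V1 (h1 : osub V1 W) : {rmorphism O V1 -> tpoly n.-1 (O V1)} := ttrunc n'n \o F V1 h1.
  pose H V1 (h1 : osub V1 W) : {rmorphism O V1 -> tpoly n.-1 (O V1)} :=
    ifun (taut_res WV d) h1 \o @tconst n.-1 (O V1).
  apply: (affine_unique aU (B := tsheaf O n.-1) (F := G) (G := H) WU).
  - move=> V1 V2 h1 h2 h12 a; rewrite /= /ttrunc -tcast_map; congr tcast.
    exact: Fn.
  - move=> V1 V2 h1 h2 h12 a.
    rewrite -[LHS]/(tmap _ (ifun (taut_res WV d) h1 _)) (taut_tmap _ _ h2); congr (ifun _ _ _).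
    exact: tmap_mono.
  - move=> V1 h1 hU a; rewrite /= /ttrunc Fimg -[ares _ _ _]/(tmap _ _) tcast_map.
    rewrite vqE /= (taut_tmap d _ (osub_trans WV h1)).
    by rewrite !tconst_mono tmap_mono (ares_comp _ _ hU).
apply: (taut_lift_ring _ _ Fd); first exact: Fn.
move=> V' h c; rewrite -(ares_cst O (osub_trans WU h) c) Fimg vc.
by rewrite -[LHS]/(tmap _ _) [LHS]tmap_mono !ares_cst.
Qed.

End LocalLift.

(** * The conjugation action in terms of derivations *)

Section Conjugation.
Variables (k : comPzRingType) (X : topologicalType) (O : algSheaf k X).
Hypothesis smO : smooth_scheme O.
Variables (n : nat) (n2 : (2 < n)%N) (n'1 : (1 < n.-1)%N).

Definition lead_coef_t (m : nat) (U : opens X) (d : taut O m U) V (h : osub V U) : O V :=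
  tcoef (ifun d h (tmono m 1 1)) 1.

Lemma lead_coef_t_tred (m j : nat) (jm : (j <= m)%N) (j1 : (1 < j)%N) (U : opens X)
    (e : taut O m U) V (h : osub V U) :
  lead_coef_t (tred jm e) h = lead_coef_t e h.
Proof. by rewrite /lead_coef_t -(tcast_mono 1 1 jm) -(tred_eqmod _ _ erefl) tcoef_cast. Qed.

Lemma lead_coef_t_res (m : nat) (U U' : opens X) (u : osub U' U) (e : taut O m U) V
    (h : osub V U') (h' : osub V U) :
  lead_coef_t (taut_res u e) h = lead_coef_t e h'.
Proof. by rewrite /lead_coef_t /= (ifun_irr e _ h'). Qed.

Lemma lead_coef_t_nat (m : nat) (U : opens X) (e : taut O m U) V W
    (hV : osub V U) (hW : osub W U) (h : osub W V) :
  ares O h (lead_coef_t e hV) = lead_coef_t e hW.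
Proof. by rewrite /lead_coef_t -tcoef_map (taut_tmap _ _ hW) tmap_mono rmorph1. Qed.

Lemma taut_res_1 (m : nat) (U U' : opens X) (u : osub U' U) :
  taut_res u (1%g : taut O m U) = 1%g.
Proof. exact: taut_ext. Qed.

(** For any lift, conjugation has the stated effect, which involves only [d]. The action quantifies
    over lifts and says nothing where there are none; local lifts are what allows the formula to be
    deduced from it. *)
Lemma conj_actionP V (d : taut O n.-1 V) (s t : taut O n V) :
  tred (leq_pred n) s = 1%g -> tred (leq_pred n) t = 1%g ->
  conj_action (leq_pred n) d s t <->
  forall V' (h : osub V' V) x, kpart t h (ifun (tred n'1 d) h x) =
    lead_coef_t d h ^+ n.-1 * kpart s h x.
Proof.
move=> sk tk.
have lift W (h : osub W V) (e : taut O n W) V' (h' : osub V' W) (hV : osub V' V) x :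
    tred (leq_pred n) e = taut_res h d ->
    kpart (e * taut_res h s * e^-1)%g h' (ifun (tred n'1 d) hV x) =
      lead_coef_t d hV ^+ n.-1 * kpart s hV x.
  move=> ed; have -> : ifun (tred n'1 d) hV x = ifun (tred (ltnW n2) e) h' x.
    rewrite -(tred_tred (leq_pred n) n'1) ed tred_res; exact: (ifun_irr (tred n'1 d)).
  rewrite kpart_conj; last by rewrite tred_res sk taut_res_1.
  rewrite -(lead_coef_t_res h d h' hV) -ed (lead_coef_t_tred (leq_pred n)) //.
  by rewrite (kpart_res _ _ _ hV).
split=> [act V' h x|e W h d' ed].
  (* The formula is an equality of sections, so it may be checked near each point, where [d] has a
     lift. *)
  apply: (sheaf_local_eq (ares_sheaf O)) => y yV'.
  have [W [u [Wy [e ed]]]] := taut_local_lift smO n2 (taut_res h d) yV'.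
  have hW := osub_trans h u; exists W, u; split=> //.
  have ed' : tred (leq_pred n) e = taut_res hW d.
    by rewrite ed; exact: (gres_comp (G := autSheaf O n.-1)).
  rewrite rmorphM rmorphXn (lead_coef_t_nat _ _ hW).
  rewrite (kpart_nat t _ hW) (kpart_nat s _ hW) (taut_tmap _ _ hW).
  rewrite -(lift W hW e W (@osub_refl _ W)) // -(act W hW e ed').
  by rewrite (kpart_res _ _ _ hW).
apply: (ker_ext n2).
- by rewrite tred_res tk taut_res_1.
- by apply: ker_conj; rewrite tred_res sk taut_res_1.
move=> V' h' x; have hV := osub_trans h h'.
rewrite -[x](iinvK (tred n'1 d) hV) (lift _ _ _ _ _ _ _ ed).
by rewrite (kpart_res _ _ _ hV) e.
Qed.

End Conjugation.

(** * Change of cocycle *)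

Section TrivializationChange.
Variables (k : comPzRingType) (X : topologicalType) (O OY : algSheaf k X).
Variables (p : algHom OY O) (m : nat).

Lemma coc_comp (c : cocycle (autSheaf O m)) i j l V
    (hij : osub V (ocap (cov i) (cov j))) (hjl : osub V (ocap (cov j) (cov l)))
    (hil : osub V (ocap (cov i) (cov l))) x :
  ifun (coc (c := c) i j) hij (ifun (coc j l) hjl x) = ifun (coc i l) hil x.
Proof.
have := congr1 (fun g : taut O m V => ifun g (@osub_refl _ V) x) (cocP hij hjl hil).
rewrite /= (ifun_irr (coc i j) _ hij) (ifun_irr (coc j l) _ hjl).
by rewrite (ifun_irr (coc i l) _ hil).
Qed.

Definition trivializations (c : cocycle (autSheaf O m))
    (tau : forall i : cidx c, algIso (tsheaf O m) OY (cov i)) : Prop :=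
  (forall i V (h : osub V (cov i)) a, ahom p V (ifun (tau i) h a) = tcoef a 0) /\
  (forall i j V (hi : osub V (cov i)) (hj : osub V (cov j))
      (hij : osub V (ocap (cov i) (cov j))) a,
    ifun (tau i) hi (ifun (coc i j) hij a) = ifun (tau j) hj a).

(** The scheme comes with trivializations for one representative of [g]. For another one, the new
    trivialization over U'_i is tau_(a q) f_q^-1 c'_(b q, i) on each W_q, with f the cochain
    relating the two cocycles. *)
Lemma trivializations_change (g : H1 (autSheaf O m)) (c' : cocycle (autSheaf O m)) :
  multiple_scheme_of p g -> represents g c' ->
  exists tau : forall i : cidx c', algIso (tsheaf O m) OY (cov i), trivializations tau.
Proof.
move=> [c gc [tau [tau0 tauc]]] gc'.
have [c0 c0P] := representsP g.
have [K [W [a [b [f [cW ha hb fE]]]]]] : cohomologous c c'.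
  by apply: (cohomologous_trans (c' := c0)); [apply/cohomologous_sym/c0P|apply/c0P].
have fc q r V (hq : osub V (W q)) (hr : osub V (W r))
    (hA : osub V (ocap (cov (a q)) (cov (a r))))
    (hB : osub V (ocap (cov (b q)) (cov (b r)))) x :
    ifun (f q)^-1%g hq (ifun (coc (b q) (b r)) hB x) =
    ifun (coc (a q) (a r)) hA (ifun (f r)^-1%g hr x).
  have := congr1 (fun g : taut O m V => ifun g (@osub_refl _ V) x) (fE q r V hq hr hA hB).
  rewrite /= (ifun_irr (coc (b q) (b r)) _ hB) (ifun_irr (coc (a q) (a r)) _ hA).
  rewrite (ifun_irr (f q) _ hq) => ->; rewrite ifunK.
  by rewrite (Prop_irrelevance (osub_trans hr (@osub_refl _ V)) hr).
have sub (i : cidx c') q : osub (ocap (W q) (cov i)) (ocap (cov (b q)) (cov i)).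
  by move=> x [/hb].
pose s (i : cidx c') q : algIso (tsheaf O m) OY (ocap (W q) (cov i)) :=
  iso_comp (iso_res (osub_trans (ha q) (@ocapl _ _ _)) (tau (a q)))
    (iso_comp (iso_res (@ocapl _ _ _) (f q)^-1%g) (iso_res (sub i q) (coc (b q) i))).
have sE i q V (h : osub V (ocap (W q) (cov i))) (hA : osub V (cov (a q)))
    (hq : osub V (W q)) (hB : osub V (ocap (cov (b q)) (cov i))) x :
    ifun (s i q) h x = ifun (tau (a q)) hA (ifun (f q)^-1%g hq (ifun (coc (b q) i) hB x)).
  rewrite /= (ifun_irr (tau (a q)) _ hA) (ifun_irr (coc (b q) i) _ hB).
  by rewrite (Prop_irrelevance (osub_trans _ h) hq).
have glue i : exists t : algIso (tsheaf O m) OY (cov i), forall q V (h : osub V (cov i))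
    (hq : osub V (ocap (W q) (cov i))) x, ifun t h x = ifun (s i q) hq x.
  apply: glue_algIso => [q|x ix|q r V hq hr]; first exact: ocapr.
    by have [q Wq] := cW x; exists q.
  apply: algIso_ext => V' h x.
  have hq' := osub_trans hq h; have hr' := osub_trans hr h.
  have Wq := osub_trans (@ocapl _ _ _) hq'; have Wr := osub_trans (@ocapl _ _ _) hr'.
  have Bq := osub_trans (sub i q) hq'; have Br := osub_trans (sub i r) hr'.
  have Aq := osub_trans (ha q) Wq; have Ar := osub_trans (ha r) Wr.
  have Bqr := osub_cap (osub_trans (hb q) Wq) (osub_trans (hb r) Wr).
  have Aqr := osub_cap Aq Ar.
  rewrite -[LHS]/(ifun (s i q) _ x) -[RHS]/(ifun (s i r) _ x).
  (* Independence of q: split c'_(b q, i) through b r, move f_q^-1 past c'_(b q, b r) to get c_(a q,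
     a r) f_r^-1, and absorb c_(a q, a r) into tau_(a r). *)
  rewrite (sE _ _ _ _ Aq Wq Bq) (sE _ _ _ _ Ar Wr Br) -(coc_comp Bqr Br Bq).
  by rewrite (fc _ _ _ Wq Wr Aqr) (tauc _ _ _ _ Ar).
pose t i := sval (cid (glue i)).
have tE i q V (h : osub V (cov i)) (hq : osub V (ocap (W q) (cov i))) x :
    ifun (t i) h x = ifun (s i q) hq x by rewrite /t; case: cid => ?.
exists t; split=> [i V h x|i j V hi hj hij x].
  apply: (sheaf_local_eq (ares_sheaf O)) => y yV; have [q Wy] := cW y.
  pose V' := ocap V (W q); have u : osub V' V := @ocapl _ _ _.
  have h' := osub_trans h u; have hq := osub_cap (@ocapr _ _ _ : osub V' (W q)) h'.
  exists V', u; split=> //; rewrite (ahom_nat p u) (ifun_nat (t i) h h' u) (tE _ _ _ _ hq).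
  rewrite (sE _ _ _ _ (osub_trans (ha q) (@ocapr _ _ _)) (@ocapr _ _ _) (osub_trans (sub i q) hq)).
  by rewrite tau0 !tvalP -tcoef_map.
apply: (sheaf_local_eq (ares_sheaf OY)) => y yV; have [q Wy] := cW y.
pose V' := ocap V (W q); have u : osub V' V := @ocapl _ _ _.
have hi' := osub_trans hi u; have qi := osub_cap (@ocapr _ _ _ : osub V' (W q)) hi'.
have hj' := osub_trans hj u; have qj := osub_cap (@ocapr _ _ _ : osub V' (W q)) hj'.
have hij' := osub_trans hij u.
exists V', u; split=> //.
rewrite (ifun_nat (t i) hi hi' u) (ifun_nat (t j) hj hj' u) (tE _ _ _ _ qi) (tE _ _ _ _ qj).
have hA := osub_trans (ha q) (@ocapr _ _ _ : osub V' (W q)).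
have Bi := osub_trans (sub i q) qi; have Bj := osub_trans (sub j q) qj.
rewrite (sE _ _ _ _ hA (@ocapr _ _ _) Bi) (sE _ _ _ _ hA (@ocapr _ _ _) Bj).
rewrite -(coc_comp Bi hij' Bj); congr (ifun _ _ (ifun _ _ (ifun _ _ _))).
exact: (ifun_nat (coc i j) hij hij' u).
Qed.

End TrivializationChange.

(** Reduction in two stages equals direct reduction, so the constant cochain 1 compares the two
    cocycles attached to a representative of [g]. *)
Lemma represents_tred (k : comPzRingType) (X : topologicalType) (O : algSheaf k X)
    (m j i : nat) (jm : (j <= m)%N) (ij : (i <= j)%N) (im : (i <= m)%N)
    (g : H1 (autSheaf O m)) (d : cocycle (autSheaf O j)) :
  represents (H1_map (rho O jm) g) d ->
  represents (H1_map (rho O im) g) (cocycle_map (rho O ij) d).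
Proof.
move=> [c gc cd]; exists c => //.
apply: cohomologous_trans (cohomologous_map (rho O ij) cd).
exists (cidx c), (@cov _ _ c), id, id, (fun=> 1%g); split.
- exact: cov_covers.
- by move=> q; exact: osub_refl.
- by move=> q; exact: osub_refl.
move=> q r V hq hr ha hb; rewrite !gres1 mul1g invg1 mulg1 (Prop_irrelevance hb ha).
by rewrite /= tred_tred.
Qed.

(** * Local generators of tensor products *)

Section ModuleSheaves.
Variables (k : comPzRingType) (X : topologicalType) (O : algSheaf k X) (M : modSheaf O).

Lemma mres_id U (h : osub U U) (s : M U) : mres M h s = s.
Proof. by have [r1 _ _ _] := mres_sheaf M; rewrite r1. Qed.

Lemma mres_comp U V W (hV : osub V U) (hW : osub W V) (hWU : osub W U) (s : M U) :
  mres M hW (mres M hV s) = mres M hWU s.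
Proof. by have [_ r2 _ _] := mres_sheaf M; rewrite (r2 _ _ _ _ _ hWU). Qed.

End ModuleSheaves.

Definition algHom_id (k : comPzRingType) (X : topologicalType) (O : algSheaf k X) :
    algHom O O :=
  @AlgHom k X O O (fun U => idfun) (fun _ _ => erefl) (fun _ _ _ _ => erefl).

(** * Direct images of restrictions to an open set *)

Section ExtensionByRestriction.
Variables (k : comPzRingType) (X : topologicalType) (A O : algSheaf k X) (p : algHom A O).
Variables (M : modSheaf O) (W : opens X).

(** Keeping [p] in the type ties to it the [A]-module structure defined below. *)
Definition push_sec (p : algHom A O) (U : opens X) : Type := M (ocap U W).

HB.instance Definition _ U :=
  GRing.Zmodule.copy (push_sec p U) (M (ocap U W)).

Section Lmodule.
Variable U : opens X.

Let scale (a : A U) (x : push_sec p U) : push_sec p U :=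
  ares O (@ocapl _ U W) (ahom p U a) *: (x : M (ocap U W)).

Let scaleA a b x : scale a (scale b x) = scale (a * b) x.
Proof. by rewrite /scale scalerA -!rmorphM. Qed.
Let scale1 : left_id 1 scale.
Proof. by move=> x; rewrite /scale !rmorph1 scale1r. Qed.
Let scaleDr : right_distributive scale +%R.
Proof. by move=> a x y; rewrite /scale scalerDr. Qed.
Let scaleDl x : {morph scale^~ x : a b / a + b}.
Proof. by move=> a b; rewrite /scale !rmorphD scalerDl. Qed.

HB.instance Definition _ :=
  GRing.Zmodule_isLmodule.Build (A U) (push_sec p U) scaleA scale1 scaleDr scaleDl.

End Lmodule.

Lemma push_secZ U (a : A U) (x : push_sec p U) :
  a *: x = ares O (@ocapl _ U W) (ahom p U a) *: (x : M (ocap U W)).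
Proof. by []. Qed.

Definition push_res U V (h : osub V U) (x : push_sec p U) : push_sec p V :=
  mres M (ocapS h (@osub_refl _ W)) x.

Let push_res_zmod U V (h : osub V U) : zmod_morphism (push_res h).
Proof. by move=> x y; exact: raddfB. Qed.

HB.instance Definition _ U V h :=
  GRing.isZmodMorphism.Build (push_sec p U) (push_sec p V) (@push_res U V h)
    (push_res_zmod h).

Let push_resZ U V (h : osub V U) (a : A U) x :
  push_res h (a *: x) = ares A h a *: push_res h x.
Proof.
rewrite !push_secZ [LHS]mresZ.
rewrite -(ahom_nat p) (ares_comp _ _ (osub_trans h (@ocapl _ V W))).
by rewrite (ares_comp _ _ (osub_trans h (@ocapl _ V W))).
Qed.

Let push_sheaf : is_sheaf push_res.
Proof.
have [r1 r2 rs rg] := mres_sheaf M.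
have cap U I (Z : I -> opens X) (cZ : covers Z U) : covers (fun i => ocap (Z i) W) (ocap U W).
  by move=> x [Ux Wx]; have [i Zx] := cZ x Ux; exists i.
split=> [U h s|U V V' hV hW hWU s|U I Z hZ cZ s t e|U I Z hZ cZ s e].
- exact: mres_id.
- exact: mres_comp.
- exact: (rs _ _ _ (fun i => ocapS (hZ i) (@osub_refl _ W)) (cap _ _ _ cZ)).
- apply: (rg _ _ _ (fun i => ocapS (hZ i) (@osub_refl _ W)) (cap _ _ _ cZ)) => i j V hi hj.
  pose Y := ocap (Z i) (Z j).
  have hY : osub V (ocap Y W).
    by move=> x Vx; have [? ?] := hi x Vx; have [? ?] := hj x Vx.
  have := congr1 (mres M hY) (e i j Y (@ocapl _ _ _) (@ocapr _ _ _)).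
  by rewrite /push_res (mres_comp _ _ hi) (mres_comp _ _ hj).
Qed.

(* The direct image on X of the restriction to W, as a module over A through p *)
Definition push : modSheaf A :=
  @ModSheaf k X A (fun U => push_sec p U) (fun U V h => push_res h) push_resZ push_sheaf.

Lemma push_scaleE U (a : A U) (x : push U) :
  a *: x = ares O (@ocapl _ U W) (ahom p U a) *: (x : M (ocap U W)).
Proof. exact: push_secZ. Qed.

Lemma push_resE U V (h : osub V U) (x : push U) :
  mres push h x = mres M (ocapS h (@osub_refl _ W)) x.
Proof. by []. Qed.

End ExtensionByRestriction.

(** * Free generators of tensor products and tensor powers *)

Section LocalGenerators.
Variables (k : comPzRingType) (X : topologicalType) (O : algSheaf k X).

Definition free_generator (G : modSheaf O) (W : opens X) (e : G W) : Prop :=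
  (forall V (h : osub V W) c, c *: mres G h e = 0 -> c = 0) /\
  (forall V (h : osub V W) y, exists c, y = c *: mres G h e).

Section Tensor.
Variables (F G T : modSheaf O) (b : forall U, F U -> G U -> T U).
Hypothesis hT : is_tensor b.

Let bl U x : linear (b (U := U) x). Proof. by case: hT => -[]. Qed.
Let br U y : linear ((b (U := U))^~ y). Proof. by case: hT => -[]. Qed.

Lemma tensor_nat U V (h : osub V U) x y :
  mres T h (b x y) = b (mres F h x) (mres G h y).
Proof. by case: hT => -[]. Qed.

Lemma tensorDl U x x' y : b (U := U) (x + x') y = b x y + b x' y.
Proof. by have := br y 1 x x'; rewrite !scale1r. Qed.

Lemma tensorDr U x y y' : b (U := U) x (y + y') = b x y + b x y'.
Proof. by have := bl x 1 y y'; rewrite !scale1r. Qed.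

Lemma tensor0l U y : b (U := U) 0 y = 0.
Proof. by apply: (addIr (b 0 y)); rewrite -tensorDl !add0r. Qed.

Lemma tensor0r U x : b (U := U) x 0 = 0.
Proof. by apply: (addIr (b x 0)); rewrite -tensorDr !add0r. Qed.

Lemma tensorZl U a x y : b (U := U) (a *: x) y = a *: b x y.
Proof. by have := br y a x 0; rewrite !addr0 tensor0l addr0. Qed.

Lemma tensorZr U a x y : b (U := U) x (a *: y) = a *: b x y.
Proof. by have := bl x a y 0; rewrite !addr0 tensor0r addr0. Qed.

Variables (W : opens X) (e : G W).
Hypothesis ge : free_generator e.

(** Sections of a tensor product sheaf are not sums of pure tensors in general, so the inverse of x
    |-> x (x) e is taken from the universal property, applied to the pairing that multiplies x by
    the coordinate of y along e. *)
Lemma tensor_generator V (h : osub V W) : bijective (fun x : F V => b x (mres G h e)).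
Proof.
have [e_inj e_surj] := ge.
pose crd V (h : osub V W) y : O V := sval (cid (e_surj V h y)).
have crdE V1 h1 y : crd V1 h1 y *: mres G h1 e = y by rewrite /crd; case: cid.
have crdP V1 (h1 : osub V1 W) c y : c *: mres G h1 e = y -> crd V1 h1 y = c.
  move=> ce; apply/eqP; rewrite -subr_eq0; apply/eqP/(e_inj V1 h1).
  by rewrite scalerBl crdE ce subrr.
have crdL V1 (h1 : osub V1 W) a y z : crd V1 h1 (a *: y + z) = a * crd V1 h1 y + crd V1 h1 z.
  by apply: crdP; rewrite scalerDl -scalerA !crdE.
have crd_nat V1 V2 h1 h2 (u : osub V2 V1) y : ares O u (crd V1 h1 y) = crd V2 h2 (mres G u y).
  by apply/esym/crdP; rewrite -(mres_comp h1 u h2) -mresZ crdE.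
pose id := algHom_id O.
pose b1 U (x : F U) (y : G U) : push id F W U :=
  crd (ocap U W) (@ocapr _ U W) (mres G (@ocapl _ U W) y) *: mres F (@ocapl _ U W) x.
have b1P : bilinear_pairing b1.
  split=> [U x a y z|U y a x z|U U' u x y]; rewrite /b1.
  - by rewrite raddfD mresZ crdL scalerDl -scalerA.
  - by rewrite raddfD mresZ scalerDr !scalerA push_scaleE scalerA mulrC.
  rewrite push_resE mresZ (crd_nat _ _ _ (@ocapr _ U' W)).
  by rewrite !(mres_comp _ _ (osub_trans u (@ocapl _ U' W))).
have [_ univ] := hT; have [u [uE _]] := univ _ _ b1P.
pose b2 U (x : F U) (y : G U) : push id T W U := mres T (@ocapl _ U W) (b x y).
have b2P : bilinear_pairing b2.
  split=> [U x a y z|U y a x z|U U' v x y]; rewrite /b2.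
  - by rewrite tensorDr tensorZr raddfD mresZ.
  - by rewrite tensorDl tensorZl raddfD mresZ.
  by rewrite push_resE -tensor_nat !(mres_comp _ _ (osub_trans v (@ocapl _ U' W))).
have w1L U : linear (fun t : T U => mres T (@ocapl _ U W) t : push id T W U).
  by move=> a s t; rewrite raddfD mresZ.
pose w1' U : {linear T U -> push id T W U} := HB.pack
  (fun t : T U => mres T (@ocapl _ U W) t : push id T W U)
  (GRing.isLinear.Build _ _ _ _ _ (w1L U)).
have w1n U U' (v : osub U' U) t : mres (push id T W) v (w1' U t) = w1' U' (mres T v t).
  by rewrite /= push_resE !(mres_comp _ _ (osub_trans v (@ocapl _ U' W))).
have w2L U : linear (fun t : T U =>
    b (mhom u U t : F (ocap U W)) (mres G (@ocapr _ U W) e) : push id T W U).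
  by move=> a s t; rewrite linearP push_scaleE tensorDl tensorZl.
pose w2' U : {linear T U -> push id T W U} := HB.pack
  (fun t : T U => b (mhom u U t : F (ocap U W)) (mres G (@ocapr _ U W) e) : push id T W U)
  (GRing.isLinear.Build _ _ _ _ _ (w2L U)).
have w2n U U' (v : osub U' U) t : mres (push id T W) v (w2' U t) = w2' U' (mres T v t).
  rewrite /= push_resE tensor_nat -(mhom_nat u) push_resE.
  by rewrite (mres_comp _ _ (@ocapr _ U' W)).
have [w [_ wU]] := univ _ _ b2P.
(* Restriction to W and t |-> u(t) (x) e agree on pure tensors, so they coincide by the uniqueness
   clause; this is the surjectivity half. *)
have w12 U t : w1' U t = w2' U t.
  have e1 := wU (ModHom w1n) _ U t; have e2 := wU (ModHom w2n) _ U t.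
  rewrite e1 // e2 // => U' x y; rewrite /= uE /b1 /b2 tensorZl -tensorZr crdE.
  by rewrite tensor_nat.
have hc : osub V (ocap V W) := osub_cap (@osub_refl _ V) h.
have bK x : mres F hc (mhom u V (b x (mres G h e))) = x.
  rewrite uE /b1 (mres_comp _ _ (@ocapr _ V W)) (crdP _ _ 1) ?scale1r //.
  by rewrite (mres_comp _ _ (@osub_refl _ V)) mres_id.
exists (fun t => mres F hc (mhom u V t)) => // t.
have := congr1 (mres T hc) (w12 V t); rewrite /= (mres_comp _ _ (@osub_refl _ V)) mres_id.
by move/esym; rewrite tensor_nat (mres_comp _ _ h).
Qed.

End Tensor.

(** The map is s |-> s^j, homogeneous of degree j rather than linear. Degree j turns a transition
    function u of L into u^j, and a power of a generator is a generator by [tensor_generator]. *)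
Lemma tensor_power_map (L : modSheaf O) (j : nat) (P : modSheaf O) :
  tensor_power L j P -> exists pw : forall U, L U -> P U,
  [/\ forall U V (h : osub V U) s, mres P h (pw U s) = pw V (mres L h s),
      forall U c s, pw U (c *: s) = c ^+ j *: pw U s
    & forall W e, free_generator e -> free_generator (pw W e)].
Proof.
elim=> {j P} [|j P Q b _ [pw [pn pZ pg]] hb].
  exists (fun U s => (1 : O U)); split=> [U V h s|U c s|W e _].
  - exact: rmorph1.
  - by rewrite expr0 scale1r.
  have r1 V (h : osub V W) : mres (structure_module O) h (1 : O W) = (1 : O V).
    exact: rmorph1.
  split=> V h; first by move=> c; rewrite r1 => ce; rewrite -ce [RHS]mulr1.
  by move=> y; exists y; rewrite r1 [RHS]mulr1.
exists (fun U s => b U (pw U s) s); split=> [U V h s|U c s|W e ge].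
- by rewrite (tensor_nat hb) pn.
- by rewrite pZ (tensorZl hb) (tensorZr hb) scalerA exprSr.
have [p_inj p_surj] := pg W e ge.
split=> V h.
  move=> c; rewrite (tensor_nat hb) -(tensorZl hb) -(tensor0l hb (mres L h e)).
  by move=> /(bij_inj (tensor_generator hb ge h)); exact: p_inj.
move=> y; have [g _ gK] := tensor_generator hb ge h; have [c gy] := p_surj V h (g y).
by exists c; rewrite (tensor_nat hb) -(tensorZl hb) -gy gK.
Qed.

End LocalGenerators.

(** * The conormal bundle of a trivialized double scheme *)

Section Conormal.
Variables (k : comPzRingType) (X : topologicalType) (O OY : algSheaf k X).
Variables (p : algHom OY O) (L : modSheaf O) (l : forall U, OY U -> L U).
Hypothesis hL : is_conormal p l.
Variables (W : opens X) (tau : algIso (tsheaf O 2) OY W).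
Hypothesis tau0 : forall V (h : osub V W) a, ahom p V (ifun tau h a) = tcoef a 0.

Lemma tau_mono V V' (h : osub V W) (h' : osub V' W) (u : osub V' V) c :
  ares OY u (ifun tau h (tmono 2 1 c)) = ifun tau h' (tmono 2 1 (ares O u c)).
Proof. by rewrite (ifun_nat tau h h' u) -tmap_mono. Qed.

Lemma ideal_trivialized V (h : osub V W) (s : OY V) : ideal_sheaf p s ->
  exists c, s = ifun tau h (tmono 2 1 c).
Proof.
rewrite -[s](iinvK tau h) => s0; set x : tpoly 2 (O V) := iinv tau h s.
exists (tcoef x 1); congr (ifun _ _ _); apply: tcoefP => -[|[|]] // _.
  by rewrite tcoef_mono -(tau0 h); exact: s0.
by rewrite tcoef_mono.
Qed.

Lemma trivialized_ideal V (h : osub V W) c : ideal_sheaf p (ifun tau h (tmono 2 1 c)).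
Proof. by rewrite /ideal_sheaf /= tau0 tcoef_mono. Qed.

Lemma conormal_trivialized V (h : osub V W) c :
  l (ifun tau h (tmono 2 1 c)) = c *: mres L h (l (ifun tau (@osub_refl _ W) (tmono 2 1 1))).
Proof.
have [_ lZ ln _ _] := hL.
rewrite ln; last exact: trivialized_ideal.
have -> : tmono 2 1 c = tconst 2 c * tmono 2 1 1 by rewrite tmonoM mulr1.
rewrite rmorphM lZ; last exact: trivialized_ideal.
by rewrite tau0 tcoef_mono /= (tau_mono _ h) rmorph1.
Qed.

(** Over W the ideal I is t O with t^2 = 0, so I^2 vanishes and c e = 0 forces c = 0. Sections of L
    lift to I only locally; the resulting coordinates are unique by the first half, hence glue. *)
Lemma conormal_generator : free_generator (l (ifun tau (@osub_refl _ W) (tmono 2 1 1))).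
Proof.
have [lD lZ ln l0 lsurj] := hL.
have inj V (h : osub V W) c :
    c *: mres L h (l (ifun tau (@osub_refl _ W) (tmono 2 1 1))) = 0 -> c = 0.
  rewrite -conormal_trivialized => /l0-/(_ (trivialized_ideal h c)) sq.
  apply: (sheaf_local_eq (ares_sheaf O)) => x Vx.
  have [V' [u [V'x [r rI rE]]]] := sq x Vx; have h' := osub_trans h u.
  exists V', u; split=> //; rewrite rmorph0.
  move: rE; rewrite big_seq big1; last first.
    move=> ab /rI[/(ideal_trivialized h')[c1 ->] /(ideal_trivialized h')[c2 ->]].
    by rewrite -rmorphM tmonoM tmono_ge ?rmorph0.
  rewrite (ifun_nat tau h h' u) => /(congr1 (iinv tau h')); rewrite ifunK rmorph0.
  move=> /(congr1 (fun x : tpoly 2 (O V') => tcoef x 1)).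
  by rewrite tcoef_map tcoef_mono tcoef0.
split=> // V h y.
have [||V1 u1 c c' cE c'E|t tE] := sheaf_glue_unique (ares_sheaf O) (U := V)
  (P := fun V' u c => mres L u y =
     c *: mres L (osub_trans h u) (l (ifun tau (@osub_refl _ W) (tmono 2 1 1)))).
- move=> x Vx; have [V' [u [V'x [s sI sE]]]] := lsurj V y x Vx.
  exists V', u; split=> //.
  have [c sc] := ideal_trivialized (osub_trans h u) sI.
  by exists c; rewrite -sE sc conormal_trivialized.
- move=> V1 V2 u1 u2 u c cE; rewrite -(mres_comp u1 u) cE mresZ.
  by rewrite (mres_comp _ _ (osub_trans h u2)).
- apply/eqP; rewrite -subr_eq0; apply/eqP/(inj _ (osub_trans h u1)).
  by rewrite scalerBl -cE -c'E subrr.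
exists t; apply: (sheaf_local_eq (mres_sheaf L)) => x Vx.
have [V' [u [V'x [s sI sE]]]] := lsurj V y x Vx.
have [c sc] := ideal_trivialized (osub_trans h u) sI.
have yE : mres L u y =
    c *: mres L (osub_trans h u) (l (ifun tau (@osub_refl _ W) (tmono 2 1 1))).
  by rewrite -sE sc conormal_trivialized.
exists V', u; split=> //; rewrite mresZ (tE _ _ _ yE) yE.
by rewrite (mres_comp _ _ (osub_trans h u)).
Qed.

End Conormal.

(** * The dual of the restricted differentials *)

Section RestrictedDifferentials.
Variables (k : comPzRingType) (X : topologicalType) (O OY : algSheaf k X).
Variables (p : algHom OY O) (Om : modSheaf OY) (d : forall U, OY U -> Om U).
Hypothesis hOm : is_differentials d.
Variables (OmX : modSheaf O) (r : forall U, Om U -> OmX U).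
Hypothesis hOmX : is_restriction p r.
Variable U : opens X.

Local Notation O1 := (structure_module O).
Local Notation id1 := (algHom_id O).

(** The elements r(d a) generate only after passing to sheaves, so uniqueness is drawn from the two
    universal properties: for differentials it shows that f and g agree on the image of [r], for the
    restriction that they agree on [OmX]. *)
Lemma dual_ext (f g : dual_module OmX U) :
  (forall V (h : osub V U) a, hfun f h (r (d a)) = hfun g h (r (d a))) -> f = g.
Proof.
move=> fg; have [[rD rZ rn] runiv] := hOmX; have [[dD dM dc dn] duniv] := hOm.
(* A section of the dual over [U] becomes a morphism on all of X with values in the direct image of
   O restricted to [U]. *)
pose G (f : dual_module OmX U) V (s : OmX V) : push id1 O1 U V :=
  hfun f (@ocapr _ V U) (mres OmX (@ocapl _ V U) s).
have GL f1 V : linear (@G f1 V).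
  by move=> a s t; rewrite /G raddfD mresZ linearP.
have GZ f1 V a s : G f1 V (a *: s) = a *: (G f1 V s : push id1 O1 U V).
  by rewrite /G mresZ linearZ.
have Gn f1 V V' (u : osub V' V) s : mres (push id1 O1 U) u (G f1 V s) = G f1 V' (mres OmX u s).
  rewrite push_resE /G (hfun_nat f1 _ (@ocapr _ V' U)).
  by rewrite !(mres_comp _ _ (osub_trans u (@ocapl _ V' U))).
pose GH f1 : modHom OmX (push id1 O1 U) := @ModHom _ _ _ _ _
  (fun V => HB.pack (@G f1 V) (GRing.isLinear.Build _ _ _ _ _ (GL f1 V))) (@Gn f1).
pose E (f : dual_module OmX U) V (x : Om V) : push p O1 U V := G f V (r x).
have EL f1 V : linear (@E f1 V).
  by move=> a s t; rewrite /E rD rZ; exact: (GL f1 V (ahom p V a) (r s) (r t)).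
have En f1 V V' (u : osub V' V) s : mres (push p O1 U) u (E f1 V s) = E f1 V' (mres Om u s).
  by rewrite /E -rn -Gn.
pose EH f1 : modHom Om (push p O1 U) := @ModHom _ _ _ _ _
  (fun V => HB.pack (@E f1 V) (GRing.isLinear.Build _ _ _ _ _ (EL f1 V))) (@En f1).
have Ed V a : E f V (d a) = E g V (d a).
  by rewrite /E /G rn dn fg.
have Eder : derivation (fun V a => E f V (d a)).
  split=> [V a a'|V a a'|V c|V V' u a].
  - by rewrite dD; exact: (raddfD (mhom (EH f) V)).
  - by rewrite dM; have := linearP (mhom (EH f) V) a (d a') (a' *: d a); rewrite linearZ.
  - by rewrite dc; exact: (raddf0 (mhom (EH f) V)).
  - by rewrite En dn.
have [w [_ wU]] := duniv _ _ Eder.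
have E12 V x : E f V x = E g V x.
  have e1 := wU (EH f) (fun _ _ => erefl) V x.
  by rewrite [LHS]e1 -(wU (EH g)) // => V' a; rewrite /= -Ed.
have Esl : semilinear_map (N := push id1 O1 U) p (fun V x => G f V (r x)).
  split=> [V x y|V a x|V V' u x].
  - by rewrite rD; exact: (raddfD (mhom (GH f) V)).
  - by rewrite rZ; exact: GZ.
  - by rewrite Gn rn.
have [z [_ zU]] := runiv _ _ Esl.
have G12 V s : G f V s = G g V s.
  have e1 := zU (GH f) (fun _ _ => erefl) V s.
  by rewrite [LHS]e1 -(zU (GH g)) // => V' x; rewrite /= -[LHS]E12.
apply: homsec_ext => V h s; pose hc := osub_cap (@osub_refl _ V) h.
have GE f1 : mres O1 hc (G f1 V s : O1 (ocap V U)) = hfun f1 h s.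
  by rewrite (hfun_nat f1 _ h) (mres_comp _ _ (@osub_refl _ V)) mres_id.
by rewrite -!GE G12.
Qed.

(** A derivation over [U] becomes one on X with values in a direct image; it factors through the
    differentials, and the semilinear map so obtained factors through their restriction to X. *)
Lemma dual_of_derivation (D : forall V, osub V U -> OY V -> O V) :
  (forall V h a a', D V h (a + a') = D V h a + D V h a') ->
  (forall V h a a', D V h (a * a') = ahom p V a * D V h a' + ahom p V a' * D V h a) ->
  (forall V h c, D V h (acst OY V c) = 0) ->
  (forall V V' h h' (u : osub V' V) a, ares O u (D V h a) = D V' h' (ares OY u a)) ->
  exists f : dual_module OmX U, forall V (h : osub V U) a, hfun f h (r (d a)) = D V h a.
Proof.
move=> DD DM Dc Dn; have [[rD rZ rn] runiv] := hOmX; have [_ duniv] := hOm.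
pose D' V (a : OY V) : push p O1 U V := D _ (@ocapr _ V U) (ares OY (@ocapl _ V U) a).
have D'der : derivation D'.
  split=> [V a a'|V a a'|V c|V V' u a]; rewrite /D'.
  - by rewrite rmorphD DD.
  - by rewrite rmorphM DM -!(ahom_nat p).
  - by rewrite ares_cst Dc.
  rewrite push_resE [LHS](Dn _ _ _ (@ocapr _ V' U)); congr (D _ _ _).
  by rewrite !(ares_comp _ _ (osub_trans u (@ocapl _ V' U))).
have [v [vd _]] := duniv _ _ D'der.
have vsl : semilinear_map (N := push id1 O1 U) p (fun V x => mhom v V x).
  split=> [V x y|V a x|V V' u x].
  - exact: raddfD.
  - by rewrite linearZ.
  - exact: (mhom_nat v u x).
have [w [wr _]] := runiv _ _ vsl.
pose hc V (h : osub V U) := osub_cap (@osub_refl _ V) h.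
pose F V h (s : OmX V) : O1 V := mres O1 (hc V h) (mhom w V s : O1 (ocap V U)).
have FL V h : linear (@F V h).
  move=> a s t; rewrite /F linearP raddfD push_scaleE mresZ.
  by rewrite (ares_comp _ _ (@osub_refl _ V)) ares_id.
have Fn V V' h h' (u : osub V' V) s : mres O1 u (F V h s) = F V' h' (mres OmX u s).
  rewrite /F -(mhom_nat w u) push_resE.
  by rewrite !(mres_comp _ _ (osub_trans (hc V h) u)).
pose f : dual_module OmX U := @HomSec _ _ _ _ _ _
  (fun V h => HB.pack (@F V h) (GRing.isLinear.Build _ _ _ _ _ (FL V h))) Fn.
exists f => V h a; rewrite /= /F wr vd /D' [LHS](Dn _ _ _ h).
by rewrite (ares_comp _ _ (@osub_refl _ V)) ares_id.
Qed.

End RestrictedDifferentials.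

(** * The twisted kernel *)

Section TwistedKernelTensor.
Variables (k : comPzRingType) (X : topologicalType) (O : algSheaf k X).
Hypothesis smO : smooth_scheme O.
Variables (n : nat) (n2 : (2 < n)%N) (n'1 : (1 < n.-1)%N).
Variables (delta : cocycle (autSheaf O n.-1)).
Variables (OY : algSheaf k X) (p : algHom OY O).
Variable tau : forall i : cidx (cocycle_map (rho O n'1) delta),
  algIso (tsheaf O 2) OY (cov i).
Hypothesis htau : trivializations p tau.
Variables (L : modSheaf O) (l : forall U, OY U -> L U).
Hypothesis hL : is_conormal p l.
Variables (Om : modSheaf OY) (d : forall U, OY U -> Om U).
Hypothesis hOm : is_differentials d.
Variables (OmX : modSheaf O) (r : forall U, Om U -> OmX U).
Hypothesis hOmX : is_restriction p r.
Variables (Lpow : modSheaf O).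
Hypothesis hLpow : tensor_power L n.-1 Lpow.
Variables (T : modSheaf O) (b : forall U, dual_module OmX U -> Lpow U -> T U).
Hypothesis hT : is_tensor b.

Let tau0 : forall (i : cidx delta) V (h : osub V (cov i)) a,
  ahom p V (ifun (tau i) h a) = tcoef a 0 := htau.1.

Let tauc (i j : cidx delta) V (hi : osub V (cov i)) (hj : osub V (cov j))
    (hij : osub V (ocap (cov i) (cov j))) a :
  ifun (tau i) hi (ifun (tred n'1 (coc (c := delta) i j)) hij a) = ifun (tau j) hj a.
Proof. exact: (htau.2 i j V hi hj hij a). Qed.

(** Take the power of e_i = l(tau_i t). The transition rule comes from tau_j(t) =
    tau_i(delta_ij(t)), where delta_ij(t) = u t modulo t^2. *)
Lemma local_power_generators : exists lam : forall i : cidx delta, Lpow (cov i),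
  (forall i, free_generator (lam i)) /\
  forall i j V (hi : osub V (cov i)) (hj : osub V (cov j))
      (hij : osub V (ocap (cov i) (cov j))),
    mres Lpow hj (lam j) =
      lead_coef_t (coc (c := delta) i j) hij ^+ n.-1 *: mres Lpow hi (lam i).
Proof.
have [pw [pn pZ pg]] := tensor_power_map hLpow.
pose e (i : cidx delta) : L (cov i) := l (ifun (tau i) (@osub_refl _ (cov i)) (tmono 2 1 1)).
exists (fun i => pw _ (e i)); split=> [i|i j V hi hj hij].
  exact: pg (conormal_generator hL (tau0 (i := i))).
rewrite !pn -pZ; congr (pw V _).
rewrite -[LHS]scale1r -(conormal_trivialized hL (tau0 (i := j))).
rewrite -(conormal_trivialized hL (tau0 (i := i))) -(tauc hi hj hij); congr (l (ifun _ _ _)).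
apply: tcoefP => -[|[|]] // _; rewrite tcoef_mono /=.
  by rewrite (tvalP (tred n'1 _)) tcoef_mono.
by rewrite -(lead_coef_t_tred n'1).
Qed.

(** * Local isomorphisms and their gluing *)

Section Fixed.
Variable lam : forall i : cidx delta, Lpow (cov i).
Hypothesis lam_gen : forall i, free_generator (lam i).
Hypothesis lam_change : forall i j V (hi : osub V (cov i)) (hj : osub V (cov j))
    (hij : osub V (ocap (cov i) (cov j))),
  mres Lpow hj (lam j) =
    lead_coef_t (coc (c := delta) i j) hij ^+ n.-1 *: mres Lpow hi (lam i).

(** The equation f r d = D tau_i^-1, kept as a relation so that it can be solved both for [f] and
    for [g]. *)
Definition dual_of_kernel (i : cidx delta) V (g : taut O n V) (f : dual_module OmX V) : Prop :=
  forall V' (h : osub V' V) (hi : osub V' (cov i)) x,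
    hfun f h (r (d (ifun (tau i) hi x))) = kpart g h x.

Lemma dual_of_kernel_ext i V (hi : osub V (cov i)) g g' f f' :
  (forall V' (h : osub V' V) x, kpart g h x = kpart g' h x) ->
  dual_of_kernel i g f -> dual_of_kernel i g' f' -> f = f'.
Proof.
move=> gg fg fg'; apply: (dual_ext hOm hOmX) => V' h a.
have h' := osub_trans hi h.
by rewrite -[a](iinvK (tau i) h') (fg _ h h') (fg' _ h h') gg.
Qed.

(** The constant coefficient of tau_i^-1(a) is the image of a under [p], so D tau_i^-1 satisfies the
    Leibniz rule of a derivation from OY to O. *)
Lemma dual_of_kernel_ex i V (hi : osub V (cov i)) (g : taut O n V) :
  tred (leq_pred n) g = 1%g -> exists f, dual_of_kernel i g f.
Proof.
move=> gk; pose D V' (h : osub V' V) a := kpart g h (iinv (tau i) (osub_trans hi h) a).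
have p0 V' (h : osub V' (cov i)) a : tcoef (iinv (tau i) h a) 0 = ahom p V' a.
  by rewrite -(tau0 h) iinvK.
have [||||f fE] := @dual_of_derivation _ _ _ _ _ _ _ hOm _ _ hOmX V D.
- by move=> V' h a a'; rewrite /D rmorphD (kpartD n2).
- by move=> V' h a a'; rewrite /D rmorphM (kpartM n2) // !p0.
- by move=> V' h c; rewrite /D iinv_cst (kpart_cst n2).
- move=> V1 V2 h1 h2 u a; rewrite /D (kpart_nat g _ h2); congr (kpart _ _ _).
  exact: (iinv_nat (tau i)).
exists f => V' h h' x; rewrite fE /D (Prop_irrelevance (osub_trans hi h) h').
by rewrite ifunK.
Qed.

Lemma kernel_of_dual i V (hi : osub V (cov i)) (f : dual_module OmX V) :
  exists2 g : taut O n V, tred (leq_pred n) g = 1%g & dual_of_kernel i g f.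
Proof.
pose K V' (h : osub V' V) x : O V' := hfun f h (r (d (ifun (tau i) (osub_trans hi h) x))).
have [[dD dM dc dn] _] := hOm; have [[rD rZ rn] _] := hOmX.
have r0 V' : r (0 : Om V') = 0 by apply: (addIr (r 0)); rewrite -rD !add0r.
have fD V' (h : osub V' V) x y : hfun f h (x + y) = (hfun f h x : O V') + hfun f h y.
  exact: raddfD.
have fZ V' (h : osub V' V) c x : hfun f h (c *: x) = c * (hfun f h x : O V').
  exact: linearZ.
have [|g gk gE] := @kpart_surj _ _ O n n2 V K.
  split=> [V' h x y|V' h x y|V' h c|V1 V2 h1 h2 u x]; rewrite /K.
  - by rewrite rmorphD dD rD fD.
  - by rewrite rmorphM dM rD !rZ fD !fZ !tau0.
  - by rewrite ifun_cst dc r0 raddf0.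
  by rewrite [LHS](hfun_nat f h1 h2 u) rn dn (ifun_nat (tau i) _ (osub_trans hi h2)).
exists g => // V' h h' x; rewrite gE /K (Prop_irrelevance (osub_trans hi h) h') //.
Qed.

(** The graph of the isomorphism from the kernel to T over an open subset of U_i, namely D |-> (D
    tau_i^-1) (x) lambda_i. *)
Definition kernel_section (i : cidx delta) V (hi : osub V (cov i)) (g : taut O n V) (t : T V) :=
  exists2 f, dual_of_kernel i g f & t = b f (mres Lpow hi (lam i)).

Lemma kernel_section_ex i V (hi : osub V (cov i)) g :
  tred (leq_pred n) g = 1%g -> exists t, kernel_section hi g t.
Proof.
by move=> /(dual_of_kernel_ex hi)[f fg]; exists (b f (mres Lpow hi (lam i))), f.
Qed.

Lemma kernel_section_surj i V (hi : osub V (cov i)) t :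
  exists2 g, tred (leq_pred n) g = 1%g & kernel_section hi g t.
Proof.
have [B _ BK] := tensor_generator hT (lam_gen i) hi.
by have [g gk gf] := kernel_of_dual hi (B t); exists g => //; exists (B t).
Qed.

Lemma kernel_section_fun i V (hi : osub V (cov i)) g t t' :
  kernel_section hi g t -> kernel_section hi g t' -> t = t'.
Proof. by move=> [f fg ->] [f' fg' ->]; rewrite (dual_of_kernel_ext hi _ fg fg'). Qed.

Lemma kernel_section_inj i V (hi : osub V (cov i)) g g' t :
  tred (leq_pred n) g = 1%g -> tred (leq_pred n) g' = 1%g ->
  kernel_section hi g t -> kernel_section hi g' t -> g = g'.
Proof.
move=> gk gk' [f fg ->] [f' fg'] /(bij_inj (tensor_generator hT (lam_gen i) hi)) ff'.
apply: (ker_ext n2) => // V' h x; have h' := osub_trans hi h.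
by rewrite -(fg V' h h') -(fg' V' h h') ff'.
Qed.

Lemma kernel_section_res i V V' (hi : osub V (cov i)) (hi' : osub V' (cov i))
    (u : osub V' V) g t :
  kernel_section hi g t -> kernel_section hi' (taut_res u g) (mres T u t).
Proof.
move=> [f fg ->]; exists (mres (dual_module OmX) u f).
  move=> V1 h h1 x; rewrite (kpart_res _ _ _ (osub_trans u h)).
  by rewrite -(fg _ (osub_trans u h) h1).
by rewrite (tensor_nat hT) (mres_comp _ _ hi').
Qed.

Lemma kernel_sectionM i V (hi : osub V (cov i)) g g' t t' :
  tred (leq_pred n) g = 1%g -> tred (leq_pred n) g' = 1%g ->
  kernel_section hi g t -> kernel_section hi g' t' ->
  kernel_section hi (g * g')%g (t + t').
Proof.
move=> gk gk' [f fg ->] [f' fg' ->]; exists (f + f'); last by rewrite (tensorDl hT).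
by move=> V' h h' x; rewrite (kpart_mul n2) // -(fg V' h h') -(fg' V' h h').
Qed.

Lemma kernel_sectionZ i V (hi : osub V (cov i)) g g' t c :
  (forall V' (h : osub V' V) x, kpart g' h x = ares O h c * kpart g h x) ->
  kernel_section hi g t -> kernel_section hi g' (c *: t).
Proof.
move=> gg [f fg ->]; exists (c *: f); last by rewrite (tensorZl hT).
by move=> V' h h' x; rewrite gg -(fg V' h h') homsecZ.
Qed.

(** Since lambda_j = u^(n-1) lambda_i, equality of the tensors means f_g = u^(n-1) f_s. As tau_i
    delta_ij = tau_j, this is the description of the action in [conj_actionP]. *)
Lemma kernel_section_conj i j V (hi : osub V (cov i)) (hj : osub V (cov j))
    (hij : osub V (ocap (cov i) (cov j))) s g t t' :
  tred (leq_pred n) s = 1%g -> tred (leq_pred n) g = 1%g ->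
  kernel_section hj s t' -> kernel_section hi g t ->
  conj_action (leq_pred n) (taut_res hij (coc (c := delta) i j)) s g <-> t = t'.
Proof.
move=> sk gk [f fs ->] [f' fg ->]; rewrite (conj_actionP smO n2 n'1) //.
rewrite (lam_change hi hj hij) (tensorZr hT) -(tensorZl hT).
set u := lead_coef_t _ hij; set D := taut_res hij _.
have uE V' (h : osub V' V) : ares O h (u ^+ n.-1) = lead_coef_t D h ^+ n.-1.
  rewrite rmorphXn /u (lead_coef_t_nat _ _ (osub_trans hij h)).
  by rewrite (lead_coef_t_res _ _ _ (osub_trans hij h)).
have DE V' (h : osub V' V) x : ifun (tau i) (osub_trans hi h) (ifun (tred n'1 D) h x) =
    ifun (tau j) (osub_trans hj h) x.
  rewrite /D tred_res -(tauc (osub_trans hi h) _ (osub_trans hij h)) //.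
split=> [e|/(bij_inj (tensor_generator hT (lam_gen i) hi)) e V' h x].
  congr (b _ _); apply: (dual_ext hOm hOmX) => V' h a.
  rewrite -[a](iinvK (tau j) (osub_trans hj h)) -DE (fg _ h) e homsecZ uE DE.
  by rewrite (fs _ h).
by rewrite -(fg V' h (osub_trans hi h)) e homsecZ uE DE (fs _ h).
Qed.

Local Notation tw_sheaf := (twistSheaf (leq_pred n) delta).

Let sec U (s : tw_sheaf U) V (h : osub V U) (t : T V) :=
  exists (i : cidx delta) (hi : osub V (cov i)),
    kernel_section hi (taut_res (osub_cap h hi) (tw s i)) t.

Let res_ker U (s : tw_sheaf U) i V (h : osub V (ocap U (cov i))) :
  tred (leq_pred n) (taut_res h (tw s i)) = 1%g.
Proof. by rewrite tred_res tw_ker taut_res_1. Qed.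

Let sec_res U (s : tw_sheaf U) V V' h h' (u : osub V' V) t :
  sec s h t -> sec s (V := V') h' (mres T u t).
Proof.
move=> [i [hi st]]; exists i, (osub_trans hi u).
have := kernel_section_res (osub_trans hi u) u st; congr kernel_section.
exact: (gres_comp (G := autSheaf O n)).
Qed.

(** Independence of the index i: the components s_i and s_j are related by the action of delta_ij,
    which by [kernel_section_conj] means that they have the same image. *)
Let sec_fun U (s : tw_sheaf U) V (h : osub V U) t t' :
  sec s h t -> sec s h t' -> t = t'.
Proof.
move=> [i [hi st]] [j [hj st']].
apply/(kernel_section_conj (osub_cap hi hj) (res_ker _ _) (res_ker _ _) st' st).
exact: tw_glue.
Qed.

Let sec_ex U (s : tw_sheaf U) x : oset U x ->
  exists V (h : osub V U), oset V x /\ exists t, sec s h t.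
Proof.
move=> Ux; have [i ix] := cov_covers delta x.
exists (ocap U (cov i)), (@ocapl _ _ _); split=> //.
have [t st] := kernel_section_ex (@ocapr _ _ _ : osub (ocap U (cov i)) (cov i))
  (res_ker s (osub_cap (@ocapl _ U (cov i)) (@ocapr _ _ _))).
by exists t, i, (@ocapr _ _ _).
Qed.

Lemma twisted_kernel_iso_of_generators : exists phi : forall U, tw_sheaf U -> T U,
    [/\ forall U, bijective (phi U),
        forall U s t, phi U (s * t)%g = phi U s + phi U t,
        forall U V (h : osub V U) s,
          mres T h (phi U s) = phi V (gres tw_sheaf h s)
      & forall U (f : O U) s s', twisted_scale f s s' ->
          phi U s' = f *: phi U s].
Proof.
have ex U (s : tw_sheaf U) : exists t : T U, forall V h y, sec s h y -> mres T (V := V) h t = y.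
  apply: (sheaf_glue_unique (mres_sheaf T) (P := fun V h y => sec s h y)).
  - by move=> x; exact: sec_ex.
  - by move=> V V' h h' u y; exact: sec_res.
  - by move=> V h y y'; exact: sec_fun.
pose phi U s := sval (cid (ex U s)).
have phiE U s V (h : osub V U) y : sec s h y -> mres T h (phi U s) = y.
  by rewrite /phi; case: cid => /= t; apply.
have phi_sec U s i : kernel_section (@ocapr _ U (cov i)) (tw s i) (mres T (@ocapl _ _ _) (phi U s)).
  have e : taut_res (osub_cap (@ocapl _ U (cov i)) (@ocapr _ _ _)) (tw s i) = tw s i.
    exact: (gres_id (G := autSheaf O n)).
  have [t st] := kernel_section_ex (@ocapr _ U (cov i)) (tw_ker s i).
  by rewrite (phiE _ _ _ _ t) //; exists i, (@ocapr _ _ _); rewrite e.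
have local U (t t' : T U) : (forall i : cidx delta,
    mres T (@ocapl _ U (cov i)) t = mres T (@ocapl _ U (cov i)) t') -> t = t'.
  move=> tt; apply: (sheaf_local_eq (mres_sheaf T)) => x Ux.
  have [i ix] := cov_covers delta x.
  by exists (ocap U (cov i)), (@ocapl _ _ _).
exists phi; split=> [U|U s t|U V h s|U f s s' ss].
- have inj : injective (phi U).
    move=> s s' e; apply: twisted_ext => i.
    apply: (kernel_section_inj (tw_ker s i) (tw_ker s' i) (phi_sec _ s i)).
    by rewrite e; exact: phi_sec.
  (* Each restriction of t comes from some g_i in the kernel. As g_i and g_j have the same image on
     overlaps, [kernel_section_conj] read backwards gives the gluing condition. *)
  have surj t : exists s, phi U s = t.
    have gex : forall i : cidx delta, exists g : taut O n (ocap U (cov i)),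
        tred (leq_pred n) g = 1%g /\
        kernel_section (@ocapr _ U (cov i)) g (mres T (@ocapl _ _ _) t).
      by move=> i; have [g] := kernel_section_surj (@ocapr _ U (cov i)) (mres T (@ocapl _ _ _) t); exists g.
    pose g i := sval (cid (gex i)); have gP i := svalP (cid (gex i)).
    have gg i j V (hi : osub V (ocap U (cov i))) (hj : osub V (ocap U (cov j)))
        (hij : osub V (ocap (cov i) (cov j))) :
        conj_action (leq_pred n) (taut_res hij (coc (c := delta) i j))
          (taut_res hj (g j)) (taut_res hi (g i)).
      have ki := osub_trans (@ocapr _ U (cov i)) hi; have kj := osub_trans (@ocapr _ U (cov j)) hj.
      have hU := osub_trans (@ocapl _ U (cov i)) hi.
      apply/(kernel_section_conj hij _ _ (kernel_section_res kj hj (gP j).2)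
        (kernel_section_res ki hi (gP i).2)).
      - by rewrite tred_res (gP j).1 taut_res_1.
      - by rewrite tred_res (gP i).1 taut_res_1.
      by rewrite !(mres_comp _ _ hU).
    pose s : tw_sheaf U := Twisted (fun i => (gP i).1) gg.
    exists s; apply: local => i.
    exact: kernel_section_fun (phi_sec U s i) (gP i).2.
  pose psi t := sval (cid (surj t)).
  have psiK t : phi U (psi t) = t by rewrite /psi; case: cid.
  by exists psi => // s; apply: inj; rewrite psiK.
- apply: local => i; rewrite raddfD.
  apply: kernel_section_fun (phi_sec U (s * t)%g i) _.
  exact: kernel_sectionM (tw_ker s i) (tw_ker t i) (phi_sec U s i) (phi_sec U t i).
- apply: local => i; rewrite (mres_comp _ _ (osub_trans h (@ocapl _ V (cov i)))).
  apply: kernel_section_fun (phi_sec V _ i).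
  have := kernel_section_res (@ocapr _ V (cov i)) (ocapS h (@osub_refl _ (cov i))) (phi_sec U s i).
  by rewrite (mres_comp _ _ (osub_trans h (@ocapl _ V (cov i)))).
- apply: local => i; rewrite mresZ.
  apply: kernel_section_fun (phi_sec U s' i) _.
  apply: kernel_sectionZ (phi_sec U s i) => V h x.
  (* Scaling multiplies g - id by f, hence also its coefficient of t^(n-1). *)
  rewrite /kpart /dpart (ss i V h (osub_trans (@ocapl _ _ _) h)).
  rewrite tcoefD tcoef_constM tcoefB addrAC subrr add0r.
  by rewrite (ares_comp _ _ (osub_trans (@ocapl _ U (cov i)) h)).
Qed.

End Fixed.

Lemma twisted_kernel_iso : exists phi : forall U, twistSheaf (leq_pred n) delta U -> T U,
    [/\ forall U, bijective (phi U),
        forall U s t, phi U (s * t)%g = phi U s + phi U t,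
        forall U V (h : osub V U) s,
          mres T h (phi U s) = phi V (gres (twistSheaf (leq_pred n) delta) h s)
      & forall U (f : O U) s s', twisted_scale f s s' ->
          phi U s' = f *: phi U s].
Proof.
have [lam [lam_gen lam_change]] := local_power_generators.
exact: twisted_kernel_iso_of_generators lam_gen lam_change.
Qed.

End TwistedKernelTensor.

Theorem proposition4p4p2 (R : realType) (X : topologicalType)
    (OX : algSheaf R[i] X) (hX : smooth_connected_variety OX)
    (n : nat) (hn : (2 < n)%N) (gn : H1 (autSheaf OX n))
    (delta : cocycle (autSheaf OX n.-1))
    (hdelta : represents (H1_map (rho OX (leq_pred n)) gn) delta)
    (OY : algSheaf R[i] X) (p : algHom OY OX)
    (hY : multiple_scheme_of p (H1_map (rho OX (ltnW hn)) gn))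
    (L : modSheaf OX) (l : forall U, OY U -> L U) (hL : is_conormal p l)
    (Om : modSheaf OY) (d : forall U, OY U -> Om U) (hOm : is_differentials d)
    (OmX : modSheaf OX) (r : forall U, Om U -> OmX U)
    (hOmX : is_restriction p r)
    (Lpow : modSheaf OX) (hLpow : tensor_power L n.-1 Lpow)
    (T : modSheaf OX) (b : forall U, dual_module OmX U -> Lpow U -> T U)
    (hT : is_tensor b) :
  exists phi : forall U, twistSheaf (leq_pred n) delta U -> T U,
    [/\ forall U, bijective (phi U),
        forall U s t, phi U (s * t)%g = phi U s + phi U t,
        forall U V (h : osub V U) s,
          mres T h (phi U s) = phi V (gres (twistSheaf (leq_pred n) delta) h s)
      & forall U (f : OX U) s s', twisted_scale f s s' ->
          phi U s' = f *: phi U s].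
Proof.
have [smO _ _ _ _] := hX.
have n'1 : (1 < n.-1)%N by rewrite -ltnS prednK // (ltnW (ltnW hn)).
(* Adapted trivializations must use [delta] modulo t^2, so this cocycle has to be recognized as a
   representative of g_2. *)
have hdelta2 := represents_tred n'1 (ltnW hn) hdelta.
have [tau htau] := trivializations_change hY hdelta2.
exact: (twisted_kernel_iso smO hn htau hL hOm hOmX hLpow hT).
Qed.
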